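(* Assume that $k$ is uncountable. Let $X$ be an algebraic torus and let $Y$ be an irreducible normal affine variety over $k$ such that $\mathrm{Aut}(X)$ and $\mathrm{Aut}(Y)$ are isomorphic as (abstract) groups and $\dim Y \le \dim X$. Then $X$ and $Y$ are isomorphic as varieties.
   Context: $k$ is an algebraically closed field of characteristic zero. An algebraic torus is a variety isomorphic to $\mathbb{G}_m^n$ for some $n\ge 0$. $\mathrm{Aut}(X)$ is the group of all automorphisms of the $k$-variety $X$ (not only group automorphisms of the torus). *)

(* Defs.v *)
From HB Require Import structures.
From mathcomp Require Export all_boot all_order all_algebra.
From mathcomp Require Export ring_quotient.
From mathcomp Require Export boolp classical_sets functions cardinality.
From mathcomp Require Export mpoly.

Set Implicit Arguments.
Unset Strict Implicit.
Unset Printing Implicit Defensive.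

Import GRing.Theory.

Local Open Scope classical_set_scope.
Local Open Scope ring_scope.

Section ZariskiTopology.
Variables (k : fieldType) (n : nat).
Implicit Types (S : set {mpoly k[n]}) (A B V : set ('I_n -> k)).

Definition zero_locus S : set ('I_n -> k) :=
  [set x | forall p, S p -> p.@[x] = 0].

Definition zariski_closed V : Prop := exists S, V = zero_locus S.

(* Meant for Zariski closed V, in which case the subsets of V that are closed
   in V are exactly the closed subsets of affine space contained in V. *)
Definition irreducible V : Prop :=
  V !=set0 /\
  forall A B, zariski_closed A -> zariski_closed B ->
    V = A `|` B -> V = A \/ V = B.

Definition has_irreducible_chain V (d : nat) : Prop :=
  exists Z : 'I_d.+1 -> set ('I_n -> k),
    (forall i, [/\ zariski_closed (Z i), irreducible (Z i) & Z i `<=` V]) /\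
    (forall i j : 'I_d.+1, (i < j)%N -> Z i `<` Z j).

(* For V nonempty and closed the set of lengths contains 0 and is bounded by n,
   so the supremum is a maximum; the default value 0 only concerns V = set0. *)
Definition krull_dim V : nat := supremum 0%N [set d | has_irreducible_chain V d].

End ZariskiTopology.

(* An affine k-variety, k algebraically closed, is given by the set of its
   k-points in some affine space; it may be reducible. *)
Record affine_variety (k : fieldType) := AffineVariety {
  ambient_dim : nat;
  points :> set ('I_ambient_dim -> k);
  points_closed : zariski_closed points }.

Arguments points {k} a _.

Record irr_affine_variety (k : fieldType) := IrrAffineVariety {
  irr_variety :> affine_variety k;
  irr_varietyP : irreducible (points irr_variety) }.

Section Morphisms.
Variable k : fieldType.

Definition morphism (X Y : affine_variety k) (f : X -> Y) : Prop :=
  exists P : 'I_(ambient_dim Y) -> {mpoly k[ambient_dim X]},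
    forall (x : X) i, \val (f x) i = (P i).@[\val x].

Definition isomorphic (X Y : affine_variety k) : Prop :=
  exists (f : X -> Y) (g : Y -> X),
    [/\ morphism f, morphism g, cancel f g & cancel g f].

Definition is_automorphism (X : affine_variety k) (f : X -> X) : Prop :=
  exists g : X -> X, [/\ morphism f, morphism g, cancel f g & cancel g f].

Lemma morphism_id (X : affine_variety k) : morphism (@id X).
Proof. by exists (fun i => 'X_i) => x i; rewrite mevalXU. Qed.

Lemma morphism_comp (X Y Z : affine_variety k) (f : Y -> Z) (g : X -> Y) :
  morphism f -> morphism g -> morphism (f \o g).
Proof.
move=> [P fP] [Q gQ].
exists (fun i => (P i) \mPo [tuple Q j | j < ambient_dim Y]) => x i /=.
rewrite fP comp_mpoly_meval; congr meval; apply/funext => j.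
by rewrite gQ tnth_map tnth_ord_tuple.
Qed.

End Morphisms.

Section AutomorphismGroup.
Variables (k : fieldType) (X : affine_variety k).

Record Aut := MkAut {
  aut_fun :> X -> X;
  _ : `[< is_automorphism aut_fun >] }.

HB.instance Definition _ := [isSub for aut_fun].
HB.instance Definition _ := [Choice of Aut by <:].

Lemma autP (f : Aut) : is_automorphism f.
Proof. by apply/asboolP; case: f. Qed.

Lemma aut_one_subproof : is_automorphism (@id X).
Proof. by exists id; split=> //; apply: morphism_id. Qed.

Lemma aut_mul_subproof (f g : Aut) : is_automorphism (f \o g).
Proof.
have [f' [mf mf' ff' f'f]] := autP f; have [g' [mg mg' gg' g'g]] := autP g.
exists (g' \o f'); split; first exact: morphism_comp.
- exact: morphism_comp.
- exact: can_comp.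
- exact: can_comp.
Qed.

Definition aut_inv_fun (f : Aut) : X -> X := sval (cid (autP f)).

Lemma aut_funK (f : Aut) : cancel f (aut_inv_fun f).
Proof. by rewrite /aut_inv_fun; case: cid => g []. Qed.

Lemma aut_inv_funK (f : Aut) : cancel (aut_inv_fun f) f.
Proof. by rewrite /aut_inv_fun; case: cid => g []. Qed.

Lemma aut_inv_subproof (f : Aut) : is_automorphism (aut_inv_fun f).
Proof. by rewrite /aut_inv_fun; case: cid => g [? ? ? ?]; exists f. Qed.

Definition aut_one : Aut := MkAut (asboolT aut_one_subproof).
Definition aut_mul (f g : Aut) : Aut := MkAut (asboolT (aut_mul_subproof f g)).
Definition aut_inv (f : Aut) : Aut := MkAut (asboolT (aut_inv_subproof f)).

Lemma aut_mulA : associative aut_mul. Proof. by move=> f g h; apply/val_inj. Qed.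
Lemma aut_1mul : left_id aut_one aut_mul. Proof. by move=> f; apply/val_inj. Qed.
Lemma aut_mul1 : right_id aut_one aut_mul. Proof. by move=> f; apply/val_inj. Qed.

Lemma aut_Vmul : left_inverse aut_one aut_inv aut_mul.
Proof. by move=> f; apply/val_inj/funext => x /=; rewrite aut_funK. Qed.

Lemma aut_mulV : right_inverse aut_one aut_inv aut_mul.
Proof. by move=> f; apply/val_inj/funext => x /=; rewrite aut_inv_funK. Qed.

HB.instance Definition _ :=
  isGroup.Build Aut aut_mulA aut_1mul aut_mul1 aut_Vmul aut_mulV.

End AutomorphismGroup.

Definition group_isomorphic (G H : groupType) : Prop :=
  exists phi : {multiplicative G -> H}, bijective phi.

Section Torus.
Variables (k : fieldType) (n : nat).

(* G_m^n, embedded in affine 2n-space as the set of (x, y) with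
   x_i y_i = 1 for all i < n. *)
Definition Gm_power : affine_variety k :=
  @AffineVariety k (n + n)
    (zero_locus [set 'X_(lshift n i) * 'X_(rshift n i) - 1 | i in [set: 'I_n]])
    (ex_intro _ _ erefl).

End Torus.

Definition algebraic_torus (k : fieldType) (X : affine_variety k) : Prop :=
  exists n : nat, isomorphic X (Gm_power k n).

Section CoordinateRing.
Variables (k : fieldType) (Y : irr_affine_variety k).
Local Notation n := (ambient_dim Y).

Definition vanishing_ideal : pred {mpoly k[n]} :=
  fun p => `[< forall x, points Y x -> p.@[x] = 0 >].

Lemma vanishingP (p : {mpoly k[n]}) :
  reflect (forall x, points Y x -> p.@[x] = 0) (p \in vanishing_ideal).
Proof. exact: asboolP. Qed.

Lemma vanishing_idealr_closed : idealr_closed vanishing_ideal.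
Proof.
split.
- by apply/vanishingP => x _; rewrite meval0.
- have [[x Yx] _] := irr_varietyP Y.
  apply/negP => /vanishingP/(_ x Yx); rewrite meval1 => /eqP.
  by rewrite oner_eq0.
- move=> a u v /vanishingP u0 /vanishingP v0; apply/vanishingP => x Yx.
  by rewrite mevalD mevalM u0// v0// mulr0 addr0.
Qed.

Lemma vanishing_prime : prime_idealr_closed vanishing_ideal.
Proof.
move=> p q /vanishingP pq0.
have [_ irrY] := irr_varietyP Y.
have [S YS] := points_closed Y.
pose Z r := zero_locus (fun s => S s \/ s = r).
have ZE r : Z r = [set x | points Y x /\ r.@[x] = 0].
  apply/seteqP; split => [x Zx|x [Yx rx] s].
    split; first by rewrite YS => s Ss; apply: Zx; left.
    by apply: Zx; right.
  by case=> [Ss|->//]; move: Yx; rewrite YS; apply.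
have closedZ r : zariski_closed (Z r) by exists (fun s => S s \/ s = r).
have : points Y = Z p `|` Z q.
  rewrite !ZE; apply/seteqP; split => [x Yx|x [[]|[]]//].
  have /eqP := pq0 x Yx; rewrite mevalM mulf_eq0 => /orP[]/eqP; by [left|right].
case/(irrY _ _ (closedZ p) (closedZ q)) => YZ; apply/orP.
- by left; apply/vanishingP => x; rewrite YZ ZE => -[].
- by right; apply/vanishingP => x; rewrite YZ ZE => -[].
Qed.

HB.instance Definition _ := isIdealr.Build _ vanishing_ideal
  vanishing_idealr_closed.
HB.instance Definition _ := isPrimeIdealrClosed.Build _ vanishing_ideal
  vanishing_prime.

Definition coordinate_ring : Type := {ideal_quot (vanishing_ideal : prime_idealr {mpoly k[n]})}.
HB.instance Definition _ := GRing.ComNzRing.on coordinate_ring.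

Definition coord_unit : pred coordinate_ring :=
  fun x => `[< exists y, y * x = 1 >].
Definition coord_inv (x : coordinate_ring) : coordinate_ring :=
  if pselect (exists y, y * x = 1) is left h then sval (cid h) else x.

Lemma coord_mulVr : {in coord_unit, left_inverse 1 coord_inv *%R}.
Proof.
move=> x /asboolP ux; rewrite /coord_inv; case: pselect => // h.
by case: cid.
Qed.

Lemma coord_unitP (x y : coordinate_ring) : y * x = 1 -> coord_unit x.
Proof. by move=> yx; apply/asboolP; exists y. Qed.

Lemma coord_inv_out : {in [predC coord_unit], coord_inv =1 id}.
Proof.
move=> x /negP nux; rewrite /coord_inv; case: pselect => // h.
by case: nux; apply/asboolP.
Qed.

HB.instance Definition _ := GRing.ComNzRing_hasMulInverse.Build coordinate_ring
  coord_mulVr coord_unitP coord_inv_out.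

Lemma coord_idomain : GRing.integral_domain_axiom coordinate_ring.
Proof. by move=> x y; apply: Quotient.rquot_IdomainAxiom. Qed.

HB.instance Definition _ :=
  GRing.ComUnitRing_isIntegral.Build coordinate_ring coord_idomain.

End CoordinateRing.

(* In its field of fractions. *)
Definition integrally_closed (A : idomainType) : Prop :=
  forall z : {fraction A},
    integralOver (@tofrac A) z -> exists a : A, z = tofrac a.

Definition normal_variety (k : fieldType) (Y : irr_affine_variety k) : Prop :=
  integrally_closed (coordinate_ring Y).

(* Main.v *)
(** The translations of the torus X = G_m^n give a commutative subgroup T of
    Aut Y which is its own centralizer and has countable index in the following
    sense: any uncountable family of automorphisms contains two which differ by
    an element of T. This replaces every appeal to algebraic group structures.

    - As k is uncountable, some uncountable W in T has bounded degree, and after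
      passing to a subset the quotients w v^-1 of its elements act locally
      finitely on k[Y]. T has no nontrivial unipotent element, because such an
      element would put too many automorphisms outside T.
    - An element of infinite order which acts locally finitely has a generalized
      eigenspace decomposition. A character of the group generated by its
      eigenvalues, taking an odd value on one of them, gives a homomorphism
      a : k^* -> Aut Y, acting by a grading of k[Y], with a(-1) <> 1. It commutes
      with T, hence has values in T.
    - GL_n(Z), acting on X by monomial automorphisms, conjugates a into n
      commuting gradings b_i such that b_i(-1) is the translation by -1 in the
      i-th coordinate. These separate signs, so the weights of k[Y] have rank n.
    - The inversion of X negates the weights. Since dim Y <= n, functions of
      weight 0 are constant, so a nonzero weight vector z is a unit (z times its
      image under the inversion is constant) and weight spaces are lines. Thus
      k[Y] is the algebra of a free abelian group of rank n. *)

Require Import Defs.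
From mathcomp Require Import generic_quotient ring zify.

Set Implicit Arguments.
Unset Strict Implicit.
Unset Printing Implicit Defensive.

Import Order.TTheory GRing.Theory.

Local Open Scope classical_set_scope.
Local Open Scope ring_scope.

(** * Ideals of polynomial rings *)

(** The isomorphism of groups is abstract and says nothing about degrees: translations correspond to
    automorphisms of [Y] of which only cardinalities, commutation and centralizers are known.
    Uncountability turns this into geometry: degrees, exponent matrices and positions in finite sets
    of roots take countably many values, so they are constant on an uncountable subfamily. Even for
    the grading [a], the translation corresponding to [a c] depends on [c] by an uncontrolled
    homomorphism. The exception is [a (-1)]: its square is trivial, so it is a vector of signs. This
    is why the character must take an odd value, why independence of the weights is tested on signs
    only, and why transitivity of GL_n(Z) modulo 2 suffices. Weights separated by signs generate a
    lattice of finite index, not necessarily all of Z^n; the index is absorbed by extracting roots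
    in [k]. Dimension enters from two sides: algebraically independent functions produce chains of
    irreducible closed sets, which needs the Nullstellensatz, while a count of monomials bounds the
    chains on a torus. *)

Lemma nat_good_index (u : nat -> nat) (a : nat) :
  exists i, (a <= i)%N /\ forall j, (i <= j)%N -> (u i <= u j)%N.
Proof.
have [b] := ubnP (u a); elim: b a => // b IH a ltab.
have [h|h] := pselect (exists j, (a <= j)%N /\ (u j < u a)%N).
  have [j [aj uj]] := h.
  have [i [ji hi]] := IH j (leq_trans uj ltab).
  by exists i; split => //; apply: leq_trans ji.
exists a; split => // j aj; rewrite leqNgt; apply/negP => uj.
by apply: h; exists j.
Qed.

(** Each chosen index minimizes [u] on the tail that starts at it. *)
Lemma nat_monotone_subseq (u : nat -> nat) :
  exists phi : nat -> nat, (forall i j, (i < j)%N -> (phi i < phi j)%N) /\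
    forall i j, (i <= j)%N -> (u (phi i) <= u (phi j))%N.
Proof.
pose g a := sval (cid (nat_good_index u a)).
have gP a : (a <= g a)%N /\ forall j, (g a <= j)%N -> (u (g a) <= u j)%N.
  by rewrite /g; case: cid.
pose phi := fix phi i := if i is i'.+1 then g (phi i').+1 else g 0%N.
have phi_lt i j : (i < j)%N -> (phi i < phi j)%N.
  elim: j => // j IH; rewrite ltnS leq_eqVlt => /predU1P[->|/IH h] /=.
    exact: (gP _).1.
  by apply: (leq_trans h); apply/ltnW/(gP (phi j).+1).1.
exists phi; split => // i j; rewrite leq_eqVlt => /predU1P[->//|/phi_lt/ltnW].
by case: i => [|i] /= h; apply: (gP _).2.
Qed.

(** Extract subsequences one coordinate at a time, making more and more exponents nondecreasing; in
    the end any two terms are comparable. *)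
Lemma dickson (n : nat) (m : nat -> 'X_{1..n}) :
  exists i j, (i < j)%N /\ (m i <= m j)%MM.
Proof.
suff: forall l, (l <= n)%N -> exists phi : nat -> nat,
    (forall i j, (i < j)%N -> (phi i < phi j)%N) /\
    forall (c : 'I_n) i j, (c < l)%N -> (i <= j)%N ->
      (m (phi i) c <= m (phi j) c)%N.
  move=> /(_ n (leqnn n)) [phi [phi_lt phi_le]].
  exists (phi 0%N), (phi 1%N); split; first exact: phi_lt.
  by apply/mnm_lepP => c; apply: phi_le.
elim=> [_|l IH ln]; first by exists id.
have [phi [phi_lt phi_le]] := IH (ltnW ln).
have [psi [psi_lt psi_le]] :=
  nat_monotone_subseq (fun i => m (phi i) (Ordinal ln)).
have psi_mono i j : (i <= j)%N -> (psi i <= psi j)%N.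
  by rewrite leq_eqVlt => /predU1P[->//|/psi_lt/ltnW].
exists (phi \o psi); split=> [i j ij|c i j] /=; first exact/phi_lt/psi_lt.
rewrite ltnS leq_eqVlt => /predU1P[cl|cl] ij.
  have -> : c = Ordinal ln by apply: val_inj.
  exact: psi_le.
exact: phi_le (psi_mono _ _ ij).
Qed.

Section Ideals.
Variables (K : fieldType) (n : nat).
Implicit Types (I J : set {mpoly K[n]}) (p q : {mpoly K[n]}).

Definition is_ideal I :=
  [/\ I 0, forall p q, I p -> I q -> I (p + q) & forall p q, I q -> I (p * q)].

Lemma is_ideal_sum I (T : Type) (s : seq T) (P : pred T) (F : T -> {mpoly K[n]}) :
  is_ideal I -> (forall i, P i -> I (F i)) -> I (\sum_(i <- s | P i) F i).
Proof. by move=> [I0 ID _] h; elim/big_ind: _. Qed.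

Lemma is_idealZ I c p : is_ideal I -> I p -> I (c *: p).
Proof. by move=> [_ _ IM] Ip; rewrite -mul_mpolyC; apply: IM. Qed.

Lemma is_idealB I p q : is_ideal I -> I p -> I q -> I (p - q).
Proof.
move=> Iid Ip Iq; have [_ ID _] := Iid; apply: ID => //.
by rewrite -scaleN1r; apply: is_idealZ.
Qed.

(* Hilbert's basis theorem, as a maximality principle. In a strictly increasing
   chain pick p_i in I_(i+1) \ I_i with least leading monomial; if the leading
   monomial of p_i divides the one of p_j, i < j, then p_j can be reduced. *)
Lemma ideal_max (F : set (set {mpoly K[n]})) :
  F `<=` is_ideal -> F !=set0 ->
  exists2 I, F I & forall J, F J -> I `<=` J -> J = I.
Proof.
move=> Fid [I0 FI0]; apply: contrapT => nomax.
have step (I : {I | F I}) : exists Jp : {J | F J} * {mpoly K[n]},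
  [/\ sval I `<=` sval Jp.1, sval Jp.1 Jp.2, ~ sval I Jp.2 &
   forall q, sval Jp.1 q -> ~ sval I q -> ~ (mlead q < mlead Jp.2)%O].
  case: I => I FI /=.
  have [J [FJ IJ JI]] : exists J, [/\ F J, I `<=` J & ~ J `<=` I].
    apply: contrapT => h; apply: nomax; exists I => // J FJ IJ.
    apply/seteqP; split => //; apply: contrapT => JI.
    by apply: h; exists J.
  have [p Jp nIp] : exists2 p, J p & ~ I p.
    by apply: contrapT => h; apply: JI => p Jp; apply: contrapT => nIp;
       apply: h; exists p.
  suff [q [Jq nIq qmin]] : exists q, [/\ J q, ~ I q &
      forall r, J r -> ~ I r -> ~ (mlead r < mlead q)%O].
    by exists (exist _ J FJ, q).
  move: Jp nIp; elim/mleadrect: p => p IH Jp nIp.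
  have [[r [Jr nIr rp]]|h] :=
    pselect (exists r, [/\ J r, ~ I r & (mlead r < mlead p)%O]).
    exact: (IH r).
  by exists p; split => // r Jr nIr rp; apply: h; exists r.
pose next (I : {I | F I}) := sval (cid (step I)).
pose ch := fix ch i := if i is i'.+1 then (next (ch i')).1
  else exist _ I0 FI0 : {I | F I}.
pose p i := (next (ch i)).2.
have chP i : [/\ sval (ch i) `<=` sval (ch i.+1), sval (ch i.+1) (p i),
    ~ sval (ch i) (p i) & forall q, sval (ch i.+1) q -> ~ sval (ch i) q ->
    ~ (mlead q < mlead (p i))%O].
  by rewrite /p /= /next; case: cid.
have mono i j : (i <= j)%N -> sval (ch i) `<=` sval (ch j).
  elim: j => [|j IH]; first by rewrite leqn0 => /eqP->.
  rewrite leq_eqVlt => /predU1P[->//|/IH h].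
  by apply: subset_trans h _; case: (chP j).
have [i [j [ij lij]]] := dickson (fun i => mlead (p i)).
have [_ Jp nIp pmin] := chP j.
have idJ : is_ideal (sval (ch j.+1)) by apply: Fid; apply: (svalP (ch j.+1)).
have idI : is_ideal (sval (ch j)) by apply: Fid; apply: (svalP (ch j)).
have Ipi : sval (ch j) (p i) by apply: (mono i.+1 j ij); case: (chP i).
have pi0 : p i != 0.
  apply/eqP => pi0; case: (chP i) => _ _ h _; apply: h.
  by rewrite pi0; case: (Fid _ (svalP (ch i))).
have pj0 : p j != 0 by apply/eqP => pj0; apply: nIp; rewrite pj0; case: idI.
set c := mleadc (p j) / mleadc (p i).
pose mul := c *: 'X_[mlead (p j) - mlead (p i)] * p i.
have Imul : sval (ch j) mul by case: idI => _ _; apply.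
pose q := p j - mul.
have Jq : sval (ch j.+1) q by apply: is_idealB => //; apply: mono Imul.
have nIq : ~ sval (ch j) q.
  move=> Iq; apply: nIp; rewrite -(subrK mul (p j)).
  by case: idI => _ h _; apply: h.
apply: (pmin q) => //; rewrite lt_neqAle.
have lci : mleadc (p i) != 0 by rewrite mleadc_eq0.
have lcj : mleadc (p j) != 0 by rewrite mleadc_eq0.
have c0 : c != 0 by rewrite mulf_neq0 ?invr_neq0.
have lmul : mlead mul = mlead (p j).
  rewrite mleadM_proper; last first.
    by rewrite mulf_neq0 // mleadc_eq0 -msize_poly_eq0 msizeZ_proper
      ?msizeX ?mleadXm ?mcoeffX ?eqxx ?mulr1.
  by rewrite mleadZ_proper ?mleadXm ?mcoeffX ?eqxx ?mulr1 // submK.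
apply/andP; split; last first.
  apply: le_trans (mleadB_le _ _) _.
  by rewrite lmul joinxx.
apply/negP => /eqP lq.
have q0 : q != 0 by apply/eqP => q0; apply: nIq; rewrite q0; case: idI.
suff : mleadc q == 0 by rewrite mleadc_eq0 (negbTE q0).
have cX : ('X_[mlead (p j) - mlead (p i)] * p i)@_(mlead (p j)) = mleadc (p i).
  by rewrite mulrC -[X in _@_X](submK lij) mcoeffMX.
by rewrite lq /q mcoeffB /mul -scalerAl mcoeffZ cX /c divfK // subrr.
Qed.

(** An ideal maximal among those disjoint from a multiplicative set is prime. The last clause
    records the maximality: modulo [P], every [p] outside [P] divides an element of [S]. *)
Lemma max_disjoint_ideal (J S : set {mpoly K[n]}) :
  is_ideal J -> (forall p, J p -> ~ S p) -> S 1 ->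
  (forall p q, S p -> S q -> S (p * q)) ->
  exists P, [/\ is_ideal P, J `<=` P, forall p, P p -> ~ S p,
    forall p q, P (p * q) -> P p \/ P q &
    forall p, ~ P p -> exists a b, [/\ P a & S (a + b * p)]].
Proof.
move=> Jid JS S1 SM.
pose F := [set I | [/\ is_ideal I, J `<=` I & forall p, I p -> ~ S p]].
have [P [Pid JP PS] Pmax] : exists2 I, F I & forall J, F J -> I `<=` J -> J = I.
  apply: ideal_max; first by move=> I [].
  by exists J; split.
have [P0 PD PM] := Pid.
have meets p : ~ P p -> exists a b, [/\ P a & S (a + b * p)].
  move=> nPp; apply: contrapT => h; apply: nPp.
  pose Q := [set x | exists a b, P a /\ x = a + b * p].
  have PQ : P `<=` Q by move=> x Px; exists x, 0; rewrite mul0r addr0.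
  have -> : P = Q.
    apply/esym/Pmax => //; split.
    - split; first exact: PQ.
        move=> _ _ [a [b [Pa ->]]] [a' [b' [Pa' ->]]]; exists (a + a'), (b + b').
        by split; [exact: PD|ring].
      move=> x _ [a [b [Pa ->]]]; exists (x * a), (x * b).
      by split; [exact: PM|ring].
    - exact: subset_trans JP PQ.
    - by move=> _ [a [b [Pa ->]]] Sx; apply: h; exists a, b.
  by exists 0, 1; rewrite add0r mul1r.
exists P; split=> // p q Ppq; apply: contrapT => /not_orP[nPp nPq].
have [a [b [Pa Sp]]] := meets _ nPp; have [a' [b' [Pa' Sq]]] := meets _ nPq.
apply: PS (SM _ _ Sp Sq).
have -> : (a + b * p) * (a' + b' * q) =
  (a' + b' * q) * a + ((b * p) * a' + (b * b') * (p * q)) by ring.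
by apply: PD (PM _ _ Pa) (PD _ _ (PM _ _ Pa') (PM _ _ Ppq)).
Qed.

End Ideals.

(** * The Nullstellensatz *)

Lemma mpoly_ring_ind (R : comNzRingType) (n : nat) (Q : {mpoly R[n]} -> Prop) :
  (forall c, Q c%:MP) -> (forall i, Q 'X_i) ->
  (forall p q, Q p -> Q q -> Q (p + q)) ->
  (forall p q, Q p -> Q q -> Q (p * q)) -> forall p, Q p.
Proof.
move=> QC QX QD QM; apply: mpolyind => [|c m p _ _ Qp]; first exact: QC 0.
apply: (QD) => //; rewrite -mul_mpolyC; apply: (QM) => //.
rewrite mpolyXE_id; elim/big_ind: _ => //; first exact: QC 1.
move=> i _; elim: (m i) => [|e IH]; first exact: QC 1.
by rewrite exprS; apply: QM.
Qed.

Lemma linear_dependence (F : fieldType) (m d : nat) (v : 'I_m -> 'I_d -> F) :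
  (d < m)%N -> exists c : 'I_m -> F, (exists i, c i != 0) /\
    forall j, \sum_i c i * v i j = 0.
Proof.
move=> dm; pose M := \matrix_(i < m, j < d) v i j.
have : kermx M != 0.
  rewrite -mxrank_eq0 mxrank_ker subn_eq0 -ltnNge.
  exact: leq_ltn_trans (rank_leq_col M) dm.
case/rowV0Pn => u /sub_kermxP uM u0; exists (u 0); split.
  by apply/existsP; apply: contra_neqT u0 => /existsPn h; apply/rowP => i;
     rewrite mxE; apply/eqP/negPn/h.
move=> j; have := congr1 (fun A : 'M_(1, d) => A 0 j) uM.
rewrite [X in X = _]mxE [X in _ = X]mxE => uMj; rewrite -[RHS]uMj.
by apply: eq_bigr => i _; rewrite [M i j]mxE.
Qed.

Lemma linear_dependence_fin (F : fieldType) (m : nat) (J : finType)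
    (v : 'I_m -> J -> F) :
  (#|J| < m)%N -> exists c : 'I_m -> F, (exists i, c i != 0) /\
    forall j, \sum_i c i * v i j = 0.
Proof.
move=> /(linear_dependence (fun i j => v i (enum_val j)))[c [c0 cv]].
by exists c; split => // j; rewrite -[j]enum_rankK cv.
Qed.

Lemma mpoly_dependence (F : fieldType) (n m D : nat) (h : 'I_m -> {mpoly F[n]}) :
  (forall i, msize (h i) <= D)%N -> (#|{: 'X_{1..n < D}}| < m)%N ->
  exists c : 'I_m -> F, (exists i, c i != 0) /\ \sum_i c i *: h i = 0.
Proof.
move=> hD /(linear_dependence_fin (fun i (j : 'X_{1..n < D}) => (h i)@_j)).
case=> c [c0 cv]; exists c; split => //.
apply/mpolyP => u; rewrite mcoeff0 raddf_sum /=.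
have [uD|Du] := ltnP (mdeg u) D.
  by rewrite -[RHS](cv (BMultinom uD)); apply: eq_bigr => i _; rewrite mcoeffZ.
rewrite big1 // => i _; rewrite mcoeffZ [_@_u]memN_msupp_eq0 ?mulr0 //.
by apply: msize_mdeg_ge; apply: leq_trans Du.
Qed.

(** Countable pigeonhole. Discrete data are encoded in [nat], often by [pickle], to be made constant
    on an uncountable set. *)
Lemma uncountable_fiber (T : Type) (A : set T) (f : T -> nat) :
  ~ countable A -> exists i, ~ countable (A `&` [set x | f x = i]).
Proof.
move=> unc; apply: contrapT => h; apply: unc.
have -> : A = \bigcup_(i in [set: nat]) (A `&` [set x | f x = i]).
  by apply/seteqP; split => [x Ax|x [i _ []]//]; exists (f x).
apply: bigcup_countable => // i _; apply: contrapT => hi; apply: h.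
by exists i.
Qed.

Lemma uncountable_uniq_seq (T : choiceType) (A : set T) (m : nat) :
  ~ countable A -> exists s : seq T, [/\ uniq s, size s = m & {in s, forall x, A x}].
Proof.
move=> unc; elim: m => [|m [s [us ss sA]]]; first by exists [::].
suff [x Ax xs] : exists2 x, A x & x \notin s.
  exists (x :: s); split; rewrite /= ?xs ?ss // => y.
  by rewrite inE => /predU1P[->//|/sA].
apply: contrapT => h; apply: unc.
apply: (@sub_countable _ _ _ [set` s]).
  apply: subset_card_le => x Ax; apply: contrapT => /negP xs; apply: h.
  by exists x.
exact/finite_set_countable/finite_seq.
Qed.

Section Resolvent.
Variables (k : fieldType) (n : nat).
Hypothesis k_unc : ~ countable [set: k].

(** Once the code and a bound on the degree are fixed, uncountably many [h a] lie in one finite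
    dimensional space of polynomials. In the Nullstellensatz, [code] carries the exponent of [g]. *)
Lemma resolvent_dependence (h : k -> {mpoly k[n]}) (code : k -> nat) :
  exists e (s : seq k) (c : k -> k), [/\ uniq s, {in s, forall a, code a = e},
    exists2 a, a \in s & c a != 0 & \sum_(a <- s) c a *: h a = 0].
Proof.
have [e unce] := uncountable_fiber code k_unc.
have [D uncD] := uncountable_fiber (fun a => msize (h a)) unce.
have [s [us ss sA]] := uncountable_uniq_seq #|{: 'X_{1..n < D}}|.+1 uncD.
have ssx i : (i < #|{: 'X_{1..n < D}}|.+1)%N -> s`_i \in s.
  by move=> hi; rewrite mem_nth ?ss.
have [||c [[i ci] cv]] := @mpoly_dependence k n #|{: 'X_{1..n < D}}|.+1 D
    (fun i => h s`_i).
- by move=> i; have [_ ->] := sA _ (ssx _ (ltn_ord i)).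
- by rewrite ltnS.
exists e, s, (fun a => c (inord (index a s))).
have idx (j : 'I_#|{: 'X_{1..n < D}}|.+1) : inord (index s`_j s) = j.
  by rewrite index_uniq ?ss // inord_val.
split => //.
- by move=> a /sA[[_ ->]].
- by exists s`_i; rewrite ?ssx // idx.
rewrite (big_nth 0) ss big_mkord -[RHS]cv.
by apply: eq_bigr => j _; rewrite idx.
Qed.

Variable R : comNzRingType.
Implicit Types (s : seq k) (w : k -> R) (phi : k -> R) (x : R).

(* What remains of the sum of the w_a / (x - a) after clearing denominators. *)
Definition resolvent_numerator s w phi x : R :=
  \sum_(a <- s) w a * \prod_(b <- s | b != a) (x - phi b).

Lemma resolvent_numeratorD s w w' phi x :
  resolvent_numerator s (fun a => w a + w' a) phi x =
  resolvent_numerator s w phi x + resolvent_numerator s w' phi x.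
Proof. by rewrite -big_split; apply: eq_bigr => a _; rewrite mulrDl. Qed.

Lemma resolvent_numerator_mul s w phi x : uniq s ->
  resolvent_numerator s (fun a => w a * (x - phi a)) phi x =
  (\sum_(a <- s) w a) * \prod_(b <- s) (x - phi b).
Proof.
move=> us; rewrite /resolvent_numerator mulr_suml.
by apply: eq_big_seq => a sa; rewrite [in RHS](bigD1_seq a) //= mulrA.
Qed.

Lemma resolvent_numerator_root s w phi a : uniq s -> a \in s ->
  resolvent_numerator s w phi (phi a) =
  w a * \prod_(b <- s | b != a) (phi a - phi b).
Proof.
move=> us sa; rewrite /resolvent_numerator (bigD1_seq a) //= [X in _ + X]big1 ?addr0 //.
move=> b ba; rewrite -big_filter (bigD1_seq a) ?filter_uniq //= ?mem_filter.
  by rewrite subrr mul0r mulr0.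
by rewrite eq_sym ba sa.
Qed.

End Resolvent.

(** Modulo [P], [u a] is [h a] times the factor [x - a], so the numerator becomes the vanishing sum
    of the [c a *: h a] times the product of all factors. *)
Lemma resolvent_ideal (k : fieldType) (n : nat) (P : set {mpoly k[n]})
    (s : seq k) (c : k -> k) (u p h : k -> {mpoly k[n]}) (x : {mpoly k[n]}) :
  is_ideal P -> uniq s -> (forall a, P (p a)) ->
  (forall a, u a = p a + h a * (x - a%:MP)) -> \sum_(a <- s) c a *: h a = 0 ->
  P (resolvent_numerator s (fun a => c a *: u a) (@mpolyC n k) x).
Proof.
move=> Pid us Pp uE ch; have [P0 PD PM] := Pid.
have -> : (fun a => c a *: u a) =
    fun a => c a *: p a + (c a *: h a) * (x - a%:MP).
  by apply/funext => a; rewrite uE scalerDr scalerAl.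
rewrite resolvent_numeratorD; apply: PD.
  apply: is_ideal_sum => // a _; rewrite mulrC; apply: PM.
  exact: is_idealZ.
by rewrite resolvent_numerator_mul // ch mul0r.
Qed.

Section Nullstellensatz.
Variables (k : closedFieldType) (n : nat).
Hypothesis k_unc : ~ countable [set: k].

(* If x - a is not in the maximal ideal P for any a, then g^e / (x - a) exists
   modulo P for all a; uncountably many elements of a space of countable
   dimension are dependent, which makes x algebraic over k modulo P. *)
Lemma nullstellensatz (J : set {mpoly k[n]}) (g : {mpoly k[n]}) :
  is_ideal J -> (forall e, ~ J (g ^+ e)) ->
  exists v : 'I_n -> k, (forall p, J p -> p.@[v] = 0) /\ g.@[v] != 0.
Proof.
move=> Jid Jg; pose S := [set g ^+ e | e in [set: nat]].
have [||_ _ [e _ <-] [e' _ <-]|P [Pid JP PS Pprime meets]] :=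
  @max_disjoint_ideal k n J S Jid.
- by move=> p Jp [e _ ep]; apply: (Jg e); rewrite ep.
- by exists 0%N.
- by exists (e + e')%N => //; rewrite exprD.
have [P0 PD PM] := Pid.
have nP1 : ~ P 1 by move=> P1; apply: (PS 1) => //; exists 0%N.
have nPC c : c != 0 -> ~ P c%:MP.
  move=> c0 Pc; apply: nP1.
  by have := PM (c^-1)%:MP _ Pc; rewrite -mpolyCM mulVf.
have Pprod (s : seq k) (F : k -> {mpoly k[n]}) :
    P (\prod_(i <- s) F i) -> exists i, P (F i).
  elim: s => [|i s IH]; rewrite ?big_nil // big_cons => /Pprime[Pi|/IH//].
  by exists i.
have coord x : exists a, P (x - a%:MP).
  apply: contrapT => nPa.
  have /choice[hx hxP] : forall a, exists t : {mpoly k[n]} * {mpoly k[n]} * nat,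
      P t.1.1 /\ g ^+ t.2 = t.1.1 + t.1.2 * (x - a%:MP).
    move=> a; have [|p [b [Pp [e _ eE]]]] := meets (x - a%:MP).
      by move=> Pxa; apply: nPa; exists a.
    by exists (p, b, e).
  have [e [s [c [us se [a0 a0s ca0] ch]]]] :=
    resolvent_dependence k_unc (fun a => (hx a).1.2) (fun a => (hx a).2).
  (* [g ^+ e] times the value of [H] at [x] lies in [P], while at [a0] only the term of [a0]
     survives. So [H] is a nonzero polynomial in one variable, and one of its linear factors at [x]
     lies in the prime [P]. *)
  pose H : {poly k} := resolvent_numerator s (polyC \o c) polyC 'X.
  pose ev (p : {poly k}) := (map_poly (@mpolyC n k) p).[x].
  have evH : g ^+ e * ev H =
      resolvent_numerator s (fun a => c a *: g ^+ e) (@mpolyC n k) x.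
    rewrite /ev rmorph_sum horner_sum mulr_sumr; apply: eq_bigr => a _ /=.
    rewrite rmorphM /= map_polyC hornerCM mulrA -mul_mpolyC [_ * g ^+ e]mulrC.
    congr (_ * _); rewrite rmorph_prod horner_prod; apply: eq_bigr => b _.
    by rewrite rmorphB /= map_polyX map_polyC !hornerE.
  have PH : P (g ^+ e * ev H).
    rewrite evH.
    have -> : resolvent_numerator s (fun a => c a *: g ^+ e) (@mpolyC n k) x =
        resolvent_numerator s (fun a => c a *: g ^+ (hx a).2) (@mpolyC n k) x.
      by apply: eq_big_seq => a /se ->.
    apply: (@resolvent_ideal _ _ _ _ _ _ (fun a => (hx a).1.1)
       (fun a => (hx a).1.2)) => // a; by case: (hxP a).
  have H0 : H != 0.
    have : H.[a0] != 0.
      have -> : H.[a0] = resolvent_numerator s c id a0.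
        rewrite horner_sum; apply: eq_bigr => a _.
        rewrite hornerCM horner_prod; congr (_ * _).
        by apply: eq_bigr => b _; rewrite !hornerE.
      rewrite resolvent_numerator_root // mulf_neq0 // prodf_seq_neq0.
      by apply/allP => b _; apply/implyP; rewrite subr_eq0 eq_sym.
    by apply: contraNneq => ->; rewrite horner0.
  have {PH} : P (ev H).
    case/Pprime: PH => // Pge; case: (PS _ Pge); by exists e.
  have [r ->] := closed_field_poly_normal H.
  rewrite /ev map_polyZ hornerZ => /Pprime[]; first by apply: nPC; rewrite lead_coef_eq0.
  rewrite rmorph_prod horner_prod => /Pprod[i].
  by rewrite rmorphB /= map_polyX map_polyC !hornerE => Pi; apply: nPa; exists i.
have /choice[v vP] : forall i : 'I_n, exists a, P ('X_i - a%:MP) by move=> i.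
have Pv p : P (p - (p.@[v])%:MP).
  elim/mpoly_ring_ind: p => [c|i|p q Pp Pq|p q Pp Pq].
  - by rewrite mevalC subrr.
  - by rewrite mevalXU.
  - have -> : p + q - ((p + q).@[v])%:MP =
      (p - (p.@[v])%:MP) + (q - (q.@[v])%:MP) by rewrite mevalD mpolyCD; ring.
    exact: PD.
  - have -> : p * q - ((p * q).@[v])%:MP =
      q * (p - (p.@[v])%:MP) + (p.@[v])%:MP * (q - (q.@[v])%:MP).
      by rewrite mevalM mpolyCM; ring.
    by apply: PD; apply: PM.
exists v; split=> [p /JP Pp|].
  apply: contrapT => /eqP/nPC; apply.
  have -> : (p.@[v])%:MP = p - (p - (p.@[v])%:MP) by ring.
  exact: is_idealB.
apply/eqP => gv; apply: (PS g); last by exists 1%N; rewrite ?expr1.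
by have := Pv g; rewrite gv mpolyC0 subr0.
Qed.

End Nullstellensatz.

(** * Algebraic dependence *)

Lemma leq_expl (a b e : nat) : (a <= b)%N -> (a ^ e <= b ^ e)%N.
Proof. by move=> ab; elim: e => // e IH; rewrite !expnS leq_mul. Qed.

Section DegreeCount.
Variable K : fieldType.

Definition mdeg_le n (b : nat) (p : {mpoly K[n]}) :=
  forall m, m \in msupp p -> (mdeg m <= b)%N.

Lemma mdeg_leP n b (p : {mpoly K[n]}) : mdeg_le b p -> (msize p <= b.+1)%N.
Proof.
move=> h; rewrite msizeE big_seq_cond.
by apply/bigmax_leqP_seq => m _ /andP[/h].
Qed.

Lemma mdeg_le_msize n (p : {mpoly K[n]}) : mdeg_le (msize p) p.
Proof. by move=> m /msize_mdeg_lt/ltnW. Qed.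

Lemma mdeg_leW n b b' (p : {mpoly K[n]}) : (b <= b')%N -> mdeg_le b p -> mdeg_le b' p.
Proof. by move=> bb h m /h; move/leq_trans; apply. Qed.

Lemma mdeg_le1 n b : mdeg_le b (1 : {mpoly K[n]}).
Proof. by move=> m; rewrite msupp1 inE => /eqP->; rewrite mdeg0. Qed.

Lemma mdeg_leM n b b' (p q : {mpoly K[n]}) :
  mdeg_le b p -> mdeg_le b' q -> mdeg_le (b + b') (p * q).
Proof.
move=> hp hq m /msuppM_le/allpairsP[[u v] /= [/hp up /hq vq ->]].
by rewrite mdegD leq_add.
Qed.

Lemma mdeg_leX n b (p : {mpoly K[n]}) e : mdeg_le b p -> mdeg_le (e * b) (p ^+ e).
Proof.
move=> hp; elim: e => [|e IH]; first exact: mdeg_le1.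
by rewrite exprS mulSn; apply: mdeg_leM.
Qed.

Lemma mdeg_le_prod n (I : finType) (e : I -> nat) b (p : I -> {mpoly K[n]}) :
  (forall i, mdeg_le b (p i)) ->
  mdeg_le ((\sum_i e i) * b) (\prod_i p i ^+ e i).
Proof.
move=> hp; elim/big_rec2: _ => [|i m q _ IH]; first exact: mdeg_le1.
by rewrite mulnDl; apply: mdeg_leM => //; apply: mdeg_leX.
Qed.

Lemma card_bmultinom n b : (#|{: 'X_{1..n < b}}| <= b ^ n)%N.
Proof.
have lt (m : 'X_{1..n < b}) i : (m i < b)%N.
  by apply: leq_ltn_trans (bmdeg m); rewrite mdegE (bigD1 i) //= leq_addr.
pose f m : {ffun 'I_n -> 'I_b} := [ffun i => Ordinal (lt m i)].
have finj : injective f.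
  move=> m m' /ffunP e; apply/val_inj/mnmP => i.
  by have := congr1 val (e i); rewrite !ffunE.
by have := leq_card f finj; rewrite card_ffun !card_ord.
Qed.

(* Counting: the B^d products of the p_i and h of degree d B, with all
   exponents of the p_i less than B, live in a space of dimension O(B^n). *)
Lemma rational_dependence n d (p : 'I_d -> {mpoly K[n]}) (h : {mpoly K[n]}) :
  (n < d)%N -> exists q : {mpoly K[d]}, q != 0 /\
    forall v, h.@[v] != 0 -> q.@[fun i => (p i).@[v] / h.@[v]] = 0.
Proof.
move=> nd.
pose b := (msize h + \sum_i msize (p i))%N.
have hb : mdeg_le b h by apply: (mdeg_leW _ (@mdeg_le_msize _ h)); apply: leq_addr.
have pb i : mdeg_le b (p i).
  apply: (mdeg_leW _ (@mdeg_le_msize _ _)).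
  by rewrite /b (bigD1 i) //= addnCA leq_addr.
(* [B] exceeds [(d b + 1)^n], whence [(d B b + 1)^n <= B^n (d b + 1)^n < B^(n+1) <= B^d]: there are
   more products than dimensions. *)
pose B := ((d * b).+1 ^ n).+1.
pose I := {ffun 'I_d -> 'I_B}.
pose e (m : I) := (\sum_i m i)%N.
have eB m : (e m <= d * B)%N.
  apply: (@leq_trans (\sum_(i < d) B)); last by rewrite sum_nat_const card_ord.
  by apply: leq_sum => i _; apply/ltnW/ltn_ord.
(* The powers of [h] give all monomials in the [p i / h] the common denominator [h ^+ (d * B)]. *)
pose r (m : I) := h ^+ (d * B - e m) * \prod_i p i ^+ m i.
have rb m : (msize (r m) <= (d * B * b).+1)%N.
  apply: mdeg_leP; rewrite -{1}(subnK (eB m)) mulnDl.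
  by apply: mdeg_leM; [apply: mdeg_leX|apply: mdeg_le_prod].
have lt : (#|{: 'X_{1..n < (d * B * b).+1}}| < #|{: I}|)%N.
  apply: leq_ltn_trans (card_bmultinom _ _) _.
  rewrite card_ffun !card_ord; apply: (@leq_trans (B ^ n.+1)); last first.
    exact: leq_pexp2l.
  have : ((d * B * b).+1 ^ n <= (B * (d * b).+1) ^ n)%N.
    apply: leq_expl; nia.
  move=> /leq_ltn_trans; apply; rewrite expnMn expnSr ltn_mul2l expn_gt0 /=.
  exact: ltnSn.
have [c [[i0 ci0] cr]] :=
  mpoly_dependence (fun i : 'I_#|{: I}| => rb (enum_val i)) lt.
pose X (m : I) := [multinom (m i : nat) | i < d].
pose q : {mpoly K[d]} := \sum_i c i *: 'X_[X (enum_val i)].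
exists q; split.
  apply: contraNneq ci0 => q0.
  have := congr1 (mcoeff (X (enum_val i0))) q0.
  rewrite mcoeff0 raddf_sum (bigD1 i0) //= mcoeffZ mcoeffX eqxx mulr1 big1 ?addr0.
    by move=> ->.
  move=> i ii0; rewrite mcoeffZ mcoeffX; case: eqP; rewrite ?mulr0 //.
  move=> /mnmP e'; case/eqP: ii0; apply: enum_val_inj; apply/ffunP => j.
  by apply: val_inj; have := e' j; rewrite !mnmE.
move=> v hv; apply: (mulfI (expf_neq0 (d * B) hv)); rewrite mulr0.
have := congr1 (meval v) cr; rewrite meval0 => <-.
rewrite [in LHS]/q !raddf_sum mulr_sumr; apply: eq_bigr => i _ /=.
rewrite !mevalZ mevalX /r mevalM rmorphXn rmorph_prod /= mulrCA; congr (_ * _).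
rewrite -{1}(subnK (eB (enum_val i))) exprD -mulrA; congr (_ * _).
rewrite -prodrXr -big_split; apply: eq_bigr => j _ /=.
by rewrite mnmE rmorphXn /= expr_div_n mulrC divfK ?expf_neq0.
Qed.

End DegreeCount.

(** * Zariski topology and dimension *)

Lemma map_hornerD (A B : comNzRingType) (f : {rmorphism A -> B}) x (p q : {poly A}) :
  (map_poly f (p + q)).[x] = (map_poly f p).[x] + (map_poly f q).[x].
Proof. by rewrite rmorphD hornerD. Qed.

Lemma map_hornerM (A B : comNzRingType) (f : {rmorphism A -> B}) x (p q : {poly A}) :
  (map_poly f (p * q)).[x] = (map_poly f p).[x] * (map_poly f q).[x].
Proof. by rewrite rmorphM hornerM. Qed.

Section Muni.
Variables (R : comNzRingType) (d : nat).
Local Notation widen := (widen_ord (leqnSn d)).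

Lemma ord_lastP (P : 'I_d.+1 -> Prop) :
  (forall j, P (widen j)) -> P ord_max -> forall i, P i.
Proof.
move=> Pw Pm i; have [id|di] := ltnP i d.
  by have -> : i = widen (Ordinal id) by apply: val_inj.
have -> // : i = ord_max.
by apply/val_inj/eqP; rewrite eqn_leq di -ltnS ltn_ord.
Qed.

Lemma muniXwiden j : muni 'X_(widen j) = ('X_j)%:P :> {poly {mpoly R[d]}}.
Proof.
rewrite muniE msuppX big_seq1 mcoeffX eqxx scale1r mnm1E.
rewrite -val_eqE /= (ltn_eqF (ltn_ord j)) expr0 alg_polyC; congr ('X_[_])%:P.
by apply/mnmP => i; rewrite mnmE !mnm1E -!val_eqE.
Qed.

Lemma muniXmax : muni 'X_ord_max = 'X :> {poly {mpoly R[d]}}.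
Proof.
rewrite muniE msuppX big_seq1 mcoeffX eqxx scale1r mnm1E eqxx expr1.
rewrite [X in 'X_[X]](_ : _ = 0%MM) ?mpolyX0 ?scale1r //.
by apply/mnmP => i; rewrite mnmE mnm1E mnm0E -val_eqE /= gtn_eqF.
Qed.

Lemma muni_inj : injective (@muni d R).
Proof.
pose g (P : {poly {mpoly R[d]}}) :=
  (map_poly (comp_mpoly [tuple 'X_(widen j) : {mpoly R[d.+1]} | j < d]) P).['X_ord_max].
apply: (@can_inj _ _ _ g) => p; rewrite /g.
elim/mpoly_ring_ind: p => [c|i|p q IHp IHq|p q IHp IHq].
- by rewrite muniC map_polyC hornerC /= comp_mpolyC.
- elim/ord_lastP: i => [j|]; last by rewrite muniXmax map_polyX hornerX.
  by rewrite muniXwiden map_polyC hornerC /= comp_mpolyXU -tnth_nth tnth_mktuple.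
- by rewrite muniD map_hornerD; congr (_ + _).
- by rewrite muniM map_hornerM; congr (_ * _).
Qed.

Lemma meval_muni (v : 'I_d.+1 -> R) (q : {mpoly R[d.+1]}) :
  q.@[v] = (map_poly (meval (fun i => v (widen i))) (muni q)).[v ord_max].
Proof.
elim/mpoly_ring_ind: q => [c|i|p r IHp IHr|p r IHp IHr].
- by rewrite muniC map_polyC hornerC /= !mevalC.
- elim/ord_lastP: i => [j|]; rewrite mevalXU.
    by rewrite muniXwiden map_polyC hornerC /= mevalXU.
  by rewrite muniXmax map_polyX hornerX.
- by rewrite mevalD muniD map_hornerD IHp IHr.
- by rewrite mevalM muniM map_hornerM IHp IHr.
Qed.

End Muni.

(* The Zariski topology induced on a type Om by a map to affine space. It is
   used both for affine space itself and for a group of automorphisms mapped to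
   the orbit of a generic point. *)
Section Zariski.
Variables (K : fieldType) (n : nat) (Om : Type) (pt : Om -> 'I_n -> K).
Implicit Types (A B V W : set Om) (S : set {mpoly K[n]}).

Definition vanish A : set {mpoly K[n]} := [set p | forall w, A w -> p.@[pt w] = 0].
Definition locus S : set Om := [set w | forall p, S p -> p.@[pt w] = 0].
Definition Zclosed V := exists S, V = locus S.
Definition Zclosure A := locus (vanish A).
Definition Zirr V :=
  V !=set0 /\ forall A B, Zclosed A -> Zclosed B -> V `<=` A `|` B ->
    V `<=` A \/ V `<=` B.

Lemma vanish_ideal A : is_ideal (vanish A).
Proof.
split=> [w _|p q hp hq w Aw|p q hq w Aw]; first exact: meval0.
- by rewrite mevalD hp ?hq ?addr0.
- by rewrite mevalM hq ?mulr0.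
Qed.

Lemma Zclosed_closure A : Zclosed (Zclosure A).
Proof. by exists (vanish A). Qed.

Lemma sub_Zclosure A : A `<=` Zclosure A.
Proof. by move=> w Aw p; apply. Qed.

Lemma Zclosure_min A V : Zclosed V -> A `<=` V -> Zclosure A `<=` V.
Proof.
move=> [S ->] AV w Aw p Sp; apply: Aw => v /AV; exact.
Qed.

Lemma Zclosure_sub A B : A `<=` Zclosure B -> Zclosure A `<=` Zclosure B.
Proof. by move=> h; apply: Zclosure_min h; apply: Zclosed_closure. Qed.

Lemma Zclosure_mono A B : A `<=` B -> Zclosure A `<=` Zclosure B.
Proof. by move=> AB; apply/Zclosure_sub/(subset_trans AB)/sub_Zclosure. Qed.

Lemma vanish_closed_sub V W : Zclosed W -> vanish W `<=` vanish V -> V `<=` W.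
Proof. by move=> [S ->] h w Vw p Sp; apply: h w Vw => v; apply. Qed.

Lemma ZclosedU A B : Zclosed A -> Zclosed B -> Zclosed (A `|` B).
Proof.
move=> [S ->] [S' ->]; exists [set p | exists q r, [/\ S q, S' r & p = q * r]].
apply/seteqP; split=> w.
  case=> h _ [q [r [Sq S'r ->]]]; rewrite mevalM.
    by rewrite (h q) // mul0r.
  by rewrite (h r) // mulr0.
move=> h; apply: contrapT => /not_orP[nA nB]; apply: nA => q Sq.
apply: contrapT => qw; apply: nB => r S'r.
have /eqP : (q * r).@[pt w] = 0 by apply: h; exists q, r.
by rewrite mevalM mulf_eq0 => /orP[]/eqP.
Qed.

Lemma Zclosed0 : Zclosed set0.
Proof.
exists [set 1]; apply/seteqP; split=> // w /(_ 1 erefl)/eqP.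
by rewrite meval1 oner_eq0.
Qed.

Lemma Zclosed_min (F : set (set Om)) :
  F `<=` Zclosed -> F !=set0 ->
  exists2 V, F V & forall W, F W -> W `<=` V -> W = V.
Proof.
move=> Fcl [V0 FV0].
have [I [V FV VI] Imax] : exists2 I, (vanish @` F) I &
    forall J, (vanish @` F) J -> I `<=` J -> J = I.
  apply: ideal_max; first by move=> _ [V _ <-]; apply: vanish_ideal.
  by exists (vanish V0), V0.
exists V => // W FW WV; apply/seteqP; split => //.
apply: vanish_closed_sub; first exact: Fcl.
have -> : vanish W = I; last by rewrite VI.
apply: Imax; first by exists W.
by rewrite -VI => p h w /WV; apply: h.
Qed.

(** Noetherian induction: a minimal closed set without such a cover is not irreducible, hence the
    union of two smaller closed sets. *)
Lemma Zirr_cover V : Zclosed V -> exists (m : nat) (C : nat -> set Om),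
  (forall i, (i < m)%N -> Zclosed (C i) /\ Zirr (C i)) /\
  V = \bigcup_(i in [set i | (i < m)%N]) C i.
Proof.
pose good V := exists (m : nat) (C : nat -> set Om),
  (forall i, (i < m)%N -> Zclosed (C i) /\ Zirr (C i)) /\
  V = \bigcup_(i in [set i | (i < m)%N]) C i.
move=> Vcl; apply: contrapT => nV.
have [W [Wcl nW] Wmin] := @Zclosed_min [set W | Zclosed W /\ ~ good W]
  (fun _ h => h.1) (ex_intro _ V (conj Vcl nV)).
have goodlt A : Zclosed A -> A `<=` W -> ~ W `<=` A -> good A.
  move=> Acl AW nWA; apply: contrapT => nA; apply: nWA.
  by rewrite (Wmin A).
apply: nW; have [[w Ww]|W0] := pselect (W !=set0); last first.
  exists 0%N, (fun=> set0); split=> //; apply/seteqP; split=> [w Ww|w [i]//].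
  by case: W0; exists w.
have [h|h] := pselect (Zirr W).
  exists 1%N, (fun=> W); split=> //; apply/seteqP; split=> [x Wx|x [i]//].
  by exists 0%N.
have [A [B [Acl Bcl WAB nA nB]]] : exists A B, [/\ Zclosed A, Zclosed B,
    W `<=` A `|` B, ~ W `<=` A & ~ W `<=` B].
  apply: contrapT => h'; apply: h; split; first by exists w.
  move=> A B Acl Bcl WAB; apply: contrapT => /not_orP[nA nB].
  by apply: h'; exists A, B.
have meet A' : Zclosed A' -> ~ W `<=` A' -> good (W `&` A').
  move=> A'cl nA'; apply: goodlt => [||WA'].
  - move: Wcl A'cl => [S ->] [S' ->]; exists (S `|` S').
    apply/seteqP; split=> [x [hS hS'] p []|x hx]; [exact: hS|exact: hS'|].
    by split=> p Sp; apply: hx; [left|right].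
  - by move=> x [].
  - by apply: nA' => x /WA'[].
have [m [C [Cirr WA]]] := meet A Acl nA.
have [m' [C' [C'irr WB]]] := meet B Bcl nB.
exists (m + m')%N, (fun i => if (i < m)%N then C i else C' (i - m)%N).
split=> [i im|].
  by case: ltnP => h'; [apply: Cirr|apply: C'irr; rewrite ltn_subLR].
apply/seteqP; split=> x.
- move=> Wx; case: (WAB x Wx) => hx.
    have : (W `&` A) x by [].
    rewrite WA => -[i /= im Cx]; exists i => /=; first exact: ltn_addr.
    by rewrite im.
  have : (W `&` B) x by [].
  rewrite WB => -[i /= im Cx]; exists (m + i)%N => /=; first by rewrite ltn_add2l.
  by rewrite ltnNge leq_addr /= addKn.
- move=> [i /= im]; case: ltnP => h'' Cx.
    have : (W `&` A) x by rewrite WA; exists i.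
    by case.
  have : (W `&` B) x by rewrite WB; exists (i - m)%N => //=; rewrite ltn_subLR.
  by case.
Qed.

Lemma Zirr_prime V p q : Zirr V -> vanish V (p * q) -> vanish V p \/ vanish V q.
Proof.
move=> [_ Virr] pq; pose Z r := locus [set r].
have Zcl r : Zclosed (Z r) by exists [set r].
have [w /pq|h|h] := Virr _ _ (Zcl p) (Zcl q).
- move=> /eqP; rewrite mevalM mulf_eq0 => /orP[]/eqP h; [left|right];
  by move=> _ ->.
- by left=> w /h; apply.
- by right=> w /h; apply.
Qed.

Definition alg_indep A d (g : 'I_d -> {mpoly K[n]}) :=
  forall q : {mpoly K[d]},
    (forall w, A w -> q.@[fun i => (g i).@[pt w]] = 0) -> q = 0.

Lemma alg_indep_le V d (g : 'I_d -> {mpoly K[n]}) : alg_indep V g -> (d <= n)%N.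
Proof.
move=> gind; rewrite leqNgt; apply/negP => nd.
have [q [/eqP q0 qv]] := rational_dependence g 1 nd.
apply/q0/gind => w _; rewrite -[RHS](qv (pt w)) ?meval1 ?oner_eq0 //.
by apply: meval_eq => i; rewrite divr1.
Qed.

(* Polynomials f_i vanishing on V_i but not on V_(i+1) are algebraically
   independent on the last term of the chain. *)
Lemma chain_alg_indep (V : nat -> set Om) (f : nat -> {mpoly K[n]}) d :
  (forall i, (i <= d)%N -> Zirr (V i)) ->
  (forall i, (i < d)%N -> V i `<=` V i.+1) ->
  (forall i, (i < d)%N -> vanish (V i) (f i) /\ ~ vanish (V i.+1) (f i)) ->
  alg_indep (V d) (fun i : 'I_d => f i).
Proof.
elim: d => [|d IH] Virr Vsub Vf q.
  have [[w Vw] _] := Virr 0%N (leqnn 0) => /(_ w Vw).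
  by rewrite [q]nvar0_mpolyC mevalC => ->.
have {}IH : alg_indep (V d) (fun i : 'I_d => f i).
  by apply: IH => i id; [apply: Virr|apply: Vsub|apply: Vf]; rewrite ltnW.
have [fd nfd] := Vf d (ltnSn d).
pose g w (i : 'I_d) := (f i).@[pt w].
pose ev w (P : {poly {mpoly K[d]}}) := (map_poly (meval (g w)) P).[(f d).@[pt w]].
suff ind (P : {poly {mpoly K[d]}}) : (forall w, V d.+1 w -> ev w P = 0) -> P = 0.
  by move=> qV; apply: muni_inj; rewrite muni0; apply: ind => w Vw;
    rewrite -[RHS](qV w Vw) meval_muni.
elim/poly_ind: P => [//|P c IHP] PV.
have evD w : ev w (P * 'X + c%:P) = ev w P * (f d).@[pt w] + c.@[g w].
  by rewrite /ev rmorphD rmorphM /= map_polyX map_polyC !hornerE.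
(* On [V d] the function [f d] vanishes, so the constant term is a relation among the earlier
   functions. What remains is a multiple of [f d], which can be cancelled on the irreducible
   [V d.+1]. *)
have c0 : c = 0.
  apply: IH => w Vw; have /eqP := PV w (Vsub d (ltnSn d) w Vw).
  by rewrite evD fd // mulr0 add0r => /eqP.
rewrite c0 addr0 IHP ?mul0r // => w.
have [h evh] : exists h, forall w, h.@[pt w] = ev w P.
  exists ((map_poly (comp_mpoly [tuple f i | i < d]) P).[f d]) => v.
  rewrite -horner_map /= -map_poly_comp /ev; congr _.[_].
  apply: eq_map_poly => r /=; rewrite comp_mpoly_meval.
  by apply: meval_eq => i; rewrite tnth_mktuple.
have [|Vh Vw|//] := @Zirr_prime (V d.+1) h (f d) (Virr _ (leqnn _)).
  move=> v Vv; have := PV v Vv.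
  by rewrite evD c0 meval0 addr0 mevalM evh.
by rewrite -evh; apply: Vh.
Qed.

Lemma chain_length (V : nat -> set Om) d :
  (forall i, (i <= d)%N -> Zclosed (V i) /\ Zirr (V i)) ->
  (forall i, (i < d)%N -> V i `<=` V i.+1 /\ ~ V i.+1 `<=` V i) -> (d <= n)%N.
Proof.
move=> Virr Vlt.
have /choice[f fP] : forall i, exists p,
    (i < d)%N -> vanish (V i) p /\ ~ vanish (V i.+1) p.
  move=> i; have [id|] := ltnP i d; last by exists 0.
  apply: contrapT => h; have [_] := Vlt i id; apply.
  apply: vanish_closed_sub; first by case: (Virr i (ltnW id)).
  by move=> p Vp; apply: contrapT => nVp; apply: h; exists p.
by apply: (@alg_indep_le (V d) d _ (chain_alg_indep _ _ fP)) => i id;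
  [case: (Virr i id)|case: (Vlt i id)].
Qed.

(** Ascending chains stop, since strict chains of irreducible closed sets have length at most
    [n]. *)
Lemma Zirr_max (F : set (set Om)) : (forall V, F V -> Zclosed V /\ Zirr V) ->
  F !=set0 -> exists2 V, F V & forall W, F W -> V `<=` W -> W = V.
Proof.
move=> Firr [V0 FV0]; apply: contrapT => nomax.
have step (V : {V | F V}) : exists W : {V | F V},
    sval V `<=` sval W /\ ~ sval W `<=` sval V.
  case: V => V FV /=; apply: contrapT => h; apply: nomax; exists V => // W FW VW.
  apply/seteqP; split=> //; apply: contrapT => WV; apply: h.
  by exists (exist _ W FW).
pose next (V : {V | F V}) := sval (cid (step V)).
pose ch i := iter i next (exist _ V0 FV0).
suff : (n.+1 <= n)%N by rewrite ltnn.
apply: (@chain_length (fun i => sval (ch i))) => i _.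
  exact: Firr (svalP (ch i)).
by rewrite /ch /= /next; case: cid.
Qed.

End Zariski.

Section AffineSpace.
Variables (k : fieldType) (n : nat).
Local Notation pt := (@id ('I_n -> k)).
Implicit Types (V W : set ('I_n -> k)).

(** [irreducible] speaks of decompositions of [V], [Zirr] of coverings; intersect the covering sets
    with [V]. *)
Lemma irreducible_Zirr V : zariski_closed V -> irreducible V -> Zirr pt V.
Proof.
move=> [S VS] [V0 Virr]; split=> // A B [SA AS] [SB BS] VAB.
have cap A' S' : A' = locus pt S' -> zariski_closed (V `&` A').
  move=> ->; exists (S `|` S'); rewrite VS; apply/seteqP; split=> x.
    by move=> [h h'] p []; [apply: h|apply: h'].
  by move=> h; split=> p Sp; apply: h; [left|right].
have [|->|->] := Virr _ _ (cap A SA AS) (cap B SB BS); last 2 first.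
- by left=> x [].
- by right=> x [].
by apply/seteqP; split=> [x Vx|x [[]|[]]//]; case: (VAB x Vx); [left|right].
Qed.

Lemma Zirr_irreducible V : Zirr pt V -> irreducible V.
Proof.
move=> [V0 Virr]; split=> // A B Acl Bcl VAB.
have VAB' : V `<=` A `|` B by rewrite -VAB.
have [VA|VB] := Virr A B Acl Bcl VAB'.
  by left; apply/seteqP; split=> // x Ax; rewrite VAB; left.
by right; apply/seteqP; split=> // x Bx; rewrite VAB; right.
Qed.

Lemma has_irreducible_chainP V d :
  has_irreducible_chain V d <-> exists Z : nat -> set ('I_n -> k),
    (forall i, (i <= d)%N -> [/\ zariski_closed (Z i), Zirr pt (Z i) & Z i `<=` V]) /\
    (forall i, (i < d)%N -> Z i `<=` Z i.+1 /\ ~ Z i.+1 `<=` Z i).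
Proof.
split=> [[Z [ZP Zlt]]|[Z [ZP Zlt]]].
  exists (fun i => Z (inord i)); split=> i id.
    by have [? ? ?] := ZP (inord i); split=> //; apply: irreducible_Zirr.
  by apply: Zlt; rewrite !inordK // ltnS ltnW.
exists (fun i => Z i); split=> [i|i j].
  by have [|? ? ?] := ZP i; [rewrite -ltnS|split=> //; apply: Zirr_irreducible].
case: i j => [i id] [j jd] /=; elim: j jd => // j IH jd.
rewrite ltnS leq_eqVlt => /predU1P[->|ij]; first exact: Zlt.
have [ZS _] := Zlt j jd; have [Zij nZ] := IH (ltnW jd) ij.
by split; [apply: subset_trans ZS|move=> h; apply: nZ; apply: subset_trans h].
Qed.

Lemma irreducible_chain_alg_indep V d : has_irreducible_chain V d ->
  exists f : 'I_d -> {mpoly k[n]}, alg_indep pt V f.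
Proof.
move=> /has_irreducible_chainP[Z [ZP Zlt]].
have /choice[f fP] : forall i, exists p,
    (i < d)%N -> vanish pt (Z i) p /\ ~ vanish pt (Z i.+1) p.
  move=> i; have [id|] := ltnP i d; last by exists 0.
  apply: contrapT => h; have [_] := Zlt i id; apply.
  apply: (@vanish_closed_sub _ _ _ pt); first by case: (ZP i (ltnW id)).
  by move=> p Vp; apply: contrapT => nVp; apply: h; exists p.
have find := @chain_alg_indep _ _ _ pt Z f d (fun i id => let: And3 _ h _ := ZP i id in h)
  (fun i id => (Zlt i id).1) fP.
exists (fun i => f i) => q qV; apply: find => w Zw; apply: qV.
by case: (ZP d (leqnn d)) => _ _; apply.
Qed.

Lemma has_irreducible_chain_le V d : has_irreducible_chain V d -> (d <= n)%N.
Proof. by move=> /irreducible_chain_alg_indep[f /alg_indep_le]. Qed.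

Lemma krull_dim_le V b :
  (forall d, has_irreducible_chain V d -> (d <= b)%N) -> (krull_dim V <= b)%N.
Proof.
move=> h; rewrite /krull_dim /supremum; case: ifP => // _.
case: xgetP => [s -> [_]|//]; apply=> d; exact: h.
Qed.

(** [supremum] would take its default value if there were no supremum; the bound [n] on the lengths
    of chains provides a maximum. *)
Lemma krull_dim_ge V d : has_irreducible_chain V d -> (d <= krull_dim V)%N.
Proof.
move=> Vd; rewrite /krull_dim /supremum; case: ifP => [/eqP e|_].
  by have : (set0 : set nat) d by rewrite -e.
case: xgetP => [s _ [/(_ d Vd)]//|] /(_ _)/= nsup.
pose P d := `[< has_irreducible_chain V d >].
have exP : exists d, P d by exists d; apply/asboolP.
have ubP i : P i -> (i <= n)%N by move/asboolP/has_irreducible_chain_le.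
case: (nsup (ex_maxn exP ubP)); case: ex_maxnP => i /asboolP Vi imax; split.
  by move=> j Vj; apply: imax; apply/asboolP.
by move=> j; apply.
Qed.

End AffineSpace.

Lemma rmorph_resolvent_numerator (k : fieldType) (R R' : comNzRingType)
    (f : {rmorphism R -> R'}) (s : seq k) (w : k -> R) phi x :
  f (resolvent_numerator s w phi x) =
  resolvent_numerator s (f \o w) (f \o phi) (f x).
Proof.
rewrite rmorph_sum; apply: eq_bigr => a _; rewrite rmorphM rmorph_prod.
by congr (_ * _); apply: eq_bigr => b _; rewrite rmorphB.
Qed.

Section ChainExistence.
Variables (k : closedFieldType) (n : nat).
Hypothesis k_unc : ~ countable [set: k].
Local Notation pt := (@id ('I_n -> k)).

(** No power of an element [g] outside the prime [P] lies in [P], so the Nullstellensatz finds a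
    zero of [P] where [g] does not vanish. *)
Lemma vanish_prime_locus (P : set {mpoly k[n]}) : is_ideal P ->
  (forall p q, P (p * q) -> P p \/ P q) -> ~ P 1 ->
  vanish pt (locus pt P) = P.
Proof.
move=> Pid Pprime nP1; apply/seteqP; split=> [g gV|p Pp w]; last exact.
apply: contrapT => nPg.
have nPge e : ~ P (g ^+ e).
  by elim: e => // e IH; rewrite exprS => /Pprime[].
have [v [vP /eqP gv]] := nullstellensatz k_unc Pid nPge.
by apply: gv; apply: gV => p /vP.
Qed.

Lemma Zirr_prime_locus (P : set {mpoly k[n]}) : is_ideal P ->
  (forall p q, P (p * q) -> P p \/ P q) -> ~ P 1 -> Zirr pt (locus pt P).
Proof.
move=> Pid Pprime nP1; have vP := vanish_prime_locus Pid Pprime nP1.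
split.
  have [|v [vPv _]] := nullstellensatz k_unc Pid (g := 1).
    by move=> e; rewrite expr1n.
  by exists v => p /vPv.
move=> A B Acl Bcl PAB; apply: contrapT => /not_orP[nA nB].
have notsub C : Zclosed pt C -> ~ locus pt P `<=` C ->
    exists2 f, vanish pt C f & ~ P f.
  move=> Ccl nC; apply: contrapT => h; apply: nC.
  apply: (@vanish_closed_sub _ _ _ pt) => // f Cf; rewrite vP.
  by apply: contrapT => nPf; apply: h; exists f.
have [f Af nPf] := notsub A Acl nA; have [g Bg nPg] := notsub B Bcl nB.
have : P (f * g); last by case/Pprime.
rewrite -vP => w /PAB[/Af|/Bg] e; rewrite mevalM e ?mul0r ?mulr0 //.
Qed.

(* If every vanish(V) + (x - a), x the last g_i, met the nonzero polynomials in
   the other g_i, the u_a / (x - a) would be dependent as in the proof of the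
   Nullstellensatz, contradicting the algebraic independence. *)
Lemma alg_indep_step (V : set ('I_n -> k)) m (g : 'I_m.+1 -> {mpoly k[n]}) :
  Zclosed pt V -> Zirr pt V -> alg_indep pt V g ->
  exists W, [/\ Zclosed pt W, Zirr pt W, W `<=` V /\ ~ V `<=` W &
    alg_indep pt W (fun i => g (widen_ord (leqnSn m) i))].
Proof.
move=> Vcl Virr gind; set g' := fun i => g (widen_ord (leqnSn m) i).
pose x := g ord_max.
pose G : {mpoly k[m.+1]} -> {mpoly k[n]} := comp_mpoly [tuple g i | i < m.+1].
pose G' : {mpoly k[m]} -> {mpoly k[n]} := comp_mpoly [tuple g' i | i < m].
have GE q v : (G q).@[v] = q.@[fun i => (g i).@[v]].
  by rewrite comp_mpoly_meval; apply: meval_eq => i; rewrite tnth_mktuple.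
have G'E q v : (G' q).@[v] = q.@[fun i => (g' i).@[v]].
  by rewrite comp_mpoly_meval; apply: meval_eq => i; rewrite tnth_mktuple.
have G0 q : vanish pt V (G q) -> q = 0.
  by move=> h; apply: gind => w /h; rewrite GE.
pose S := [set G' q | q in [set q : {mpoly k[m]} | q != 0]].
have vid := vanish_ideal pt V; have [v0 vD vM] := vid.
pose J a := [set p | exists u h, vanish pt V u /\ p = u + h * (x - a%:MP)].
have [a aP] : exists a : k, forall p, J a p -> ~ S p.
  apply: contrapT => nPa.
  have /choice[t tP] : forall a, exists t : {mpoly k[n]} * {mpoly k[n]} * {mpoly k[m]},
      [/\ vanish pt V t.1.1, t.2 != 0 & G' t.2 = t.1.1 + t.1.2 * (x - a%:MP)].
    move=> a; apply: contrapT => h; apply: nPa; exists a => p [u [b [Vu ->]]] [q q0 qE].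
    by apply: h; exists (u, b, q).
  have [_ [s [c [us _ [a0 a0s ca0] ch]]]] :=
    resolvent_dependence k_unc (fun a => (t a).1.2) (fun=> 0%N).
  have num : vanish pt V
      (resolvent_numerator s (fun a => c a *: G' (t a).2) (@mpolyC n k) x).
    apply: (@resolvent_ideal _ _ _ _ _ _ (fun a => (t a).1.1)
       (fun a => (t a).1.2)) => // a; by case: (tP a).
  pose wd : {mpoly k[m]} -> {mpoly k[m.+1]} :=
    comp_mpoly [tuple 'X_(widen_ord (leqnSn m) i) | i < m].
  (* A lift of the numerator to the ring in [m.+1] variables. Algebraic independence forces [Q = 0],
     although putting the last variable equal to [a0] leaves exactly the term of [a0], a nonzero
     multiple of [(t a0).2]. *)
  pose Q := resolvent_numerator s (fun a => c a *: wd (t a).2)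
    (@mpolyC m.+1 k) 'X_ord_max.
  have Q0 : Q = 0.
    apply: G0; suff -> : G Q = resolvent_numerator s
      (fun a => c a *: G' (t a).2) (@mpolyC n k) x by [].
    rewrite /G rmorph_resolvent_numerator; congr resolvent_numerator.
    - apply/funext => a /=; rewrite comp_mpolyZ; congr (_ *: _).
      elim/mpoly_ring_ind: (t a).2 => [e|i|p q IHp IHq|p q IHp IHq].
      - by rewrite /wd /G' !comp_mpolyC.
      - by rewrite /wd /G' !comp_mpolyXU -!tnth_nth !tnth_mktuple comp_mpolyXU
          -tnth_nth tnth_mktuple.
      - by rewrite /wd /G' !comp_mpolyD; congr (_ + _).
      - by rewrite /wd /G' !rmorphM; congr (_ * _).
    - by apply/funext => a /=; rewrite comp_mpolyC.
    - by rewrite /= comp_mpolyXU -tnth_nth tnth_mktuple.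
  pose sp : {mpoly k[m.+1]} -> {mpoly k[m]} := fun q => horner_eval a0%:MP (muni q).
  have : sp Q == 0 by rewrite Q0 /sp muni0 rmorph0.
  have -> : sp Q = resolvent_numerator s (fun a => c a *: (t a).2)
      (@mpolyC m k) a0%:MP.
    have -> : sp Q = _ := congr1 (horner_eval a0%:MP)
      (rmorph_resolvent_numerator (@muni m k) s _ _ _).
    rewrite (rmorph_resolvent_numerator (horner_eval _)) /= muniXmax.
    rewrite [X in resolvent_numerator _ _ _ X]hornerX.
    congr resolvent_numerator; apply/funext => a /=.
      rewrite /horner_eval muniZ -mul_polyC hornerM hornerC mul_mpolyC; congr (_ *: _).
      have -> : muni (wd (t a).2) = (t a).2%:P; last by rewrite hornerC.
      elim/mpoly_ring_ind: (t a).2 => [e|i|p q IHp IHq|p q IHp IHq].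
      - by rewrite /wd comp_mpolyC muniC.
      - by rewrite /wd comp_mpolyXU -tnth_nth tnth_mktuple muniXwiden.
      - by rewrite /wd comp_mpolyD muniD polyCD; congr (_ + _).
      - by rewrite /wd rmorphM muniM polyCM; congr (_ * _).
    by rewrite /horner_eval muniC hornerC.
  rewrite resolvent_numerator_root // mulf_eq0 scaler_eq0 (negbTE ca0) /=.
  have /negbTE -> /= : (t a0).2 != 0 by case: (tP a0).
  rewrite prodf_seq_eq0 => /hasP[b _ /andP[ba]].
  by rewrite -mpolyCB mpolyC_eq0 subr_eq0 eq_sym (negbTE ba).
have Vx u : vanish pt V u -> J a u by move=> Vu; exists u, 0; rewrite mul0r addr0.
have [||||P [Pid JP PS Pprime _]] := @max_disjoint_ideal k n (J a) S.
- split; first exact: Vx.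
    move=> _ _ [u [h [Vu ->]]] [u' [h' [Vu' ->]]]; exists (u + u'), (h + h').
    by split; [exact: vD|ring].
  move=> p _ [u [h [Vu ->]]]; exists (p * u), (p * h).
  by split; [exact: vM|ring].
- exact: aP.
- by exists 1; [exact: oner_neq0|rewrite /G' comp_mpoly1].
- move=> _ _ [q q0 <-] [q' q'0 <-]; exists (q * q'); first exact: mulf_neq0.
  by rewrite /G' rmorphM.
have nP1 : ~ P 1.
  by move=> /PS; apply; exists 1; [exact: oner_neq0|rewrite /G' comp_mpoly1].
have vW := vanish_prime_locus Pid Pprime nP1.
exists (locus pt P); split.
- by exists P.
- exact: Zirr_prime_locus.
- split.
    apply: (@vanish_closed_sub _ _ _ pt) => // u Vu; rewrite vW.
    exact/JP/Vx.
  move=> VW; have : 'X_ord_max - a%:MP = 0 :> {mpoly k[m.+1]}.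
    apply: gind => w /VW Ww; rewrite mevalB mevalXU mevalC.
    have : P (x - a%:MP) by apply: JP; exists 0, 1; rewrite add0r mul1r.
    by move/Ww; rewrite mevalB mevalC.
  move/(congr1 (mcoeff U_(ord_max))).
  rewrite mcoeffB mcoeffX eqxx mcoeffC mnm1_eq0 mulr0 subr0 mcoeff0 => /eqP.
  by rewrite oner_eq0.
- move=> q qW; apply: contrapT => /eqP q0; apply: (PS (G' q)); last by exists q.
  by rewrite -vW => w /qW; rewrite G'E.
Qed.

Lemma alg_indep_chain m (V : set ('I_n -> k)) (g : 'I_m -> {mpoly k[n]}) :
  Zclosed pt V -> Zirr pt V -> alg_indep pt V g -> has_irreducible_chain V m.
Proof.
elim: m V g => [|m IH] V g Vcl Virr gind; apply/has_irreducible_chainP.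
  by exists (fun=> V); split=> // i _; split.
have [W [Wcl Wirr [WV nVW] Wind]] := alg_indep_step Vcl Virr gind.
have /has_irreducible_chainP[Z [ZP Zlt]] := IH W _ Wcl Wirr Wind.
exists (fun i => if (i <= m)%N then Z i else V); split=> i im.
  case: leqP => [/ZP[? ? ZW]|//]; split=> //; exact: subset_trans ZW WV.
rewrite -ltnS im; have [|h] := ltnP i m; first exact: Zlt.
have [_ _ ZW] := ZP i im; split; first exact: subset_trans ZW WV.
by move=> h'; apply: nVW; apply: subset_trans h' ZW.
Qed.

End ChainExistence.

(** * Commuting families of matrices *)

(** A matrix of largest rank with row space inside [P] exhausts [P], since otherwise a row could be
    added. *)
Lemma subspace_matrix (F : fieldType) N (P : 'rV[F]_N -> Prop) :
  P 0 -> (forall a u v, P u -> P v -> P (a *: u + v)) ->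
  exists U : 'M[F]_N, forall v, P v <-> (v <= U)%MS.
Proof.
move=> P0 PL.
pose Q d := `[< exists U : 'M[F]_N, (forall v, (v <= U)%MS -> P v) /\ \rank U = d >].
have exQ : exists d, Q d.
  exists 0%N; apply/asboolP; exists 0; split; last exact: mxrank0.
  by move=> v; rewrite submx0 => /eqP->.
have ubQ d : Q d -> (d <= N)%N by move=> /asboolP[U [_ <-]]; exact: rank_leq_row.
case: (ex_maxnP exQ ubQ) => d /asboolP[U [UP rU]] dmax.
exists U => v; split; last exact: UP.
move=> Pv; have : Q (\rank (U + v)%MS).
  apply/asboolP; exists (U + v)%MS; split=> // w /sub_addsmxP[[u1 u2] /= ->].
  rewrite [u2]mx11_scalar mul_scalar_mx addrC; apply: PL => //; apply: UP.
  exact: submxMl.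
move=> /dmax; rewrite -rU => le.
apply: submx_trans (addsmxSr U v) _.
by have := mxrank_leqif_sup (addsmxSl U v); move=> [_ <-]; rewrite eqn_leq le mxrankS ?addsmxSl.
Qed.

Lemma poly_eq0_of_all_roots (F : fieldType) (p : {poly F}) :
  ~ countable [set: F] -> (forall t, p.[t] = 0) -> p = 0.
Proof.
move=> unc pt0; apply/eqP; apply: contrapT => /negP p0.
have [s [us ss _]] := uncountable_uniq_seq (size p) unc.
suff : (size s < size p)%N by rewrite ss ltnn.
by apply: max_poly_roots => //; apply/allP => x _; apply/rootP.
Qed.

Lemma mdeg_leZsum (F : fieldType) n b (T : eqType) (r : seq T) (c : T -> F)
    (p : T -> {mpoly F[n]}) :
  {in r, forall i, mdeg_le b (p i)} -> mdeg_le b (\sum_(i <- r) c i *: p i).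
Proof.
move=> h m; rewrite big_seq => /msupp_sum_le/flattenP[s /mapP[i]].
by rewrite mem_filter => /andP[ir _] -> /msuppZ_le/(h i ir).
Qed.

Section FiniteFibre.
Variables (k : closedFieldType) (N : nat).
Hypothesis k_unc : ~ countable [set: k].

Definition scale_pt (t : k) (x : 'I_N -> k) := fun i => t * x i.

(** Along the line through [x], the powers of [t] separate the homogeneous components of [p]. *)
Lemma meval_scale_pt (p : {mpoly k[N]}) (t : k) x :
  p.@[scale_pt t x] =
  (\sum_(m <- msupp p) (p@_m * \prod_i x i ^+ m i) *: 'X^(mdeg m)).[t].
Proof.
rewrite mevalE horner_sum; apply: eq_bigr => m _.
rewrite hornerZ hornerXn -mulrA; congr (_ * _).
rewrite mdegE -prodrXr -big_split; apply: eq_bigr => i _ /=.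
by rewrite exprMn mulrC.
Qed.

(* A closed cone C meeting the common zeros of the forms l only at 0 is finite
   over the space of values of l: its fibres are finite. *)
Lemma cone_fibre_finite (C Xi : set ('I_N -> k)) (l : 'I_N -> 'I_N -> k) :
  Zclosed id C -> (forall t x, C x -> C (scale_pt t x)) ->
  (forall x, C x -> (forall j, \sum_i x i * l i j = 0) -> forall i, x i = 0) ->
  Xi `<=` C ->
  (forall x y j, Xi x -> Xi y -> \sum_i x i * l i j = \sum_i y i * l i j) ->
  exists r : seq k, forall x i, Xi x -> x i \in r.
Proof.
move=> Ccl Cscale C0 XiC Xil.
have [[x0 Xix0]|Xi0] := pselect (Xi !=set0); last first.
  by exists [::] => x i Xix; case: Xi0; exists x.
pose L j : {mpoly k[N]} := \sum_i l i j *: 'X_i.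
have LE j v : (L j).@[v] = \sum_i v i * l i j.
  by rewrite raddf_sum; apply: eq_bigr => i _ /=; rewrite mevalZ mevalXU mulrC.
pose J := [set p | exists c g, vanish id C c /\ p = c + \sum_j L j * g j].
have [v0 vD vM] := vanish_ideal id C.
have Jid : is_ideal J.
  split.
  - by exists 0, (fun=> 0); split=> //; rewrite add0r big1 // => j _; rewrite mulr0.
  - move=> _ _ [c [g [Vc ->]]] [c' [g' [Vc' ->]]].
    exists (c + c'), (fun j => g j + g' j); split; first exact: vD.
    rewrite addrACA -big_split; congr (_ + _).
    by apply: eq_bigr => j _; rewrite mulrDr.
  - move=> p _ [c [g [Vc ->]]]; exists (p * c), (fun j => p * g j).
    split; first exact: vM.
    by rewrite mulrDr mulr_sumr; congr (_ + _); apply: eq_bigr => j _; rewrite mulrCA.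
have [_ _ JM] := Jid.
(* The equations of [C] and the forms [L j] have at most the origin as common zero, so the
   Nullstellensatz puts a power of every variable into [J]. *)
have /choice[e eP] : forall i, exists e, J ('X_i ^+ e).
  move=> i; apply: contrapT => nJ.
  have [|v [vJ]] := nullstellensatz k_unc Jid (g := 'X_i).
    by move=> e Je; apply: nJ; exists e.
  rewrite mevalXU => /eqP; apply; apply: C0 => [|j].
    have : Zclosure id C v.
      move=> p Vp; apply: vJ; exists p, (fun=> 0); split=> //.
      by rewrite big1 ?addr0 // => j _; rewrite mulr0.
    exact: (Zclosure_min Ccl).
  rewrite -LE; apply: vJ; exists 0, (fun j' => (j' == j)%:R).
  split=> //; rewrite add0r (bigD1 j) //= eqxx mulr1 big1 ?addr0 // => j' /negbTE ->.
  by rewrite mulr0.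
pose D := (\sum_i e i).+1.
have eD i : (e i <= D)%N by rewrite /D (bigD1 i) //= -addnS leq_addr.
(* As the forms are constant on [Xi], the homogeneous part of degree [D] of the equation for
   ['X_i ^+ D] expresses [x i ^+ D] in lower degree. [D] is a successor, so [D.-1] is really
   smaller. *)
pose red i (a : {mpoly k[N]}) := mdeg_le D.-1 a /\
  forall x, Xi x -> x i ^+ D = a.@[x].
have /choice[a aP] : forall i, exists a, red i a.
  move=> i; have [c [g [Vc XE]]] : J ('X_i ^+ D).
    by rewrite -(subnK (eD i)) exprD; apply: JM.
  exists (\sum_j (\sum_s x0 s * l s j) *:
    \sum_(m <- msupp (g j) | mdeg m == D.-1) (g j)@_m *: 'X_[m]).
  split.
    move=> m /msupp_sum_le/flattenP[s /mapP[j _ ->]] /msuppZ_le.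
    move=> /msupp_sum_le/flattenP[s' /mapP[m']].
    rewrite mem_filter => /andP[/eqP mD _] -> /msuppZ_le.
    by rewrite msuppX inE => /eqP->; rewrite mD.
  move=> x Xix.
  pose H : {poly k} := (x i ^+ D) *: 'X^D - \sum_j (\sum_s x s * l s j) *: ('X *
    \sum_(m <- msupp (g j)) ((g j)@_m * \prod_i x i ^+ m i) *: 'X^(mdeg m)).
  have H0 : H = 0.
    apply: poly_eq0_of_all_roots => // t.
    have := congr1 (meval (scale_pt t x)) XE.
    rewrite rmorphXn /= mevalXU mevalD Vc ?add0r; last exact/Cscale/XiC.
    rewrite raddf_sum /= => E; rewrite hornerD hornerN hornerZ hornerXn.
    rewrite mulrC -exprMn -[t * x i]/(scale_pt t x i) E horner_sum; apply/eqP.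
    rewrite subr_eq0; apply/eqP/eq_bigr => j _.
    rewrite mevalM LE meval_scale_pt hornerZ hornerM hornerX mulrA; congr (_ * _).
    rewrite mulr_suml; apply: eq_bigr => s _.
    by rewrite /scale_pt -mulrA mulrC.
  have := congr1 (fun h : {poly k} => h`_D) H0.
  rewrite coefB coefZ coefXn eqxx mulr1 coef0 coef_sum => /eqP.
  rewrite subr_eq0 => /eqP->; rewrite raddf_sum; apply: eq_bigr => j _ /=.
  rewrite mevalZ coefZ (Xil x x0) //; congr (_ * _).
  rewrite coefXM /= coef_sum raddf_sum /= [RHS]big_mkcond /=; apply: eq_bigr => m _.
  rewrite coefZ coefXn eq_sym; case: eqP => _; last by rewrite mulr0.
  by rewrite mulr1 mevalZ mevalX.
have reduce b (p : {mpoly k[N]}) : mdeg_le b p ->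
    exists2 p', mdeg_le (N * D) p' & forall x, Xi x -> p.@[x] = p'.@[x].
  elim: b p => [|b IH] p pb; first by exists p => //; apply: mdeg_leW pb.
  have /choice[f fP] : forall m : 'X_{1..N}, exists p', m \in msupp p ->
      mdeg_le (N * D) p' /\ forall x, Xi x -> 'X_[m].@[x] = p'.@[x].
    move=> m; have [mp|] := boolP (m \in msupp p); last by exists 0.
    have [mND|NDm] := leqP (mdeg m) (N * D).
      by exists 'X_[m] => _; split=> // m'; rewrite msuppX inE => /eqP->.
    have [i Dmi] : exists i, (D <= m i)%N.
      apply/existsP; apply: contraTT NDm => /existsPn h; rewrite -leqNgt mdegE.
      apply: (@leq_trans (\sum_(i < N) D)).
        by apply: leq_sum => i _; rewrite ltnW // ltnNge.
      by rewrite sum_nat_const card_ord.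
    have Um : (U_(i) *+ D <= m)%MM.
      apply/mnm_lepP => j; rewrite mulmnE mnm1E.
      by case: eqP => [<-|]; rewrite ?mul1n ?mul0n.
    have mE : mdeg m = (mdeg (m - U_(i) *+ D) + D)%N.
      by rewrite -{1}(submK Um) mdegD mdegMn mdeg1 mul1n.
    have [aD aE] := aP i.
    have [|p' p'N p'E] := IH ('X_[m - U_(i) *+ D] * a i).
      apply: (@mdeg_leW _ _ (mdeg (m - U_(i) *+ D) + D.-1)).
        by have := pb m mp; rewrite mE addnS.
      by apply: mdeg_leM => // m'; rewrite msuppX inE => /eqP->.
    exists p' => _; split=> // x Xix; rewrite -p'E // mevalM -aE //.
    by rewrite -{1}(submK Um) mpolyXD mevalM -mpolyXn rmorphXn /= mevalXU.
  exists (\sum_(m <- msupp p) p@_m *: f m).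
    by apply: mdeg_leZsum => m /fP[].
  move=> x Xix; rewrite {1}[p]mpolyE !raddf_sum /=; apply: eq_big_seq => m mp.
  by rewrite !mevalZ; have [_ ->] := fP m mp.
(* On [Xi] all powers of [x i] come from polynomials of degree at most [N * D]; a linear relation
   among them is a polynomial equation for [x i] that does not depend on the point. *)
have /choice[r rP] : forall i, exists r : seq k, forall x, Xi x -> x i \in r.
  move=> i; pose M := #|{: 'X_{1..N < (N * D).+1}}|.+1.
  have /choice[h hP] : forall j : 'I_M, exists p',
      mdeg_le (N * D) p' /\ forall x, Xi x -> x i ^+ j = p'.@[x].
    move=> j; have [p' ? p'E] := reduce _ ('X_i ^+ j) (@mdeg_le_msize _ _ _).
    by exists p'; split=> // x Xix; rewrite -p'E // rmorphXn /= mevalXU.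
  have [|c [[j0 cj0] ch]] := @mpoly_dependence k N M (N * D).+1 h _ (ltnSn _).
    by move=> j; apply: mdeg_leP; case: (hP j).
  pose H : {poly k} := \sum_j c j *: 'X^j.
  have H0 : H != 0.
    apply: contraNneq cj0 => H0; have := congr1 (fun q : {poly k} => q`_j0) H0.
    rewrite coef0 coef_sum (bigD1 j0) //= coefZ coefXn eqxx mulr1 big1 ?addr0.
      by move=> ->.
    by move=> j /negbTE jj0; rewrite coefZ coefXn eq_sym val_eqE jj0 mulr0.
  have [r HE] := closed_field_poly_normal H; exists r => x Xix.
  rewrite -root_prod_XsubC -(@rootZ _ _ (lead_coef H)) ?lead_coef_eq0 // -HE.
  apply/rootP; have := congr1 (meval x) ch.
  rewrite meval0 raddf_sum horner_sum /= => E; rewrite -[RHS]E.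
  apply: eq_bigr => j _.
  by rewrite hornerZ hornerXn mevalZ; have [_ ->] := hP j.
exists (flatten [seq r i | i <- enum 'I_N]) => x i Xix.
by apply/flattenP; exists (r i); [apply: map_f; rewrite mem_enum|apply: rP].
Qed.

End FiniteFibre.

(** The tuple of positions in [r] takes only countably many values. *)
Lemma uncountable_constant_fibre (T : Type) (F : eqType) N (W : set T)
    (xi : T -> 'I_N -> F) (r : seq F) :
  ~ countable W -> (forall w i, W w -> xi w i \in r) ->
  exists W1, [/\ W1 `<=` W, ~ countable W1 &
    forall w v i, W1 w -> W1 v -> xi w i = xi v i].
Proof.
move=> Wunc xir.
pose code w := pickle [seq index (xi w i) r | i <- enum 'I_N].
have [c W1unc] := uncountable_fiber code Wunc.
exists (W `&` [set x | code x = c]); split=> [w []//|//|w v i [Ww cw] [Wv cv]].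
have : code w = code v by rewrite cw cv.
move=> /(pcan_inj pickleK)/eq_in_map/(_ i (mem_enum _ i)) e.
by rewrite -[LHS](nth_index (xi v i) (xir w i Ww)) e nth_index // xir.
Qed.

Section CommutingMatrices.
Variables (k : closedFieldType) (K : fieldType) (io : {rmorphism k -> K}) (m : nat).
Hypothesis k_unc : ~ countable [set: k].
Variables (Om : Type) (A : Om -> 'M[K]_m) (W : set Om) (B : nat).

Hypothesis Acomm : forall w v, W w -> W v -> A w *m A v = A v *m A w.
Hypothesis Ainv : forall w, W w -> exists2 v, W v & A w *m A v = 1%:M.
Hypothesis Abound : forall s : 'I_B -> Om, (forall i, W (s i)) ->
  exists c : 'I_B -> k, (exists i, c i != 0) /\ \sum_i io (c i) *: A (s i) = 0.

(** The roots [cs] are taken in [k], although the matrices live over the larger field [K]: in the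
    end they have to be eigenvalues on functions with values in [k]. *)
Definition kill (cs : seq k) (S X : 'M[K]_m) :=
  foldl (fun X c => X *m (S - (io c)%:M)) X cs.

Lemma kill_cat cs cs' S X : kill (cs ++ cs') S X = kill cs' S (kill cs S X).
Proof. exact: foldl_cat. Qed.

Lemma kill_mulmx cs S X Z : kill cs S (Z *m X) = Z *m kill cs S X.
Proof. by elim: cs X => //= c cs IH X; rewrite -IH mulmxA. Qed.

Lemma kill_comm cs S X a : S *m a = a *m S -> kill cs S (X *m a) = kill cs S X *m a.
Proof.
move=> Sa; elim: cs X => //= c cs IH X; rewrite -IH -!mulmxA; congr (kill _ _ (_ *m _)).
by rewrite mulmxBr mulmxBl Sa scalar_mxC.
Qed.

Lemma kill_stable cs (S X U : 'M[K]_m) : (U *m S <= U)%MS -> (X <= U)%MS -> (kill cs S X <= U)%MS.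
Proof.
move=> US; elim: cs X => //= c cs IH X XU; apply: IH.
rewrite mulmxBr mul_mx_scalar; apply: addmx_sub.
  by apply: submx_trans US; apply: submxMr.
by rewrite -scaleNr; apply: scalemx_sub.
Qed.

Definition combine q (w : 'I_q -> Om) (c : 'I_q -> k) := \sum_j io (c j) *: A (w j).

Lemma combineE (U : 'M[K]_m) q (w : 'I_q -> Om) (c : 'I_q -> k) :
  U *m combine w c = \sum_j io (c j) *: (U *m A (w j)).
Proof. by rewrite mulmx_sumr; apply: eq_bigr => j _; rewrite scalemxAr. Qed.

Lemma combine_comm q (w : 'I_q -> Om) (c : 'I_q -> k) v :
  (forall j, W (w j)) -> W v -> A v *m combine w c = combine w c *m A v.
Proof.
move=> Ww Wv; rewrite /combine mulmx_sumr mulmx_suml; apply: eq_bigr => j _.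
by rewrite -scalemxAr -scalemxAl Acomm.
Qed.

(* The case where every k-combination of the A w is zero or injective on U:
   writing A w and its inverse as combinations with coefficient vectors kappa
   and kappa', the rank one matrices kappa^T kappa' lie in one fibre of the
   multiplication map, so there are finitely many of them. *)
Lemma proportional_on_domain (U : 'M[K]_m) (W0 : set Om) :
  U != 0 -> (forall w, W w -> (U *m A w <= U)%MS) ->
  (forall q (w : 'I_q -> Om) (c : 'I_q -> k), (forall j, W (w j)) ->
    U *m combine w c = 0 \/ \rank (U *m combine w c) = \rank U) ->
  W0 `<=` W -> ~ countable W0 ->
  exists W1, [/\ W1 `<=` W0, ~ countable W1 & forall w v, W1 w -> W1 v ->
    exists2 c, c != 0 & U *m A w = io c *: (U *m A v)].
Proof.
move=> U0 Ust dom W0W W0unc.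
pose indep q (w : 'I_q -> Om) := forall c, U *m combine w c = 0 -> forall j, c j = 0.
pose Q q := `[< exists w : 'I_q -> Om, (forall j, W (w j)) /\ indep q w >].
have exQ : exists q, Q q.
  exists 0%N; apply/asboolP.
  suff [w _] : exists w : Om, True.
    by exists (fun=> w); split=> [[]|c _ []].
  apply: contrapT => h; apply: W0unc; apply: (@sub_countable _ _ _ (set0 : set Om)).
    by apply: subset_card_le => w _; apply: h; exists w.
  exact: countable0.
have ubQ q : Q q -> (q <= B)%N.
  move=> /asboolP[w [Ww wind]]; rewrite leqNgt; apply/negP => Bq.
  have [c [[i ci] cA]] := Abound (fun i => Ww (widen_ord (ltnW Bq) i)).
  pose c' (j : 'I_q) := if (insub (j : nat) : option 'I_B) is Some i then c i else 0.
  case/eqP: ci; have <- : c' (widen_ord (ltnW Bq) i) = c i by rewrite /c' /= valK.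
  apply: wind; rewrite combineE (bigID (fun j : 'I_q => (j < B)%N)) /=.
  rewrite (big_ord_narrow (ltnW Bq)) [X in _ + X]big1 ?addr0; last first.
    by move=> j jB; rewrite /c' insubN // rmorph0 scale0r.
  rewrite -[RHS](mulmx0 _ U) -[X in _ *m X]cA mulmx_sumr; apply: eq_bigr => j _.
  by rewrite /c' /= valK scalemxAr.
(* [b] is a maximal family in [W] that is independent over [k] on [U]; its size is bounded by
   [Abound]. *)
case: (ex_maxnP exQ ubQ) => q /asboolP[b [Wb bind]] qmax.
have span w : W w -> exists c, U *m A w = U *m combine b c.
  move=> Ww; apply: contrapT => nspan.
  suff : Q q.+1 by move=> /qmax; rewrite ltnn.
  apply/asboolP; exists (fun j => if unlift ord_max j is Some i then b i else w).
  split=> [j|c]; first by case: unliftP.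
  rewrite combineE (bigD1_ord ord_max) //= unlift_none.
  under eq_bigr => i _ do rewrite liftK.
  rewrite -combineE => E.
  have c0 : c ord_max = 0.
    apply: contrapT => /eqP c0; apply: nspan.
    exists (fun i => - (c ord_max)^-1 * c (lift ord_max i)).
    have ioc : io (c ord_max) != 0 by rewrite fmorph_eq0.
    apply: (scalerI ioc); apply/eqP; rewrite -subr_eq0 -[X in _ == X]E; apply/eqP.
    congr (_ + _); rewrite !combineE scaler_sumr -sumrN; apply: eq_bigr => i _.
    by rewrite scalerA -rmorphM mulNr mulrN mulVKf // rmorphN scaleNr opprK.
  move: E; rewrite c0 rmorph0 scale0r add0r => /bind h j.
  by case: (unliftP ord_max j) => [i ->|->].
have /choice[kap kapP] : forall w, exists c, W w -> U *m A w = U *m combine b c.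
  move=> w; have [Ww|] := pselect (W w); last by exists (fun=> 0).
  by have [c cE] := span w Ww; exists c.
have /choice[vi viP] : forall w, exists v, W w -> W v /\ A w *m A v = 1%:M.
  move=> w; have [Ww|] := pselect (W w); last by exists w.
  by have [v Wv vE] := Ainv Ww; exists v.
pose ab i j := U *m A (b i) *m A (b j).
have prodE c c' : U *m combine b c *m combine b c' =
    \sum_i \sum_j io (c i * c' j) *: ab i j.
  rewrite [U *m combine b c]combineE mulmx_suml; apply: eq_bigr => i _.
  rewrite /combine mulmx_sumr; apply: eq_bigr => j _.
  by rewrite -scalemxAl -scalemxAr scalerA rmorphM.
have UAA w : W w -> U *m combine b (kap w) *m combine b (kap (vi w)) = U.
  move=> Ww; have [Wv AA] := viP w Ww.
  rewrite -kapP // -mulmxA combine_comm // mulmxA -kapP // -mulmxA.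
  by rewrite Acomm // AA mulmx1.
have U_kap w : W w -> U *m A w != 0.
  move=> Ww; apply: contraNneq U0 => UA0.
  by have [_ AA] := viP w Ww; rewrite -(mulmx1 U) -AA mulmxA UA0 mul0mx.
pose P (v : 'rV[k]_(q * q)) := \sum_i \sum_j io (v 0 (mxvec_index i j)) *: ab i j = 0.
have [||M MP] := @subspace_matrix _ _ P.
- by rewrite /P big1 // => i _; rewrite big1 // => j _; rewrite mxE rmorph0 scale0r.
- move=> a u v uP vP; rewrite /P -[RHS](scaler0 _ (io a)) -[X in _ = _ *: X]uP.
  rewrite -[RHS]addr0 -[X in _ = _ + X]vP scaler_sumr -big_split.
  apply: eq_bigr => i _; rewrite scaler_sumr -big_split; apply: eq_bigr => j _ /=.
  by rewrite !mxE rmorphD rmorphM scalerDl scalerA.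
pose l i j := cokermx M i j.
have lP (x : 'I_(q * q) -> k) : (forall j, \sum_i x i * l i j = 0) <-> P (\row_s x s).
  rewrite MP submxE; split=> [h|/eqP h j].
    by apply/eqP/rowP => j; rewrite !mxE -[RHS](h j); apply: eq_bigr => i _; rewrite mxE.
  have := congr1 (fun u : 'rV_(q * q) => u 0 j) h; rewrite [X in X = _]mxE mxE => E.
  by rewrite -[RHS]E; apply: eq_bigr => i _; rewrite mxE.
(* The cone of square matrices of rank at most one. *)
pose C := [set x : 'I_(q * q) -> k | forall i j i' j' : 'I_q,
  x (mxvec_index i j) * x (mxvec_index i' j') =
  x (mxvec_index i j') * x (mxvec_index i' j)].
pose xi w s := kap w (enum_val (cast_ord (esym (mxvec_cast q q)) s)).1 *
  kap (vi w) (enum_val (cast_ord (esym (mxvec_cast q q)) s)).2.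
have xiE w i j : xi w (mxvec_index i j) = kap w i * kap (vi w) j.
  by rewrite /xi /mxvec_index cast_ordK enum_rankK.
have xiP w : W w -> \sum_i \sum_j io (xi w (mxvec_index i j)) *: ab i j = U.
  move=> Ww; rewrite -[RHS](UAA w) // prodE.
  by apply: eq_bigr => i _; apply: eq_bigr => j _; rewrite xiE.
have [|||||r rP] := @cone_fibre_finite k (q * q) k_unc C (xi @` W) l.
- exists [set p | exists i j i' j' : 'I_q, p = 'X_(mxvec_index i j) *
    'X_(mxvec_index i' j') - 'X_(mxvec_index i j') * 'X_(mxvec_index i' j)].
  apply/seteqP; split=> x.
    move=> Cx _ [i [j [i' [j' ->]]]]; rewrite mevalB !mevalM !mevalXU.
    by rewrite Cx subrr.
  move=> h i j i' j'; apply/eqP; rewrite -subr_eq0; apply/eqP.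
  by rewrite -[RHS](h _ (ex_intro _ i (ex_intro _ j (ex_intro _ i'
    (ex_intro _ j' erefl))))) mevalB !mevalM !mevalXU.
- by move=> t x Cx i j i' j'; rewrite /scale_pt mulrACA Cx mulrACA.
- move=> x Cx /lP xP s; apply: contrapT => /eqP xs.
  case/mxvec_indexP: s xs => i0 j0 xs.
  pose al i := x (mxvec_index i j0); pose be j := x (mxvec_index i0 j).
  have Uab : U *m combine b al *m combine b be = 0.
    rewrite prodE -[RHS](scaler0 _ (io (x (mxvec_index i0 j0)))) -[X in _ = _ *: X]xP.
    rewrite scaler_sumr; apply: eq_bigr => i _; rewrite scaler_sumr.
    by apply: eq_bigr => j _; rewrite scalerA -rmorphM mxE [in RHS]mulrC Cx.
  have [/bind al0|rk] := dom q b al Wb.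
    by case/eqP: xs; apply: (al0 i0).
  have Ual : (U *m combine b al <= U)%MS.
    rewrite combineE summx_sub // => j _; apply: scalemx_sub.
    exact: Ust.
  have /submxP[Z UZ] : (U <= U *m combine b al)%MS.
    by have [_ <-] := mxrank_leqif_sup Ual; rewrite rk.
  case/eqP: xs; apply: (bind be _ j0).
  by rewrite UZ -mulmxA Uab mulmx0.
- move=> _ [w Ww <-] i j i' j'; rewrite !xiE mulrACA [RHS]mulrACA.
  by congr (_ * _); apply: mulrC.
- move=> _ _ j [w Ww <-] [v Wv <-]; apply/eqP; rewrite -subr_eq0; apply/eqP.
  rewrite -sumrB; transitivity (\sum_i (xi w i - xi v i) * l i j).
    by apply: eq_bigr => i _; rewrite mulrBl.
  move: j; apply/lP; rewrite /P -[RHS](subrr U) -{1}(xiP w) // -(xiP v) // -sumrB.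
  apply: eq_bigr => i _; rewrite -sumrB; apply: eq_bigr => j _.
  by rewrite !mxE rmorphB scalerBl.
have [|W1 [W1W0 W1unc W1P]] := uncountable_constant_fibre (xi := xi) (r := r) W0unc.
  by move=> w i /W0W Ww; apply: rP; exists w.
exists W1; split=> // w v W1w W1v; have Ww := W0W _ (W1W0 _ W1w); have Wv := W0W _ (W1W0 _ W1v).
have [Wiw _] := viP w Ww; have [Wiv _] := viP v Wv.
have [j kj] : exists j, kap (vi w) j != 0.
  apply: contrapT => h; have := U_kap _ Wiw; rewrite kapP // combineE big1 ?eqxx //.
  move=> i _; have -> : kap (vi w) i = 0; last by rewrite rmorph0 scale0r.
  by apply: contrapT => /eqP ki; apply: h; exists i.
(* The products [kap w i * kap (vi w) j] are the same for [w] and [v]; for a fixed [j] with nonzero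
   second factor this makes the two coefficient vectors proportional. *)
have UAw : U *m A w = io (kap (vi v) j / kap (vi w) j) *: (U *m A v).
  rewrite !kapP // !combineE scaler_sumr; apply: eq_bigr => i _.
  rewrite scalerA -rmorphM; congr (io _ *: _); apply: (mulIf kj).
  by rewrite -xiE (W1P w v) // xiE mulrAC mulfVK // mulrC.
exists (kap (vi v) j / kap (vi w) j) => //.
by apply: contraNneq (U_kap _ Ww) => c0; rewrite UAw c0 rmorph0 scale0r.
Qed.

(** Induction on the rank of [U]. If some combination [a] is neither zero nor injective on [U],
    commutativity makes the kernel of [a] in [U] and the image [U *m a] stable, and both have
    smaller rank. Otherwise the ratios within an uncountable subset act on [U] by scalars from
    [k]. *)
Lemma uncountable_killed (U : 'M[K]_m) (W0 : set Om) :
  (forall w, W w -> (U *m A w <= U)%MS) -> W0 `<=` W -> ~ countable W0 ->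
  exists W1, [/\ W1 `<=` W0, ~ countable W1 & forall w v v', W1 w -> W1 v -> W v' ->
    A v *m A v' = 1%:M ->
    exists2 cs, 0 \notin cs & kill cs (A w *m A v') U = 0].
Proof.
have [r] := ubnP (\rank U); elim: r U W0 => // r IH U W0; rewrite ltnS => Ur Ust W0W W0unc.
have [U0|U0] := eqVneq U 0.
  by exists W0; split=> // w v v' _ _ _ _; exists [::].
have [h|h] := pselect (exists q (w : 'I_q -> Om) c, [/\ (forall j, W (w j)),
    U *m combine w c != 0 & (\rank (U *m combine w c)%R < \rank U)%N]); last first.
  have [|W1 [W1W0 W1unc W1P]] := proportional_on_domain U0 Ust _ W0W W0unc.
    move=> q w c Ww; have [->|Uc] := eqVneq (U *m combine w c) 0; first by left.
    right; apply/eqP; rewrite eqn_leq; apply/andP; split.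
      apply: mxrankS; rewrite combineE summx_sub // => j _.
      by apply: scalemx_sub; apply: Ust.
    by rewrite leqNgt; apply/negP => rk; apply: h; exists q, w, c.
  exists W1; split=> // w v v' W1w W1v _ Avv'.
  have [c c0 cE] := W1P w v W1w W1v; exists [:: c]; first by rewrite inE eq_sym.
  rewrite /kill /= mulmxBr mulmxA cE -scalemxAl -mulmxA Avv' mulmx1.
  by rewrite mul_mx_scalar subrr.
have [q [w0 [c [Ww0 Ua rUa]]]] := h.
set a := combine w0 c in Ua rUa.
have ac v : W v -> A v *m a = a *m A v by exact: combine_comm.
pose U1 := (U :&: kermx a)%MS.
have rU : (\rank (U *m a) + \rank U1 = \rank U)%N := mxrank_mul_ker U a.
have U1st w : W w -> (U1 *m A w <= U1)%MS.
  move=> Ww; rewrite sub_capmx; apply/andP; split.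
    by apply: submx_trans (Ust w Ww); apply/submxMr/capmxSl.
  apply/sub_kermxP; rewrite -mulmxA ac // mulmxA.
  by rewrite (sub_kermxP (capmxSr _ _)) mul0mx.
have U2st w : W w -> (U *m a *m A w <= U *m a)%MS.
  by move=> Ww; rewrite -mulmxA -ac // mulmxA; apply/submxMr/Ust.
have rUa0 : (0 < \rank (U *m a))%N by rewrite lt0n mxrank_eq0.
have [|W1 [W1W0 W1unc W1P]] := IH U1 W0 _ U1st W0W W0unc; first by lia.
have [|W2 [W2W1 W2unc W2P]] := IH (U *m a) W1 _ U2st (subset_trans W1W0 W0W) W1unc; first by lia.
exists W2; split=> //; first exact: subset_trans W1W0.
move=> w v v' W2w W2v Wv' Avv'.
have [cs1 cs10 cs1P] := W1P w v v' (W2W1 _ W2w) (W2W1 _ W2v) Wv' Avv'.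
have [cs2 cs20 cs2P] := W2P w v v' W2w W2v Wv' Avv'.
have Ww := W0W _ (W1W0 _ (W2W1 _ W2w)).
exists (cs2 ++ cs1); first by rewrite mem_cat negb_or cs20.
have : (kill cs2 (A w *m A v') U <= U1)%MS.
  rewrite sub_capmx; apply/andP; split.
    apply: kill_stable => //; rewrite mulmxA.
    by apply: submx_trans (Ust v' Wv'); apply/submxMr/Ust.
  apply/sub_kermxP; rewrite -kill_comm ?cs2P //.
  by rewrite -mulmxA ac // mulmxA ac // -mulmxA.
by rewrite kill_cat => /submxP[Z ->]; rewrite kill_mulmx cs1P mulmx0.
Qed.

End CommutingMatrices.

(** * Regular functions and automorphisms *)

Section RegularFunctions.
Variable k : fieldType.
Implicit Types X Z : affine_variety k.

Definition ev X (p : {mpoly k[ambient_dim X]}) : X -> k := fun x => p.@[\val x].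
Definition regular X (f : X -> k) := exists p, f = ev p.
Definition crd X (i : 'I_(ambient_dim X)) : X -> k := fun x => \val x i.

Lemma points_inj X (x y : X) : (forall i, \val x i = \val y i) -> x = y.
Proof. by move=> h; apply/val_inj/funext. Qed.

Lemma regular_crd X i : regular (@crd X i).
Proof. by exists 'X_i; apply/funext => x; rewrite /ev mevalXU. Qed.

Lemma regular_cst X (c : k) : regular (fun _ : X => c).
Proof. by exists c%:MP; apply/funext => x; rewrite /ev mevalC. Qed.

Lemma regularD X (f g : X -> k) :
  regular f -> regular g -> regular (fun x => f x + g x).
Proof.
move=> [p ->] [q ->]; exists (p + q); apply/funext => x.
by rewrite /ev mevalD.
Qed.

Lemma regularM X (f g : X -> k) :
  regular f -> regular g -> regular (fun x => f x * g x).
Proof.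
move=> [p ->] [q ->]; exists (p * q); apply/funext => x.
by rewrite /ev mevalM.
Qed.

Lemma regularZ X c (f : X -> k) : regular f -> regular (fun x => c * f x).
Proof. by move=> h; apply: regularM => //; apply: regular_cst. Qed.

Lemma regularB X (f g : X -> k) :
  regular f -> regular g -> regular (fun x => f x - g x).
Proof.
move=> hf hg; have := regularD hf (regularZ (-1) hg).
by under eq_fun do rewrite mulN1r.
Qed.

Lemma regular_sum X (I : Type) (r : seq I) (P : pred I) (F : I -> X -> k) :
  (forall i, P i -> regular (F i)) -> regular (fun x => \sum_(i <- r | P i) F i x).
Proof.
move=> h; elim: r => [|i r IH].
  by under eq_fun do rewrite big_nil; apply: regular_cst.
under eq_fun do rewrite big_cons.
by have [Pi|_] := boolP (P i); [apply: regularD => //; apply: h|].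
Qed.

Lemma regular_prod X (I : Type) (r : seq I) (P : pred I) (F : I -> X -> k) :
  (forall i, P i -> regular (F i)) -> regular (fun x => \prod_(i <- r | P i) F i x).
Proof.
move=> h; elim: r => [|i r IH].
  by under eq_fun do rewrite big_nil; apply: regular_cst.
under eq_fun do rewrite big_cons.
by have [Pi|_] := boolP (P i); [apply: regularM => //; apply: h|].
Qed.

Lemma regularX X (f : X -> k) e : regular f -> regular (fun x => f x ^+ e).
Proof.
move=> h; elim: e => [|e IH]; first by under eq_fun do rewrite expr0; apply: regular_cst.
by under eq_fun do rewrite exprS; apply: regularM.
Qed.

Lemma regular_meval X n (p : {mpoly k[n]}) (F : 'I_n -> X -> k) :
  (forall i, regular (F i)) -> regular (fun x => p.@[fun i => F i x]).
Proof.
move=> h; under eq_fun do rewrite mevalE.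
apply: regular_sum => m _; apply: regularZ; apply: regular_prod => i _.
exact: regularX.
Qed.

Lemma morphism_regular X Z (f : X -> Z) :
  morphism f <-> forall i, regular (fun x => crd i (f x)).
Proof.
split=> [[P fP] i|h]; first by exists (P i); apply/funext => x; rewrite /crd fP.
have /choice[P PE] : forall i, exists p, (fun x => crd i (f x)) = ev p.
  by move=> i; have [p pE] := h i; exists p.
by exists P => x i; have := congr1 (fun g => g x) (PE i).
Qed.

Lemma regular_comp X Z (f : X -> Z) (g : Z -> k) :
  morphism f -> regular g -> regular (fun x => g (f x)).
Proof.
move=> mf [p ->].
rewrite (_ : (fun _ => _) = fun x => p.@[fun i => crd i (f x)]) //.
by apply: regular_meval; apply/morphism_regular.
Qed.

Lemma aut_morphism X (g : Aut X) : morphism g.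
Proof. by have [h []] := autP g. Qed.

Lemma regular_aut X (g : Aut X) (f : X -> k) : regular f -> regular (fun x => f (g x)).
Proof. exact/regular_comp/aut_morphism. Qed.

Lemma autV X (g : Aut X) x : (g^-1)%g (g x) = x.
Proof. exact: aut_funK. Qed.

Lemma autVr X (g : Aut X) x : g ((g^-1)%g x) = x.
Proof. exact: aut_inv_funK. Qed.

Lemma aut_eq X (g h : Aut X) : (forall x, g x = h x) -> g = h.
Proof. by move=> e; apply/val_inj/funext. Qed.

Lemma exists_aut X (f g : X -> X) :
  (forall i, regular (fun x => crd i (f x))) ->
  (forall i, regular (fun x => crd i (g x))) ->
  cancel f g -> cancel g f -> exists a : Aut X, forall x, a x = f x.
Proof.
move=> /morphism_regular mf /morphism_regular mg fg gf.
have fA : is_automorphism f by exists g.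
by exists (MkAut (asboolT fA)).
Qed.

(** Maps into [X] are constructed by this: a tuple of coordinates is a point as soon as it inherits
    all polynomial identities of [X]. *)
Lemma exists_point X (v : 'I_(ambient_dim X) -> k) :
  (forall p, (forall x : X, p.@[\val x] = 0) -> p.@[v] = 0) ->
  exists x : X, \val x = v.
Proof.
move=> h; have [S XS] := points_closed X.
have Xv : points X v.
  rewrite XS => p Sp; apply: h => x.
  have : zero_locus S (\val x) by rewrite -XS; apply: (set_valP x).
  exact.
by exists (exist _ v (mem_set Xv)).
Qed.

End RegularFunctions.

Section IrreducibleVariety.
Local Open Scope quotient_scope.
Variables (k : fieldType) (Y : irr_affine_variety k).
Local Notation N := (ambient_dim Y).

Lemma regular_domain (f g : Y -> k) : regular f -> regular g ->
  (forall y, f y * g y = 0) -> (forall y, f y = 0) \/ (forall y, g y = 0).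
Proof.
move=> [p ->] [q ->] pq.
have /(@vanishing_prime k Y p q)/orP[] : p * q \in @vanishing_ideal k Y.
- apply/vanishingP => x Yx; rewrite mevalM.
  exact: (pq (exist _ x (mem_set Yx))).
- by move/vanishingP => h; left => y; apply/h/set_valP.
- by move/vanishingP => h; right => y; apply/h/set_valP.
Qed.

Lemma irr_nonempty : exists y : Y, True.
Proof.
by have [[x Yx] _] := irr_varietyP Y; exists (exist _ x (mem_set Yx)).
Qed.

(** [K] is the function field of [Y] and [ka] the evaluation at the generic point; the sections
    below only need the kernel of [ka]. *)
Lemma generic_field : exists (K : fieldType) (ka : {rmorphism {mpoly k[N]} -> K}),
  forall p, ka p = 0 <-> ev p = (fun _ : Y => 0).
Proof.
pose Q := {ideal_quot (@vanishing_ideal k Y : prime_idealr {mpoly k[N]})}.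
pose pi : {rmorphism {mpoly k[N]} -> coordinate_ring Y} := \pi_Q.
pose ka : {rmorphism {mpoly k[N]} -> {fraction coordinate_ring Y}} :=
  (@tofrac (coordinate_ring Y) \o pi).
have piE p : (pi p == 0) = (p \in @vanishing_ideal k Y).
  rewrite -(rmorph0 pi) -[in RHS](subr0 p).
  exact/esym/(Quotient.idealrBE (@vanishing_ideal k Y : prime_idealr _)).
exists {fraction coordinate_ring Y}, ka => p.
have -> : ka p = 0 <-> p \in @vanishing_ideal k Y.
  by rewrite -piE -tofrac_eq0; split=> /eqP.
split=> [/vanishingP h|h]; first by apply/funext => y; apply/h/set_valP.
by apply/vanishingP => x Yx; have := congr1 (fun f => f (exist _ x (mem_set Yx) : Y)) h.
Qed.

End IrreducibleVariety.

(** * Locally finite automorphisms *)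

Section GenericOrbit.
Variables (k : fieldType) (Y : irr_affine_variety k).
Local Notation N := (ambient_dim Y).
Local Notation G := (Aut Y).
Variables (K : fieldType) (ka : {rmorphism {mpoly k[N]} -> K}).
Hypothesis kaP : forall p, ka p = 0 <-> ev p = (fun _ : Y => 0).

Definition io : {rmorphism k -> K} := (ka \o @mpolyC N k).

Definition emb (f : Y -> k) : K :=
  if pselect (regular f) is left h then ka (sval (cid h)) else 0.

Lemma emb_ev p : emb (ev p) = ka p.
Proof.
rewrite /emb; case: pselect => [h|[]]; last by exists p.
case: cid => q /= pq; apply/eqP; rewrite -subr_eq0 -rmorphB; apply/eqP/kaP.
apply/funext => y; have := congr1 (fun f => f y) pq.
by rewrite /ev mevalB => ->; rewrite subrr.
Qed.

Lemma emb_eq0 f : regular f -> emb f = 0 -> forall y, f y = 0.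
Proof. by move=> [p ->]; rewrite emb_ev => /kaP -> y. Qed.

Lemma embBZ f g c : regular f -> regular g ->
  emb (fun y => f y - c * g y) = emb f - io c * emb g.
Proof.
move=> [p ->] [q ->]; rewrite !emb_ev /io /= -rmorphM -rmorphB -emb_ev.
by congr emb; apply/funext => y; rewrite /ev mevalB mevalM mevalC.
Qed.

(* The image of the generic point of Y under w. *)
Definition gpt (w : G) : 'I_N -> K := fun i => emb (fun y => crd i (w y)).

Lemma meval_gpt (p : {mpoly k[N]}) w :
  (map_mpoly io p).@[gpt w] = emb (fun y => ev p (w y)).
Proof.
have /choice[P PE] : forall i, exists q, (fun y => crd i (w y)) = ev q.
  by move=> i; have [q qE] := regular_aut w (regular_crd i); exists q.
have -> : (fun y => ev p (w y)) = ev (p \mPo [tuple P i | i < N]).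
  apply/funext => y; rewrite /ev comp_mpoly_meval; apply: meval_eq => i.
  by rewrite tnth_mktuple; have := congr1 (fun f => f y) (PE i).
rewrite emb_ev; elim/mpoly_ring_ind: p => [c|i|p q IHp IHq|p q IHp IHq].
- by rewrite map_mpolyC mevalC comp_mpolyC.
- by rewrite map_mpolyX mevalXU comp_mpolyXU -tnth_nth tnth_mktuple /gpt PE emb_ev.
- by rewrite !rmorphD /= IHp IHq.
- by rewrite !rmorphM /= IHp IHq.
Qed.

(** Since [s] is given by polynomials over [k], left multiplication by [s] is polynomial in the
    coordinates [gpt]. Hence translations are homeomorphisms of the group. *)
Lemma gptM (s : G) : exists Q : 'I_N -> {mpoly K[N]},
  forall w, gpt (s * w)%g = fun i => (Q i).@[gpt w].
Proof.
have /choice[P PE] : forall i, exists q, (fun y => crd i (s y)) = ev q.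
  by move=> i; have [q qE] := regular_aut s (regular_crd i); exists q.
exists (fun i => map_mpoly io (P i)) => w; apply/funext => i; rewrite meval_gpt.
by congr emb; apply/funext => y; have := congr1 (fun f => f (w y)) (PE i).
Qed.

Local Notation cl := (Zclosure gpt).
Local Notation closed := (Zclosed gpt).
Local Notation irr := (Zirr gpt).
Implicit Types (A B C V : set G) (s w : G).

Definition transl s V : set G := [set w | V (s^-1 * w)%g].

Lemma transl_closed s V : closed V -> closed (transl s V).
Proof.
move=> [S ->]; have [Q QE] := gptM (s^-1)%g.
exists [set p \mPo [tuple Q i | i < N] | p in S].
apply/seteqP; split=> w.
  move=> h _ [p Sp <-]; rewrite comp_mpoly_meval -[RHS](h p Sp) QE.
  by apply: meval_eq => i; rewrite tnth_mktuple.
move=> h p Sp; rewrite QE.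
have := h _ (ex_intro2 _ _ p Sp erefl); rewrite comp_mpoly_meval => E.
by rewrite -[RHS]E; apply: meval_eq => i; rewrite tnth_mktuple.
Qed.

Lemma translK s V : transl s (transl (s^-1)%g V) = V.
Proof. by apply/seteqP; split=> w; rewrite /transl /= invgK mulgA mulgV mul1g. Qed.

Lemma translVK s V : transl (s^-1)%g (transl s V) = V.
Proof. by apply/seteqP; split=> w; rewrite /transl /= invgK mulgA mulVg mul1g. Qed.

Lemma transl_mono s A B : A `<=` B -> transl s A `<=` transl s B.
Proof. by move=> AB w /AB. Qed.

Lemma transl_irr s V : irr V -> irr (transl s V).
Proof.
move=> [[v Vv] Virr]; split; first by exists (s * v)%g; rewrite /transl /= mulgA mulVg mul1g.
move=> A B Acl Bcl VAB.
have [||h|h|h] := Virr (transl (s^-1)%g A) (transl (s^-1)%g B).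
- exact: transl_closed.
- exact: transl_closed.
- by rewrite -(translVK s V); apply: (transl_mono VAB).
- by left; rewrite -(translK s A); apply: transl_mono.
- by right; rewrite -(translK s B); apply: transl_mono.
Qed.

Lemma transl_closure s A B : (forall w, A w -> B (s * w)%g) ->
  cl A `<=` transl (s^-1)%g (cl B).
Proof.
move=> AB; apply: Zclosure_min; first exact/transl_closed/Zclosed_closure.
by move=> w /AB; rewrite /transl /= invgK; apply: sub_Zclosure.
Qed.

Lemma closure1_irr w : irr (cl [set w]).
Proof.
split; first by exists w; apply: sub_Zclosure.
move=> A B Acl Bcl h.
have [Aw|Bw] : A w \/ B w by apply/h/sub_Zclosure.
- by left; apply: Zclosure_min => // _ ->.
- by right; apply: Zclosure_min => // _ ->.
Qed.

End GenericOrbit.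

Section ZirrUnion.
Variables (K : fieldType) (n : nat) (Om : Type) (pt : Om -> 'I_n -> K).

Lemma Zclosed_bigcup (D : nat -> set Om) (P : set nat) m :
  (forall i, (i < m)%N -> Zclosed pt (D i)) ->
  Zclosed pt (\bigcup_(i in [set i | (i < m)%N /\ P i]) D i).
Proof.
elim: m => [|m IH] Dcl.
  rewrite (_ : \bigcup_(_ in _) _ = set0); first exact: Zclosed0.
  by apply/seteqP; split=> // w [i []].
have {}IH := IH (fun i im => Dcl i (leqW im)).
have [Pm|nPm] := pselect (P m).
  have := ZclosedU IH (Dcl m (ltnSn m)); congr Zclosed; apply/seteqP; split=> w.
    by case=> [[i [im Pi] Di]|Dm]; [exists i => //; split=> //; apply: leqW|exists m].
  move=> [i [im Pi] Di]; move: im; rewrite ltnS leq_eqVlt => /predU1P[im|im].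
    by right; rewrite -im.
  by left; exists i.
congr (Zclosed pt): IH; apply/seteqP; split=> w [i [im Pi] Di]; exists i => //; split=> //.
  exact: leqW.
move: im; rewrite ltnS leq_eqVlt => /predU1P[im|//].
by case: nPm; rewrite -im.
Qed.

Lemma Zirr_sub_bigcup C (D : nat -> set Om) (P : set nat) m : Zirr pt C ->
  (forall i, (i < m)%N -> Zclosed pt (D i)) ->
  C `<=` \bigcup_(i in [set i | (i < m)%N /\ P i]) D i ->
  exists i, [/\ (i < m)%N, P i & C `<=` D i].
Proof.
move=> [[c Cc] Cirr] Dcl; elim: m Dcl => [|m IH] Dcl Csub.
  by have [i []] := Csub c Cc.
have Dcl' i : (i < m)%N -> Zclosed pt (D i) by move=> im; apply: Dcl; apply: leqW.
have h : C `<=` (\bigcup_(i in [set i | (i < m)%N /\ P i]) D i) `|`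
    (\bigcup_(i in [set i | (i < m.+1)%N /\ (P i /\ i = m)]) D i).
  move=> w /Csub[i [im Pi] Di]; have [e|ne] := eqVneq i m; [right|left]; exists i => //.
  by split=> //; rewrite ltn_neqAle ne -ltnS.
have [||i1|i2] := Cirr _ _ _ _ h; [exact: Zclosed_bigcup|exact: Zclosed_bigcup| |].
  by have [i [im Pi CD]] := IH Dcl' i1; exists i; split=> //; apply: leqW.
have [i [_ [Pi im]] _] := i2 c Cc.
exists m; split; rewrite -?im //; rewrite im => // w /i2[j [_ [_ ->]]]//.
Qed.

End ZirrUnion.

(** * Degrees of automorphisms, subgroups of countable index and density *)

Section BoundedDegree.
Variables (k : fieldType) (Y : irr_affine_variety k).
Local Notation N := (ambient_dim Y).
Implicit Types (v w : Aut Y).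

Definition degree_le (d : nat) w := exists P : 'I_N -> {mpoly k[N]},
  (forall i, mdeg_le d (P i)) /\ forall i, (fun y => crd i (w y)) = ev (P i).

(** Bounding the inverse as well makes these sets stable under inversion. *)
Definition bidegree_le (d : nat) := [set w | degree_le d w /\ degree_le d (w^-1)%g].

Lemma degree_leW d d' w : (d <= d')%N -> degree_le d w -> degree_le d' w.
Proof.
by move=> dd [P [Pd PE]]; exists P; split=> // i; apply: mdeg_leW (Pd i).
Qed.

Lemma degree_le_exists w : exists d, degree_le d w.
Proof.
have /choice[P PE] : forall i, exists q, (fun y => crd i (w y)) = ev q.
  by move=> i; have [q qE] := regular_aut w (regular_crd i); exists q.
exists (\sum_i msize (P i))%N, P; split=> // i.
by apply: mdeg_leW (@mdeg_le_msize _ _ (P i)); rewrite (bigD1 i) //= leq_addr.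
Qed.

Lemma degree_leM d d' w v : degree_le d w -> degree_le d' v ->
  degree_le (d * d') (w * v)%g.
Proof.
move=> [P [Pd PE]] [Q [Qd QE]]; exists (fun i => P i \mPo [tuple Q j | j < N]).
split=> i.
  rewrite comp_mpolyE; apply: mdeg_leZsum => m /(Pd i) md.
  apply: (@mdeg_leW _ _ (mdeg m * d')); first by rewrite leq_mul2r md orbT.
  by rewrite mdegE; apply: mdeg_le_prod => j; rewrite tnth_mktuple.
apply/funext => y; rewrite /ev comp_mpoly_meval.
have -> : crd i ((w * v)%g y) = (P i).@[\val (v y)].
  by have := congr1 (fun f => f (v y)) (PE i).
apply: meval_eq => j; rewrite tnth_mktuple.
by have := congr1 (fun f => f y) (QE j).
Qed.

Lemma bidegree_le_mono d d' : (d <= d')%N -> bidegree_le d `<=` bidegree_le d'.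
Proof. by move=> dd w [h h']; split; apply: degree_leW dd _. Qed.

Lemma bidegree_le_exists w : exists d, bidegree_le d w.
Proof.
have [d wd] := degree_le_exists w; have [d' wd'] := degree_le_exists (w^-1)%g.
exists (d + d')%N; split.
  by apply: degree_leW wd; apply: leq_addr.
by apply: degree_leW wd'; apply: leq_addl.
Qed.

Lemma bidegree_leM d d' w v : bidegree_le d w -> bidegree_le d' v ->
  bidegree_le (d * d') (w * v)%g.
Proof.
move=> [wd wd'] [vd vd']; split; first exact: degree_leM.
by rewrite invgM mulnC; apply: degree_leM.
Qed.

Lemma bidegree_leV d w : bidegree_le d w -> bidegree_le d (w^-1)%g.
Proof. by move=> [h h']; split; rewrite ?invgK. Qed.

End BoundedDegree.

Section CoCountable.
Variables (k : fieldType) (Y : irr_affine_variety k) (T : set (Aut Y)).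
Local Notation G := (Aut Y).

Definition is_subgroup (S : set G) :=
  [/\ S 1%g, forall s t, S s -> S t -> S (s * t)%g & forall s, S s -> S (s^-1)%g].

(* For S <= T: S has countable index in T, phrased so as to compose. *)
Definition cocountable (S : set G) := forall A, A `<=` T -> ~ countable A ->
  exists2 a, A a & ~ countable (A `&` [set b | S (a^-1 * b)%g]).

Lemma uncountable_nonempty (U : Type) (A : set U) : ~ countable A -> A !=set0.
Proof.
move=> Aunc; apply: contrapT => A0; apply: Aunc.
rewrite (_ : A = set0); first exact: countable0.
by apply/seteqP; split=> // a Aa; apply: A0; exists a.
Qed.

Lemma cocountable_uncountable (S : set G) : ~ countable T -> cocountable S ->
  ~ countable S.
Proof.
move=> Tunc Sco Sc; have [a _] := Sco T (@subset_refl _ T) Tunc; apply.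
apply: (@sub_countable _ _ _ [set (a * s)%g | s in S]).
  apply: subset_card_le => b [_ /= Sb]; exists (a^-1 * b)%g => //.
  by rewrite mulgA mulgV mul1g.
exact: (sub_countable (card_image_le _ _)).
Qed.

End CoCountable.

Section Density.
Variables (k : fieldType) (Y : irr_affine_variety k).
Local Notation N := (ambient_dim Y).
Local Notation G := (Aut Y).
Variables (K : fieldType) (ka : {rmorphism {mpoly k[N]} -> K}).
Hypothesis kaP : forall p, ka p = 0 <-> ev p = (fun _ : Y => 0).
Local Notation pt := (gpt (Y := Y) ka).
Local Notation cl := (Zclosure pt).
Variable T : set G.
Hypotheses (Tgrp : is_subgroup T) (Tunc : ~ countable T).

(* Choose S of countable index in T with least closure, and C maximal among
   the irreducible closed sets contained in some closure of S :&: (degree <= d).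
   The translates of C are components of such closures, so there are countably
   many of them and the stabilizer of C has countable index; by minimality of S
   the closure of S :&: (degree <= d) is then the one of S. *)
Lemma bounded_dense_subset : exists (S : set G) (d : nat),
  [/\ S `<=` T, is_subgroup S, ~ countable (S `&` bidegree_le d) &
      S `<=` cl (S `&` bidegree_le d)].
Proof.
pose good S := [/\ S `<=` T, is_subgroup S & cocountable T S].
have goodT : good T.
  split=> // A AT Aunc; have [a Aa] := uncountable_nonempty Aunc; exists a => //.
  rewrite (_ : _ `&` _ = A) //; apply/seteqP; split=> [b []//|b Ab]; split=> //=.
  by have [_ TM TV] := Tgrp; apply: TM; [apply: TV|]; apply: AT.
have [V [S [ST Sgrp Sco] SV] Vmin] : exists2 V, (cl @` good) V &
    forall W, (cl @` good) W -> W `<=` V -> W = V.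
  apply: (@Zclosed_min _ _ _ pt); first by move=> _ [S _ <-]; apply: Zclosed_closure.
  by exists (cl T), T.
have [S1 SM SV'] := Sgrp.
pose F := [set C | [/\ Zclosed pt C, Zirr pt C &
  exists d, C `<=` cl (S `&` bidegree_le d)]].
have F0 : F !=set0.
  exists (cl [set 1%g]); split; [exact: Zclosed_closure|exact: closure1_irr|].
  have [d d1] := bidegree_le_exists (1%g : G); exists d; apply: Zclosure_sub.
  by move=> _ ->; apply: sub_Zclosure.
have Ftr s C : S s -> F C -> F (transl s C).
  move=> Ss [Ccl Cirr [d Cd]]; split; [exact: transl_closed|exact: transl_irr|].
  have [e se] := bidegree_le_exists s; exists (e * d)%N => w /Cd.
  move=> /(@transl_closure _ _ _ _ kaP s _ (S `&` bidegree_le (e * d))).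
  rewrite /transl /= invgK mulgA mulgV mul1g; apply=> v [Sv vd].
  by split; [exact: SM|exact: bidegree_leM].
have [C FC Cmax] : exists2 C, F C & forall D, F D -> C `<=` D -> D = C.
  by apply: (@Zirr_max _ _ _ pt) => // C [].
have trmax s D : S s -> F D -> transl s C `<=` D -> D = transl s C.
  move=> Ss FD CD; rewrite -(translK s D); congr transl.
  apply: Cmax; first by apply: Ftr => //; apply: SV'.
  by rewrite -[X in X `<=` _](translVK s); apply: transl_mono.
have /choice[m /choice[D DP]] : forall d, exists m D,
    (forall i, (i < m)%N -> Zclosed pt (D i) /\ Zirr pt (D i)) /\
    cl (S `&` bidegree_le d) = \bigcup_(i in [set i | (i < m)%N]) D i.
  by move=> d; apply: Zirr_cover; apply: Zclosed_closure.
have DF d i : (i < m d)%N -> F (D d i).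
  move=> im; have [/(_ i im)[? ?] clE] := DP d; split=> //; exists d.
  by rewrite clE => w Dw; exists i.
have comp s : S s -> exists d i, (i < m d)%N /\ transl s C = D d i.
  move=> Ss; have [Dirr [Ccl Cirr [d Cd]]] := (DP, Ftr s C Ss FC).
  have [DPd clE] := DP d.
  have [||i [im _ CDi]] := @Zirr_sub_bigcup _ _ _ pt _ (D d) setT (m d) Cirr.
  - by move=> i /DPd[].
  - by move=> w /Cd; rewrite clE => -[i im Di]; exists i.
  by exists d, i; split=> //; rewrite (trmax s (D d i)) //; apply: DF.
(* If [C] missed [S], the elements of [S] of degree at most [d] would lie in the components other
   than [C]; then so would [C], against its maximality. *)
have [w0 [Cw0 Sw0]] : exists w0, C w0 /\ S w0.
  have [Ccl Cirr [d Cd]] := FC; have [DPd clE] := DP d.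
  apply: contrapT => h.
  pose P : set nat := [set i | D d i <> C].
  have sub : S `&` bidegree_le d `<=` \bigcup_(i in [set i | (i < m d)%N /\ P i]) D d i.
    move=> w Sdw; have := sub_Zclosure (pt := pt) Sdw; rewrite clE => -[i im Di].
    exists i => //; split=> // e; apply: h; exists w; split; last by case: Sdw.
    by rewrite -e.
  have [||i [im Pi CDi]] := @Zirr_sub_bigcup _ _ _ pt _ (D d) P (m d) Cirr.
  - by move=> i /DPd[].
  - apply: (subset_trans Cd); apply: Zclosure_min sub; apply: Zclosed_bigcup.
    by move=> i /DPd[].
  by apply: Pi; apply: Cmax => //; apply: DF.
pose C0 := transl (w0^-1)%g C.
have FC0 : F C0 by apply: Ftr => //; apply: SV'.
have C01 : C0 1%g by rewrite /C0 /transl /= invgK mulg1.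
pose S' := S `&` [set s | transl s C0 = C0].
have translM (s t : G) V' : transl (s * t)%g V' = transl s (transl t V').
  by apply/seteqP; split=> w; rewrite /transl /= invgM mulgA.
have S'grp : is_subgroup S'.
  split; first by split=> //=; apply/seteqP; split=> w; rewrite /transl /= invg1 mul1g.
    by move=> s t [Ss sC] [St tC]; split; [exact: SM|rewrite /= translM tC].
  by move=> s [Ss sC]; split; [exact: SV'|rewrite /= -{1}sC translVK].
have goodS' : good S'.
  split=> //; first by move=> s [/ST].
  move=> A AT Aunc; have [a Aa Unc] := Sco A AT Aunc.
  (* Elements with the same translate of [C0] differ by an element of its stabilizer, and the
     translates are numbered by a degree and the index of a component. *)
  have /choice[code codeP] : forall b, exists c : nat, S (a^-1 * b)%g ->
      exists d i, [/\ (i < m d)%N, transl (a^-1 * b)%g C0 = D d i & c = pickle (d, i)].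
    move=> b; have [Sb|] := pselect (S (a^-1 * b)%g); last by exists 0%N.
    have [d [i [im e]]] := comp (a^-1 * b * w0^-1)%g (SM _ _ Sb (SV' _ Sw0)).
    by exists (pickle (d, i)) => _; exists d, i; split=> //; rewrite -e (translM (a^-1 * b)%g).
  have [c Uc] := uncountable_fiber code Unc.
  have [b [[Ab Sb] cb]] := uncountable_nonempty Uc.
  exists b => //; apply: contra_not Uc => /(sub_countable _); apply.
  apply: subset_card_le => b' [[Ab' Sb'] cb']; split=> //=.
  have bb' : (b^-1 * b' = (a^-1 * b)^-1 * (a^-1 * b'))%g.
    by rewrite invgM invgK mulgA -[(_ * a * _)%g]mulgA mulgV mulg1.
  rewrite bb'; split=> /=; first by apply: SM => //; apply: SV'.
  have [d [i [_ e ce]]] := codeP b Sb; have [d' [i' [_ e' ce']]] := codeP b' Sb'.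
  move: cb cb'; rewrite /= ce ce' => <- /(pcan_inj pickleK) [dd' ii'].
  by rewrite translM e' dd' ii' -e translVK.
have [C0cl C0irr [d0 C0d]] := FC0.
have S'C0 : cl S' `<=` C0.
  apply: Zclosure_min => // s [Ss <-]; rewrite /transl /=.
  by rewrite mulVg.
(* Minimality of the closure of [S] enters here. It puts [S] into [C0], which lies in the closure of
   a part of bounded degree. *)
have clS' : cl S' = cl S.
  rewrite SV; apply: Vmin; first by exists S'.
  by rewrite -SV; apply: Zclosure_mono => s [].
have /choice[deg degP] : forall s : G, exists d, bidegree_le d s.
  by move=> s; apply: bidegree_le_exists.
have [d1 d1unc] := uncountable_fiber deg (cocountable_uncountable Tunc Sco).
(* [d0] serves the density, [d1] the uncountability. *)
exists S, (maxn d0 d1); split=> //.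
  apply: contra_not d1unc => /(sub_countable _); apply; apply: subset_card_le.
  move=> s [Ss /= ds]; split=> //; apply: (bidegree_le_mono (leq_maxr d0 d1)).
  by rewrite -ds.
move=> s Ss; have : cl S' s by rewrite clS'; apply: sub_Zclosure.
move=> /S'C0/C0d; apply: Zclosure_mono => v [Sv vd]; split=> //.
exact: (bidegree_le_mono (leq_maxl d0 d1)).
Qed.

End Density.

Definition shift (k : fieldType) (X : Type) (s : X -> X) (c : k) (f : X -> k) :=
  fun x => f (s x) - c * f x.

Section LocallyFinite.
Variables (k : closedFieldType) (Y : irr_affine_variety k).
Hypothesis k_unc : ~ countable [set: k].
Local Notation N := (ambient_dim Y).
Local Notation G := (Aut Y).
Variable T : set G.
Hypotheses (Tgrp : is_subgroup T) (Tunc : ~ countable T).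
Hypothesis Tcomm : forall s t, T s -> T t -> (s * t)%g = (t * s)%g.

(* The functions s |-> (x_i o t)(s eta), t in S, eta the generic point, span a
   finite dimensional K-space of functions on S: on the subset W of bounded
   degree they do, and W is dense. The matrices of S acting on this space are
   k-combinations of finitely many matrices as long as the degree is bounded. *)
Lemma uncountable_locally_finite : exists W : set G,
  [/\ W `<=` T, ~ countable W & forall w v, W w -> W v -> exists2 cs : seq k,
    0 \notin cs & forall i y,
      foldl (fun f c => shift (w * v^-1)%g c f) (@crd k Y i) cs y = 0].
Proof.
have [K [ka kaP]] := generic_field Y.
have [S [d [ST [S1 SM SV] Wunc Sdense]]] := bounded_dense_subset kaP Tgrp Tunc.
set W := S `&` bidegree_le d in Wunc Sdense.
have WS : W `<=` S by move=> w [].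
have Scomm s t : S s -> S t -> (s * t)%g = (t * s)%g by move=> /ST Ts /ST; apply: Tcomm.
pose kk : {rmorphism k -> K} := io ka.
pose e (h : G * 'I_N) (s : G) := gpt ka (h.1 * s)%g h.2.
have eE h s t : e h (s * t)%g = e ((h.1 * s)%g, h.2) t by rewrite /e /= mulgA.
have /choice[P0 P0E] : forall w, exists P : 'I_N -> {mpoly k[N]}, W w ->
    (forall i, (msize (P i) <= d.+1)%N) /\ forall i, (fun y => crd i (w y)) = ev (P i).
  move=> w; have [[_ [[P [Pd PE]] _]]|] := pselect (W w); last by exists (fun=> 0).
  by exists P => _; split=> // i; apply: mdeg_leP.
(* Commutativity moves [w] to the front, so that its defining polynomials, with coefficients in [k],
   are evaluated at the image of the generic point under [h.1 * s]. *)
have eP (h : G * 'I_N) (w s : G) : S h.1 -> W w ->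
    e h (w * s)%g = (map_mpoly kk (P0 w h.2)).@[gpt ka (h.1 * s)%g].
  move=> Sh Ww; have [_ PE] := P0E w Ww.
  rewrite /e mulgA (Scomm _ _ Sh (WS _ Ww)) -mulgA meval_gpt // -PE.
  by [].
pose indep m (h : 'I_m -> G * 'I_N) := forall g : 'I_m -> K,
  (forall s, S s -> \sum_a g a * e (h a) s = 0) -> forall a, g a = 0.
pose Smap m (h : 'I_m -> G * 'I_N) := forall a, S (h a).1.
(* A relation on [W] is the vanishing of one polynomial in [gpt], so it extends to the closure of
   [W]. *)
have dense m (h : 'I_m -> G * 'I_N) (g : 'I_m -> K) :
    (forall w, W w -> \sum_a g a * e (h a) w = 0) ->
    forall s, S s -> \sum_a g a * e (h a) s = 0.
  move=> hW s /Sdense.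
  have /choice[Q QE] : forall a, exists q : {mpoly K[N]},
      forall s, e (h a) s = q.@[gpt ka s].
    move=> a; have [Q QE] := gptM kaP (h a).1; exists (Q (h a).2) => t.
    by rewrite /e QE.
  have qE t : \sum_a g a * e (h a) t = (\sum_a g a *: Q a).@[gpt ka t].
    by rewrite raddf_sum; apply: eq_bigr => a _ /=; rewrite mevalZ QE.
  by rewrite qE; apply=> w Ww; rewrite -qE; apply: hW.
pose J : finType := ('I_N * 'X_{1..N < d.+1})%type.
(* On [W] each [e (h a)] is a fixed combination of the coefficients of the polynomials defining [w].
   These are indexed by [J], so more than [#|J|] such functions are dependent. *)
have bounded m (h : 'I_m -> G * 'I_N) : Smap m h -> indep m h -> (m <= #|{: J}|)%N.
  move=> Sh hind; rewrite leqNgt; apply/negP => Jm.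
  have [g [[a ga] gJ]] := linear_dependence_fin (fun a (j : J) =>
    ((h a).2 == j.1)%:R * 'X_[(j.2 : 'X_{1..N})].@[gpt ka (h a).1]) Jm.
  case/eqP: ga; apply: hind a; apply: dense => w Ww.
  have -> : \sum_a g a * e (h a) w = \sum_(j : J) kk (P0 w j.1)@_j.2 *
     (\sum_a g a * (((h a).2 == j.1)%:R * 'X_[(j.2 : 'X_{1..N})].@[gpt ka (h a).1])).
    transitivity (\sum_a g a * \sum_(j : J) kk (P0 w j.1)@_j.2 *
        (((h a).2 == j.1)%:R * 'X_[(j.2 : 'X_{1..N})].@[gpt ka (h a).1])).
      apply: eq_bigr => a _; congr (_ * _); rewrite -[w]mulg1 eP // mulg1.
      have [Pd _] := P0E w Ww.
      rewrite (map_mpolyE _ (Pd _)) raddf_sum /=.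
      rewrite -(pair_bigA _ (fun i (m : 'X_{1..N < d.+1}) => kk (P0 w i)@_m *
        (((h a).2 == i)%:R * 'X_[(m : 'X_{1..N})].@[gpt ka (h a).1]))) /=.
      rewrite (bigD1 (h a).2) //= [X in _ = _ + X]big1 ?addr0; last first.
        move=> i; rewrite eq_sym => /negbTE ai; apply: big1 => m' _.
        by rewrite ai mul0r mulr0.
      by apply: eq_bigr => m' _; rewrite eqxx mul1r mevalZ.
    under eq_bigr => a _ do rewrite mulr_sumr.
    rewrite exchange_big; apply: eq_bigr => j _; rewrite mulr_sumr.
    by apply: eq_bigr => a _; rewrite mulrCA.
  by rewrite big1 // => j _; rewrite gJ mulr0.
pose Q m := `[< exists h : 'I_m -> G * 'I_N, Smap m h /\ indep m h >].
have exQ : exists m, Q m.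
  exists 0%N; apply/asboolP.
  have /choice[h0 _] : forall i : 'I_0, exists x : G * 'I_N, True by case.
  by exists h0; split=> [[]|g _ []].
have ubQ m : Q m -> (m <= #|{: J}|)%N by move=> /asboolP[h [Sh hind]]; apply: bounded hind.
case: (ex_maxnP exQ ubQ) => m /asboolP[h [Sh hind]] mmax.
have span (h' : G * 'I_N) : S h'.1 -> exists c : 'I_m -> K,
    forall s, S s -> e h' s = \sum_a c a * e (h a) s.
  move=> Sh'; apply: contrapT => nspan; suff : Q m.+1 by move=> /mmax; rewrite ltnn.
  apply/asboolP; exists (fun j => if unlift ord_max j is Some i then h i else h').
  split=> [j|c cS]; first by case: unliftP.
  have {}cS s : S s -> c ord_max * e h' s + \sum_i c (lift ord_max i) * e (h i) s = 0.
    move=> Ss; rewrite -[RHS](cS s Ss) (bigD1_ord ord_max) //= unlift_none.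
    by congr (_ + _); apply: eq_bigr => i _; rewrite liftK.
  have c0 : c ord_max = 0.
    apply: contrapT => /eqP c0; apply: nspan.
    exists (fun i => - (c ord_max)^-1 * c (lift ord_max i)) => s Ss.
    apply: (mulfI c0); apply/eqP; rewrite -subr_eq0 -[X in _ == X](cS s Ss); apply/eqP.
    congr (_ + _); rewrite mulr_sumr -sumrN; apply: eq_bigr => i _.
    by rewrite !mulrA mulrN mulfV // mulN1r mulNr opprK.
  have ci : forall i, c (lift ord_max i) = 0.
    by apply: hind => s Ss; rewrite -[RHS](cS s Ss) c0 mul0r add0r.
  by move=> j; case: (unliftP ord_max j) => [i ->|->].
have /choice[A0 A0E] : forall t, exists M : 'M[K]_m, S t -> forall b s, S s ->
    e (h b) (t * s)%g = \sum_a M b a * e (h a) s.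
  move=> t; have [St|] := pselect (S t); last by exists 0.
  have /choice[c cE] : forall b, exists c : 'I_m -> K, forall s, S s ->
      e (h b) (t * s)%g = \sum_a c a * e (h a) s.
    move=> b; have [c cE] := span ((h b).1 * t, (h b).2)%g (SM _ _ (Sh b) St).
    by exists c => s /cE <-; rewrite eE.
  by exists (\matrix_(b, a) c b a) => _ b s /(cE b) ->; apply: eq_bigr => a _; rewrite mxE.
have Auniq (M M' : 'M[K]_m) : (forall b s, S s ->
    \sum_a M b a * e (h a) s = \sum_a M' b a * e (h a) s) -> M = M'.
  move=> MM; apply/matrixP => b a; apply/eqP; rewrite -subr_eq0; apply/eqP.
  move: a; apply: hind => s Ss; under eq_bigr do rewrite mulrBl.
  by rewrite sumrB MM // subrr.
have AM s t : S s -> S t -> A0 (s * t)%g = A0 s *m A0 t.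
  move=> Ss St; apply: Auniq => b u Su.
  rewrite -(A0E _ (SM _ _ Ss St) b u Su).
  rewrite -(mulgA s t u).
  rewrite (A0E s Ss b); last exact: SM.
  transitivity (\sum_a A0 s b a * \sum_c A0 t a c * e (h c) u).
    by apply: eq_bigr => a _; rewrite -A0E.
  under eq_bigr do rewrite mulr_sumr; rewrite exchange_big; apply: eq_bigr => c _.
  by rewrite mxE mulr_suml; apply: eq_bigr => a _; rewrite mulrA.
have A1 : A0 1%g = 1%:M.
  apply: Auniq => b s Ss; rewrite -A0E // mul1g (bigD1 b) //= mxE eqxx mul1r.
  rewrite big1 ?addr0 // => a ab; rewrite mxE eq_sym (negbTE ab) mul0r //.
have WV w : W w -> W (w^-1)%g by move=> [Sw wd]; split; [exact: SV|exact: bidegree_leV].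
have [||||W1 [W1W W1unc W1P]] := @uncountable_killed k K kk m k_unc G A0 W
    #|{: J}|.+1 _ _ _ 1%:M W _ (@subset_refl _ W) Wunc.
- by move=> w v /WS Sw /WS Sv; rewrite -!AM // Scomm.
- move=> w Ww; exists (w^-1)%g; first exact: WV.
  by rewrite -AM ?mulgV //; apply: WS => //; apply: WV.
- move=> s Ws.
  have [c [c0 cJ]] := linear_dependence_fin (fun l (j : J) => (P0 (s l) j.1)@_j.2)
    (ltnSn _).
  exists c; split=> //; apply: Auniq => b u Su.
  have cP i : \sum_l c l *: P0 (s l) i = 0.
    apply/mpolyP => mu; rewrite mcoeff0 raddf_sum /=.
    have [ud|du] := ltnP (mdeg mu) d.+1.
      by rewrite -[RHS](cJ (i, BMultinom ud)); apply: eq_bigr => l _; rewrite mcoeffZ.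
    rewrite big1 // => l _; rewrite mcoeffZ [_@_mu]memN_msupp_eq0 ?mulr0 //.
    by apply: msize_mdeg_ge; apply: leq_trans du; have [] := P0E _ (Ws l).
  transitivity (\sum_l kk (c l) * e (h b) (s l * u)%g).
    transitivity (\sum_l kk (c l) * \sum_a A0 (s l) b a * e (h a) u); last first.
      by apply: eq_bigr => l _; rewrite -A0E //; apply: WS.
    under [RHS]eq_bigr do rewrite mulr_sumr; rewrite [RHS]exchange_big.
    apply: eq_bigr => a _; rewrite summxE mulr_suml; apply: eq_bigr => l _.
    by rewrite mxE mulrA.
  under [RHS]eq_bigr do rewrite mxE mul0r; rewrite [RHS]big1 //.
  have := congr1 (fun p => (map_mpoly kk p).@[gpt ka ((h b).1 * u)%g]) (cP (h b).2).
  rewrite rmorph0 meval0 (rmorph_sum (map_mpoly kk)) (rmorph_sum (meval _)) => E.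
  rewrite -[RHS]E.
  by apply: eq_bigr => l _; rewrite (eP _ _ _ (Sh b) (Ws l)) -mevalZ -map_mpolyZ.
- by move=> w _; apply: submx1.
exists W1; split=> //; first by move=> w /W1W/WS/ST.
move=> w v W1w W1v; have Ww := W1W _ W1w; have Wv := W1W _ W1v.
have [|cs cs0 csP] := W1P w v (v^-1)%g W1w W1v (WV _ Wv).
  by rewrite -AM ?mulgV //; apply: WS => //; apply: WV.
exists cs => // i.
set t := (w * v^-1)%g; have St : S t by apply: SM; apply: WS => //; apply: WV.
have At : A0 w *m A0 (v^-1)%g = A0 t by rewrite -AM //; apply: WS => //; apply: WV.
rewrite At in csP.
(* The row [x] describes [f] along the orbit in the finite dimensional space. Pullback by [t]
   multiplies rows by [A0 t], so [kill] turns into iterated [shift]. *)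
pose rep (f : Y -> k) (x : 'rV[K]_m) := regular f /\ forall s, S s ->
  emb ka (fun y => f (s y)) = \sum_a x 0 a * e (h a) s.
have step f x c : rep f x -> rep (shift t c f) (x *m (A0 t - (kk c)%:M)).
  move=> [rf fx]; split.
    by apply: regularB; [apply: regular_aut|apply: regularZ].
  move=> s Ss; rewrite (embBZ kaP);
    [|exact: (regular_aut s (regular_aut t rf))|exact: regular_aut].
  rewrite (fx s Ss) -[X in X - _]/(emb ka (fun y => f ((t * s)%g y))).
  rewrite (fx _ (SM _ _ St Ss)).
  rewrite mulmxBr mul_mx_scalar.
  under [RHS]eq_bigr do rewrite !mxE mulrBl; rewrite sumrB; congr (_ - _); last first.
    by rewrite mulr_sumr; apply: eq_bigr => a _; rewrite mulrA.
  under eq_bigr do rewrite A0E // mulr_sumr; rewrite exchange_big.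
  by apply: eq_bigr => a _; rewrite mulr_suml; apply: eq_bigr => b _; rewrite mulrA.
have rep_foldl : forall cs' u (x : 'rV[K]_m) Z, rep u (x *m Z) ->
    rep (foldl (fun f c => shift t c f) u cs') (x *m kill kk cs' (A0 t) Z).
  by elim=> [//|c0 cs1 IH] u x0 Z0 hu; apply: IH; rewrite mulmxA; apply: step.
have [c cE] := span (1%g, i) S1.
have : rep (crd i) ((\row_a c a) *m 1%:M).
  split; first exact: regular_crd.
  move=> s Ss; rewrite mulmx1; transitivity (e (1%g, i) s); first by rewrite /e mul1g.
  by rewrite cE //; apply: eq_bigr => a _; rewrite mxE.
move=> /(rep_foldl cs)[rf]; rewrite csP mulmx0 => /(_ 1%g S1) E.
apply: (emb_eq0 kaP rf).
by rewrite -[RHS](_ : \sum_a (0 : 'rV[K]_m) 0 a * e (h a) 1%g = 0) ?E // big1 // => a _;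
  rewrite mxE mul0r.
Qed.

End LocallyFinite.

(** * Unipotent automorphisms *)

Section PolynomialFunctions.
Variable k : fieldType.
Hypothesis char0 : [pchar k] =i pred0.

Lemma natr_eq0_char0 (m : nat) : (m%:R == 0 :> k) = (m == 0%N).
Proof. by have /pcharf0P -> := char0. Qed.

Definition polyfun (phi : k -> k) := exists P : {poly k}, forall c, phi c = P.[c].

Lemma polyfun_cst a : polyfun (fun=> a).
Proof. by exists a%:P => c; rewrite hornerC. Qed.

Lemma polyfun_horner (P : {poly k}) a b : polyfun (fun c => P.[a * c + b]).
Proof. by exists (P \Po (a *: 'X + b%:P)) => c; rewrite horner_comp !hornerE. Qed.

Lemma polyfunD phi psi : polyfun phi -> polyfun psi -> polyfun (fun c => phi c + psi c).
Proof. by move=> [P PE] [Q QE]; exists (P + Q) => c; rewrite hornerD PE QE. Qed.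

Lemma polyfunM phi psi : polyfun phi -> polyfun psi -> polyfun (fun c => phi c * psi c).
Proof. by move=> [P PE] [Q QE]; exists (P * Q) => c; rewrite hornerM PE QE. Qed.

Lemma polyfun_meval n (p : {mpoly k[n]}) (F : 'I_n -> k -> k) :
  (forall i, polyfun (F i)) -> polyfun (fun c => p.@[fun i => F i c]).
Proof.
move=> h; elim/mpoly_ring_ind: p => [a|i|p q hp hq|p q hp hq].
- by under eq_fun do rewrite mevalC; apply: polyfun_cst.
- by under eq_fun do rewrite mevalXU.
- by under eq_fun do rewrite mevalD; apply: polyfunD.
- by under eq_fun do rewrite mevalM; apply: polyfunM.
Qed.

(** In characteristic 0 the natural numbers are infinitely many points. Identities between iterates
    of [u] thus extend to all parameters of the flow. *)
Lemma polyfun_eq phi psi : polyfun phi -> polyfun psi ->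
  (forall m : nat, phi m%:R = psi m%:R) -> forall c, phi c = psi c.
Proof.
move=> [P PE] [Q QE] h c; apply/eqP; rewrite -subr_eq0 PE QE -hornerN -hornerD.
suff -> : P - Q = 0 by rewrite horner0.
apply/eqP; apply: contrapT => /negP nz.
pose s := [seq m%:R : k | m <- iota 0 (size (P - Q))].
suff : (size s < size (P - Q)%R)%N by rewrite size_map size_iota ltnn.
apply: max_poly_roots => //.
  by apply/allP => _ /mapP[m _ ->]; rewrite /root !hornerE -PE -QE h subrr.
rewrite map_inj_uniq ?iota_uniq // => m m' /eqP.
wlog le : m m' / (m <= m')%N.
  by move=> W e; have [/W|/ltnW/W] := leqP m m'; [apply|rewrite eq_sym => ->].
rewrite eq_sym -subr_eq0 -natrB // natr_eq0_char0 subn_eq0 => le'.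
by apply/eqP; rewrite eqn_leq le.
Qed.

Definition binpoly (j : nat) : {poly k} :=
  (j`!%:R)^-1 *: \prod_(l < j) ('X - l%:R%:P).

Lemma binpolyE j (m : nat) : (binpoly j).[m%:R] = 'C(m, j)%:R.
Proof.
have ffE : (\prod_(l < j) ('X - (l%:R : k)%:P)).[m%:R] = (m ^_ j)%:R.
  elim: j => [|j IH]; first by rewrite big_ord0 hornerC.
  rewrite big_ord_recr hornerM IH !hornerE ffactnSr natrM.
  have [jm|mj] := leqP j m; first by rewrite natrB.
  by rewrite ffact_small // !mul0r.
rewrite hornerZ ffE -bin_ffact natrM mulrC mulfK //.
by rewrite natr_eq0_char0 -lt0n fact_gt0.
Qed.

End PolynomialFunctions.

Section Differences.
Variables (k : fieldType) (X : Type) (u : X -> X).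

Definition diff (j : nat) (f : X -> k) := iter j (shift u 1) f.

Arguments diff : simpl never.

Lemma diffS j f x : diff j.+1 f x = diff j f (u x) - diff j f x.
Proof. by rewrite /diff iterS /shift mul1r. Qed.

(** Newton's forward difference formula: pullback by [u] is 1 plus a difference operator that is
    nilpotent on [f]. *)
Lemma newton M (f : X -> k) m x : (forall x, diff M f x = 0) ->
  f (iter m u x) = \sum_(j < M) 'C(m, j)%:R * diff j f x.
Proof.
move=> fM; elim: m x => [|m IH] x.
  case: M fM => [|M] fM; first by rewrite big_ord0; apply: fM.
  rewrite big_ord_recl bin0 mul1r big1 ?addr0 // => j _.
  by rewrite bin0n mul0r.
rewrite iterSr IH.
case: M fM {IH} => [|M] fM; first by rewrite !big_ord0.
transitivity (\sum_(j < M.+1) 'C(m, j)%:R * (diff j.+1 f x + diff j f x)).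
  by apply: eq_bigr => j _; rewrite diffS subrK.
under eq_bigr do rewrite mulrDr; rewrite big_split /=.
rewrite big_ord_recr /= fM mulr0 addr0 [in RHS]big_ord_recl bin0 mul1r.
rewrite [X in _ + X]big_ord_recl bin0 mul1r addrCA; congr (_ + _).
rewrite -big_split; apply: eq_bigr => j _ /=.
by rewrite binS natrD mulrDl addrC.
Qed.

End Differences.

Section NoUnipotent.
Variables (k : fieldType) (Y : irr_affine_variety k).
Hypothesis char0 : [pchar k] =i pred0.
Local Notation G := (Aut Y).
Variable T : set G.
Hypothesis Tcomm : forall s t, T s -> T t -> (s * t)%g = (t * s)%g.
Hypothesis Tindex : forall F : k -> G, exists c c', c != c' /\ T ((F c)^-1 * F c')%g.

(* A unipotent u in T would belong to a flow u^c, and replacing c by c f, f a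
   u-invariant function, gives as many automorphisms as there are multiples of
   f. As T has countable index, f is T-invariant, so T acts by translations
   along the orbits of the flow and has no element of order two. *)
Lemma unipotent_trivial (u tau : G) (M : nat) :
  T u -> T tau -> (tau * tau)%g = 1%g -> tau <> 1%g ->
  (forall i y, diff u M (@crd k Y i) y = 0) -> u = 1%g.
Proof.
move=> Tu Ttau tau2 tau1 uM; apply: contrapT => u1.
(* By Newton's formula the coordinates of [iter m u y] are polynomial in [m]; their values at
   arbitrary elements of [k] define the flow [fl]. *)
pose P i y : {poly k} := \sum_(j < M) diff u j (@crd k Y i) y *: binpoly k j.
have PE i y (m : nat) : (P i y).[m%:R] = crd i (iter m u y).
  rewrite (newton m _ (uM i)) horner_sum; apply: eq_bigr => j _.
  by rewrite hornerZ binpolyE // mulrC.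
have /choice[fl0 flE0] : forall cy : k * Y, exists z : Y, forall i,
    crd i z = (P i cy.2).[cy.1].
  move=> [c y] /=; have [|z zE] := @exists_point k Y (fun i => (P i y).[c]).
    move=> p pY; apply: (@polyfun_eq _ char0 (fun c => p.@[fun i => (P i y).[c]]) (fun=> 0)).
    - by apply: polyfun_meval => i; exists (P i y).
    - exact: polyfun_cst.
    - by move=> m; rewrite -[RHS](pY (iter m u y)); apply: meval_eq => i; rewrite PE.
  by exists z => i; rewrite /crd zE.
pose fl c y := fl0 (c, y).
have flE c y i : crd i (fl c y) = (P i y).[c] := flE0 (c, y) i.
have fl_nat m y : fl m%:R y = iter m u y.
  by apply: points_inj => i; rewrite -[LHS]/(crd i _) flE PE.
have diff_reg j f : regular f -> regular (diff u j f).
  move=> rf; elim: j => // j IH; rewrite /diff iterS.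
  apply: regularB; first exact: regular_aut.
  exact: regularZ.
have fl_reg (phi : Y -> k) i : regular phi -> regular (fun y => crd i (fl (phi y) y)).
  move=> rphi; under eq_fun do rewrite flE /P horner_sum.
  apply: regular_sum => j _; under eq_fun do rewrite hornerZ.
  apply: regularM; first exact/diff_reg/regular_crd.
  under eq_fun do rewrite horner_coef.
  by apply: regular_sum => l _; apply: regularZ; apply: regularX.
have fl_poly h a b y : regular h -> polyfun (fun c => h (fl (a * c + b) y)).
  move=> [p ->].
  rewrite (_ : (fun c => _) = fun c => p.@[fun i => (P i y).[a * c + b]]).
    by apply: polyfun_meval => i; apply: polyfun_horner.
  by apply/funext => c; apply: meval_eq => i; rewrite -flE.
have fl_poly1 h y : regular h -> polyfun (fun c => h (fl c y)).
  by move=> /(fl_poly h 1 0 y); under eq_fun do rewrite mul1r addr0.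
have flD c c' y : fl (c + c') y = fl c (fl c' y).
  apply: points_inj => i; rewrite -![LHS]/(crd i _) -![RHS]/(crd i _).
  have nat1 (m : nat) d : crd i (fl (d + m%:R) y) = crd i (fl d (fl m%:R y)).
    apply: (@polyfun_eq _ char0 (fun d => crd i (fl (d + m%:R) y))
      (fun d => crd i (fl d (fl m%:R y)))).
    - have := fl_poly (crd i) 1 m%:R y (regular_crd i).
      by under eq_fun do rewrite mul1r.
    - exact/fl_poly1/regular_crd.
    - by move=> m'; rewrite -natrD !fl_nat iterD.
  apply: (@polyfun_eq _ char0 (fun c' => crd i (fl (c + c') y))
      (fun c' => crd i (fl c (fl c' y)))) => //.
  - have := fl_poly (crd i) 1 c y (regular_crd i).
    by under eq_fun do rewrite mul1r addrC.
  - apply: (fl_poly1 (fun z => crd i (fl c z))).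
    exact: (fl_reg (fun=> c) i (regular_cst Y c)).
have fl0y y : fl 0 y = y by rewrite -[0]/(0%:R) fl_nat.
have fl_inv f c y : regular f -> (forall y, f (u y) = f y) -> f (fl c y) = f y.
  move=> rf fu; apply: (@polyfun_eq _ char0 (fun c => f (fl c y)) (fun=> f y)).
  - exact: fl_poly1.
  - exact: polyfun_cst.
  - by move=> m; rewrite fl_nat; elim: m => // m IH; rewrite iterS fu.
have fl_comm t c y : T t -> t (fl c y) = fl c (t y).
  move=> Tt; apply: points_inj => i; rewrite -![LHS]/(crd i _) -![RHS]/(crd i _).
  apply: (@polyfun_eq _ char0 (fun c => crd i (t (fl c y))) (fun c => crd i (fl c (t y)))).
  - exact: (fl_poly1 (fun z => crd i (t z)) y (regular_aut t (regular_crd i))).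
  - exact/fl_poly1/regular_crd.
  - move=> m; rewrite !fl_nat; congr crd; elim: m => // m IH; rewrite !iterS -IH.
    by have := congr1 (fun g : G => g (iter m u y)) (Tcomm Tt Tu).
have fl_fix d y : d != 0 -> fl d y = y -> u y = y.
  move=> d0 dy; apply: points_inj => i; rewrite -[LHS]/(crd i _) -[RHS]/(crd i _).
  rewrite -[u y]/(iter 1 u y) -fl_nat -(mulfV d0).
  apply: (@polyfun_eq _ char0 (fun c => crd i (fl (d * c) y)) (fun=> crd i y)).
  - have := fl_poly (crd i) d 0 y (regular_crd i).
    by under eq_fun do rewrite addr0.
  - exact: polyfun_cst.
  - move=> m; congr crd; elim: m => [|m IH]; first by rewrite mulr0.
    by rewrite -addn1 natrD mulrDr mulr1 flD dy.
(* The automorphisms [y |-> fl (c * f y) y] are indexed by [k], so two of them differ by some [t] in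
   [T], which has the same form with parameter [e]. As [t] commutes with [tau], it compares [f] at
   [y] and at [tau y]. *)
have inv f : regular f -> (forall y, f (u y) = f y) -> forall y, f (tau y) = f y.
  move=> rf fu.
  have /choice[F FE] : forall c, exists g : G, forall y, g y = fl (c * f y) y.
    move=> c; have [||||g gE] := @exists_aut k Y (fun y => fl (c * f y) y)
      (fun y => fl (- c * f y) y).
    - by move=> i; apply: fl_reg; apply: regularZ.
    - by move=> i; apply: fl_reg; apply: regularZ.
    - by move=> y; rewrite fl_inv // -flD mulNr addNr fl0y.
    - by move=> y; rewrite fl_inv // -flD mulNr addrN fl0y.
    by exists g.
  have [c [c' [cc' Tt]]] := Tindex F.
  set t := ((F c)^-1 * F c')%g in Tt; pose e := c' - c.
  have e0 : e != 0 by rewrite subr_eq0 eq_sym.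
  have tE y : t y = fl (e * f y) y.
    rewrite -[LHS]/(((F c)^-1)%g (F c' y)).
    have -> : F c' y = F c (fl (e * f y) y); last by rewrite autV.
    by rewrite !FE fl_inv // -flD -mulrDl addrC subrK.
  (* Where [f] differs, the flow has a nonzero period at [tau y], which is then fixed by [u], and so
     is [y]. Irreducibility makes one alternative hold on all of [Y]. *)
  have key y : (f (tau y) - f y) = 0 \/ u y = y.
    have [->|d0] := eqVneq (f (tau y)) (f y); first by left; rewrite subrr.
    right; apply: (can_inj (autV tau)).
    have <- : u (tau y) = tau (u y).
      by have := congr1 (fun g : G => g y) (Tcomm Tu Ttau).
    apply: (@fl_fix (e * (f (tau y) - f y))).
      by rewrite mulf_neq0 // subr_eq0.
    have E : fl (e * f (tau y)) (tau y) = fl (e * f y) (tau y).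
      rewrite -tE -(fl_comm tau (e * f y) y Ttau) -tE.
      by have := congr1 (fun g : G => g y) (Tcomm Tt Ttau).
    by rewrite mulrBr addrC flD E -flD addNr fl0y.
  have [y0 [i yi]] : exists y i, crd i (u y) != crd i y.
    apply: contrapT => h; apply: u1; apply: aut_eq => y; apply: points_inj => i.
    by apply: contrapT => /eqP ne; apply: h; exists y, i.
  have [|||h|h] := @regular_domain k Y (fun y => f (tau y) - f y)
    (fun y => crd i (u y) - crd i y).
  - by apply: regularB => //; apply: regular_aut.
  - by apply: regularB; [apply: regular_aut|]; apply: regular_crd.
  - by move=> y; case: (key y) => ->; rewrite ?mul0r // subrr mulr0.
  - by move=> y; apply/eqP; rewrite -subr_eq0 h.
  - by case/eqP: yi; apply/eqP; rewrite -subr_eq0 h.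
(* The difference [g] of [f o tau] and [f] is invariant under [u], hence under [tau]; but [tau]
   having order two changes the sign of [g], so [2 g = 0]. *)
have tau_fix m f : regular f -> (forall y, diff u m f y = 0) -> forall y, f (tau y) = f y.
  elim: m f => [|m IH] f rf fm y; first by rewrite !(fm : forall y, f y = 0).
  pose g y := f (tau y) - f y.
  have rg : regular g by apply: regularB => //; apply: regular_aut.
  have gu z : g (u z) = g z.
    have ru : regular (shift u 1 f) by apply: (diff_reg 1%N).
    have := IH _ ru _ z; rewrite /shift !mul1r => E.
    have e : u (tau z) = tau (u z).
      by have := congr1 (fun g : G => g z) (Tcomm Tu Ttau).
    have {}E : f (tau (u z)) - f (tau z) = f (u z) - f z.
      by rewrite -e; apply: E => y'; rewrite -[RHS](fm y') /diff iterSr.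
    apply/eqP; rewrite /g -subr_eq0; apply/eqP.
    transitivity ((f (tau (u z)) - f (tau z)) - (f (u z) - f z)); first by ring.
    by rewrite E subrr.
  have := inv g rg gu y; rewrite /g.
  have -> : tau (tau y) = y by have := congr1 (fun g : G => g y) tau2.
  move=> E; apply/eqP; rewrite -subr_eq0.
  have : (f (tau y) - f y) * 2%:R == 0.
    apply/eqP; transitivity ((f (tau y) - f y) - (f y - f (tau y))); first by ring.
    by rewrite E subrr.
  by rewrite mulf_eq0 natr_eq0_char0 // orbF.
apply: tau1; apply: aut_eq => y; apply: points_inj => i.
exact: (tau_fix M (crd i) (regular_crd i) (uM i) y).
Qed.

End NoUnipotent.

(** * Gradings from locally finite automorphisms *)

Section GeneralizedEigenfunctions.
Variables (k : fieldType) (X : Type) (s : X -> X).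
Implicit Types (f g : X -> k) (c d : k).

Local Notation S := (shift s).

Definition kills M c f := forall x, iter M (S c) f x = 0.

Definition gen_eigen c f := exists M, kills M c f.

Lemma iter_shiftD M c f g x :
  iter M (S c) (fun y => f y + g y) x = iter M (S c) f x + iter M (S c) g x.
Proof. by elim: M x => // M IH x; rewrite !iterS /shift !IH; ring. Qed.

Lemma iter_shiftZ M c a f x :
  iter M (S c) (fun y => a * f y) x = a * iter M (S c) f x.
Proof. by elim: M x => // M IH x; rewrite !iterS /shift !IH; ring. Qed.

Lemma iter_shift0 M c x : iter M (S c) (fun=> 0) x = 0.
Proof. by elim: M x => // M IH x; rewrite iterS /shift !IH; ring. Qed.

Lemma iter_shift_comp M c (t : X -> X) f x : (forall x, s (t x) = t (s x)) ->
  iter M (S c) (fun y => f (t y)) x = iter M (S c) f (t x).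
Proof. by move=> st; elim: M x => // M IH x; rewrite !iterS /shift !IH st. Qed.

Lemma kills_le M M' c f : (M <= M')%N -> kills M c f -> kills M' c f.
Proof.
move=> MM h x; rewrite -(subnK MM) iterD.
by rewrite (_ : iter M _ f = fun=> 0) ?iter_shift0 //; apply/funext.
Qed.

Lemma kills0 c f : kills 0 c f -> forall x, f x = 0.
Proof. by []. Qed.

Lemma gen_eigen0 c : gen_eigen c (fun=> 0).
Proof. by exists 0%N. Qed.

Lemma gen_eigenD c f g : gen_eigen c f -> gen_eigen c g ->
  gen_eigen c (fun x => f x + g x).
Proof.
move=> [M hf] [M' hg]; exists (maxn M M') => x.
by rewrite iter_shiftD (kills_le (leq_maxl _ _) hf) (kills_le (leq_maxr _ _) hg) addr0.
Qed.

Lemma gen_eigenZ c a f : gen_eigen c f -> gen_eigen c (fun x => a * f x).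
Proof. by move=> [M hf]; exists M => x; rewrite iter_shiftZ hf mulr0. Qed.

Lemma gen_eigen_sum (I : Type) (r : seq I) (P : pred I) c (F : I -> X -> k) :
  (forall i, P i -> gen_eigen c (F i)) ->
  gen_eigen c (fun x => \sum_(i <- r | P i) F i x).
Proof.
move=> h; elim: r => [|i r IH].
  by under eq_fun do rewrite big_nil; apply: gen_eigen0.
under eq_fun do rewrite big_cons.
by have [Pi|_] := boolP (P i); [apply: gen_eigenD => //; apply: h|].
Qed.

Lemma gen_eigen_shift c d f : gen_eigen c f -> gen_eigen c (S d f).
Proof.
move=> [M hM]; exists M => x; rewrite /shift.
have -> : (fun x => f (s x) - d * f x) = fun x => f (s x) + (- d) * f x.
  by apply/funext => y; rewrite mulNr.
by rewrite iter_shiftD iter_shiftZ iter_shift_comp // !hM mulr0 addr0.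
Qed.

Lemma gen_eigen_iter c d M f : gen_eigen c f -> gen_eigen c (iter M (S d) f).
Proof. by move=> h; elim: M => // M IH; rewrite iterS; apply: gen_eigen_shift. Qed.

Lemma gen_eigen1 a : gen_eigen 1 (fun=> a).
Proof. by exists 1%N => x; rewrite /= /shift mul1r subrr. Qed.

(** A Leibniz rule: [S (c d) (f g)] is [(S c f) (g o s) + c f (S d g)]. Each term lowers one of the
    two orders of nilpotency. *)
Lemma gen_eigenM c d f g : gen_eigen c f -> gen_eigen d g ->
  gen_eigen (c * d) (fun x => f x * g x).
Proof.
suff h n : forall M M' f g, (M + M' <= n)%N -> kills M c f -> kills M' d g ->
    kills n (c * d) (fun x => f x * g x).
  by move=> [M hf] [M' hg]; exists (M + M')%N; apply: (h _ M M').
elim: n => [|n IH] M M' {}f {}g.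
  by rewrite leqn0 addn_eq0 => /andP[/eqP-> /eqP->] hf _ x; rewrite /= (kills0 hf) mul0r.
case: M => [_ hf _ x|M].
  have -> : (fun x => f x * g x) = fun=> 0 by apply/funext => y; rewrite (kills0 hf) mul0r.
  exact: iter_shift0.
case: M' => [_ _ hg x|M'].
  have -> : (fun x => f x * g x) = fun=> 0 by apply/funext => y; rewrite (kills0 hg) mulr0.
  exact: iter_shift0.
move=> MM hf hg x; rewrite iterSr.
have -> : S (c * d) (fun x => f x * g x) =
    fun x => (S c f x * g (s x)) + c * (f x * S d g x).
  by apply/funext => y; rewrite /shift; ring.
rewrite iter_shiftD iter_shiftZ.
rewrite (IH M M'.+1 (S c f) (fun x => g (s x))); first last.
- by move=> y; rewrite iter_shift_comp.
- by move=> y; rewrite -iterSr.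
- by rewrite -ltnS.
rewrite (IH M.+1 M' f (S d g)) ?mulr0 ?addr0 // => [|y]; last by rewrite -iterSr.
by move: MM; rewrite addnS ltnS.
Qed.

(** Where pullback by [s] is multiplication by [d], the operator [S c] is multiplication by the
    nonzero [d - c]. *)
Lemma gen_eigen_inj c d f : c != d -> gen_eigen c f ->
  (forall x, S d f x = 0) -> forall x, f x = 0.
Proof.
move=> cd [M hM] df x; have : (d - c) ^+ M * f x = 0; last first.
  move/eqP; rewrite mulf_eq0 expf_eq0 subr_eq0 eq_sym (negbTE cd) andbF /=.
  by move/eqP.
rewrite -(hM x) /kills; elim: M x {hM} => [|M IH] x; first by rewrite mul1r.
rewrite iterSr.
have -> : S c f = fun x => (d - c) * f x.
  apply/funext => y; have := df y; rewrite /shift => /eqP; rewrite subr_eq0 => /eqP->.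
  by ring.
by rewrite iter_shiftZ -IH exprS mulrA.
Qed.

Section StableSpace.
Variable R : (X -> k) -> Prop.
Hypothesis R0 : R (fun=> 0).
Hypothesis RD : forall f g, R f -> R g -> R (fun x => f x + g x).
Hypothesis RZ : forall a f, R f -> R (fun x => a * f x).
Hypothesis Rs : forall f, R f -> R (fun x => f (s x)).

Lemma stable_shift c f : R f -> R (S c f).
Proof.
move=> Rf; have := RD (Rs Rf) (RZ (- c) Rf).
by congr R; apply/funext => x; rewrite /shift mulNr.
Qed.

Lemma stable_sum (I : Type) (r : seq I) (P : pred I) (F : I -> X -> k) :
  (forall i, P i -> R (F i)) -> R (fun x => \sum_(i <- r | P i) F i x).
Proof.
move=> h; elim: r => [|i r IH]; first by under eq_fun do rewrite big_nil.
under eq_fun do rewrite big_cons.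
by have [Pi|_] := boolP (P i); [apply: RD => //; apply: h|].
Qed.

(** [S d] is [S c] plus the nonzero scalar [c - d], and [S c] is nilpotent on [g]: the inverse is a
    finite geometric series, summed by induction inside [R]. *)
Lemma gen_eigen_surj c d g : c != d -> gen_eigen c g -> R g ->
  exists h, [/\ gen_eigen c h, R h & forall x, S d h x = g x].
Proof.
move=> cd [M]; elim: M g => [|M IH] g hM Rg.
  by exists (fun=> 0); split; [exact: gen_eigen0| |move=> x; rewrite /shift (kills0 hM); ring].
have [||h [hc Rh hE]] := IH (S c g); [by move=> x; rewrite -iterSr|exact: stable_shift|].
have cd0 : c - d != 0 by rewrite subr_eq0.
exists (fun x => (c - d)^-1 * (g x + (-1) * h x)); split.
- by apply/gen_eigenZ/gen_eigenD; [exists M.+1|apply: gen_eigenZ].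
- by apply/RZ/RD => //; apply: RZ.
move=> x; apply: (mulfI cd0); rewrite /shift.
have := hE x; rewrite /shift => E.
transitivity ((c - d) * (c - d)^-1 * (g (s x) - h (s x) - d * (g x - h x))); first by ring.
rewrite mulfV // mul1r.
transitivity (g (s x) - (h (s x) - d * h x) - d * g x); first by ring.
by rewrite E; ring.
Qed.

(** Remove the factors one by one. The components of [S c f] for eigenvalues other than [c] are
    lifted by surjectivity of [S c]; after subtracting the lifts, [f] is a generalized eigenfunction
    for [c]. *)
Lemma gen_eigen_decomposition (cs : seq k) f :
  R f -> (forall x, foldl (fun f c => S c f) f cs x = 0) ->
  exists z : 'I_(size cs) -> X -> k,
    (forall l : 'I_(size cs), gen_eigen cs`_l (z l) /\ R (z l)) /\ forall x, f x = \sum_l z l x.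
Proof.
suff h cs' : {subset cs' <= cs} -> forall f, R f ->
    (forall x, foldl (fun f c => S c f) f cs' x = 0) ->
    exists z : 'I_(size cs) -> X -> k,
      (forall l : 'I_(size cs), gen_eigen cs`_l (z l) /\ R (z l)) /\ forall x, f x = \sum_l z l x.
  exact: h.
elim: cs' => [|c cs' IH] sub {}f /= Rf f0.
  exists (fun=> fun=> 0); split=> [l|x]; first by split=> //; exact: gen_eigen0.
  by rewrite f0 big1.
have ccs : c \in cs by apply: sub; rewrite mem_head.
have [|z [zg zE]] := IH _ (S c f) (stable_shift c Rf) f0.
  by move=> d dcs; apply: sub; rewrite inE dcs orbT.
have /choice[h hP] : forall l : 'I_(size cs), exists h, cs`_l != c ->
    [/\ gen_eigen cs`_l h, R h & forall x, S c h x = z l x].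
  move=> l; have [e|ne] := eqVneq cs`_l c; first by exists (fun=> 0).
  by have [zl Rl] := zg l; have [h hP] := gen_eigen_surj ne zl Rl; exists h.
pose f0' x := f x - \sum_(l < size cs | cs`_l != c) h l x.
have Sf0 : S c f0' = fun x => \sum_(l < size cs | cs`_l == c) z l x.
  apply/funext => x; rewrite /f0' /shift.
  transitivity (S c f x - \sum_(l < size cs | cs`_l != c) S c (h l) x).
    rewrite /shift sumrB -mulr_sumr; ring.
  rewrite zE (bigID (fun l : 'I__ => cs`_l == c)) /= -addrA -sumrB.
  rewrite [X in _ + X]big1 ?addr0 //.
  by move=> l lc; have [_ _ ->] := hP l lc; rewrite subrr.
have f0g : gen_eigen c f0'.
  have [M hM] : gen_eigen c (S c f0').
    by rewrite Sf0; apply: gen_eigen_sum => l /eqP <-; have [] := zg l.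
  by exists M.+1 => x; rewrite iterSr.
have Rf0' : R f0'.
  have := RD Rf (RZ (-1) (stable_sum (index_enum _) (fun l lc => let: And3 _ r _ := hP l lc in r))).
  by congr R; apply/funext => x; rewrite /f0' mulN1r.
(* [cs] may have repetitions: the whole component of [c] is put at its first position. *)
pose l0 : 'I_(size cs) := Ordinal (etrans (index_mem c cs) ccs).
have l0c : cs`_l0 = c by rewrite nth_index.
exists (fun l : 'I_(size cs) => if cs`_l == c then (if l == l0 then f0' else fun=> 0) else h l).
split=> [l|x].
  case: eqP => [->|/eqP lc]; last by have [] := hP l lc.
  by case: eqP => _; split=> //; exact: gen_eigen0.
rewrite (bigID (fun l : 'I__ => cs`_l == c)) /= (bigD1 l0) ?l0c //= eqxx.
rewrite eqxx [X in _ + X + _]big1 ?addr0; last first.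
  by move=> l /andP[/eqP lc /negbTE ->]; rewrite lc eqxx.
rewrite (eq_bigr (fun l => h l x)); first by rewrite /f0' subrK.
by move=> l /negbTE ->.
Qed.

End StableSpace.

Lemma gen_eigen_direct (I : eqType) (r : seq I) (la : I -> k) (F : I -> X -> k) c f :
  gen_eigen c f -> (forall i, i \in r -> la i != c /\ gen_eigen (la i) (F i)) ->
  (forall x, f x = \sum_(i <- r) F i x) -> forall x, f x = 0.
Proof.
elim: r f F => [|i r IH] f F fc Fg fE; first by move=> x; rewrite fE big_nil.
have [ic [M hM]] := Fg i (mem_head _ _).
have : forall x, iter M (S (la i)) f x = 0.
  apply: (IH _ (fun j => iter M (S (la i)) (F j))).
  - exact: gen_eigen_iter.
  - move=> j jr; have [|jc jg] := Fg j; first by rewrite inE jr orbT.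
    by split=> //; apply: gen_eigen_iter.
  - move=> x; have -> : f = fun x => \sum_(j <- i :: r) F j x by apply/funext.
    under eq_fun do rewrite big_cons.
    rewrite iter_shiftD hM add0r; elim: r {IH Fg fE} x => [|j r IH] x.
      by under eq_fun do rewrite big_nil; rewrite iter_shift0 big_nil.
    by under eq_fun do rewrite big_cons; rewrite iter_shiftD IH big_cons.
elim: M {hM} => // M IHM h; apply: IHM.
apply: (@gen_eigen_inj c (la i)); first by rewrite eq_sym.
  exact: gen_eigen_iter.
by move=> x; rewrite -iterS.
Qed.

(** Generalized eigenspaces are independent, so the terms with a common eigenvalue already sum to 0
    and may be multiplied by any function of the eigenvalue. *)
Lemma gen_eigen_weights (I : finType) (la : I -> k) (F : I -> X -> k) (chi : k -> k) :
  (forall i, gen_eigen (la i) (F i)) -> (forall x, \sum_i F i x = 0) ->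
  forall x, \sum_i chi (la i) * F i x = 0.
Proof.
move=> Fg F0 x.
have same i : \sum_(j | la j == la i) F j x = 0.
  pose f x := \sum_(j | la j == la i) F j x.
  apply: (@gen_eigen_direct _ [seq j <- enum I | la j != la i] la
     (fun j x => (-1) * F j x) (la i) f).
  - by apply: gen_eigen_sum => j /eqP <-.
  - by move=> j; rewrite mem_filter => /andP[? _]; split=> //; apply: gen_eigenZ.
  move=> y; rewrite big_filter big_enum_cond /= -mulr_sumr mulN1r.
  have := F0 y; rewrite (bigID (fun j => la j == la i)) /= => /eqP.
  by rewrite addr_eq0 => /eqP.
pose rho i := odflt i [pick j | la j == la i].
have rhoE i : la (rho i) = la i by rewrite /rho; case: pickP => [j /eqP|].
have rho_eq i j : la i = la j -> rho i = rho j.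
  move=> ij; rewrite /rho ij; case: pickP => [//|/(_ j)].
  by rewrite eqxx.
rewrite (partition_big rho xpredT) //= big1 // => j _.
have [[i0 ij]|h] := pselect (exists i, rho i = j); last first.
  by rewrite big1 // => i /eqP ij; case: h; exists i.
transitivity (chi (la j) * \sum_(i | la i == la j) F i x); last by rewrite same mulr0.
rewrite mulr_sumr; apply: eq_big => [i|i /eqP <-]; last by rewrite rhoE.
by apply/eqP/eqP => [<-|e]; [rewrite rhoE|rewrite -ij; apply: rho_eq; rewrite e -ij rhoE].
Qed.

End GeneralizedEigenfunctions.

(** * Characters of finitely generated subgroups of the multiplicative group *)

Section Exponents.
Variable k : fieldType.

Lemma prod_exprz (I : finType) (e : I -> k) (m : I -> int) a :
  (\prod_i e i ^ m i) ^ a = \prod_i e i ^ (m i * a).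
Proof.
rewrite (big_morph (fun x => x ^ a) (id1 := 1) (op1 := *%R)).
- by apply: eq_bigr => i _; rewrite exprz_exp.
- by move=> x y; rewrite expfzMl.
- exact: exp1rz.
Qed.

Lemma prod_exprzD (I : finType) (e : I -> k) (m n : I -> int) :
  (forall i, e i != 0) ->
  \prod_i e i ^ (m i + n i) = (\prod_i e i ^ m i) * (\prod_i e i ^ n i).
Proof.
by move=> e0; rewrite -big_split; apply: eq_bigr => i _; rewrite expfzDr.
Qed.

Definition root_of_unity (x : k) := exists d, (0 < d)%N /\ x ^+ d = 1.

Lemma common_order r (e : 'I_r -> k) : (forall j, root_of_unity (e j)) ->
  exists2 d, (0 < d)%N & forall j, e j ^+ d = 1.
Proof.
move=> /choice[d dP].
exists (\prod_j d j)%N; first by rewrite prodn_gt0 // => j; case: (dP j).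
by move=> j; rewrite (bigD1 j) //= exprM; case: (dP j) => _ ->; rewrite expr1n.
Qed.

(* A homomorphism from the group generated by the e_j to the integers which is
   not trivial on all of the e_j. *)
Lemma exponents r (e : 'I_r -> k) : (forall j, e j != 0) ->
  (exists j, ~ root_of_unity (e j)) ->
  exists v : 'I_r -> int, (exists j, v j != 0) /\
    forall m : 'I_r -> int, \prod_j e j ^ m j = 1 -> \sum_j v j * m j = 0.
Proof.
elim: r e => [|r IH] e e0 [j0 nj0]; first by case: j0 nj0.
pose e' i := e (lift ord_max i); pose x := e ord_max.
pose ext (a : int) (w : 'I_r -> int) (j : 'I_r.+1) :=
  if unlift ord_max j is Some i then w i else a.
have prodE (m : 'I_r.+1 -> int) : \prod_j e j ^ m j =
    x ^ m ord_max * \prod_i e' i ^ m (lift ord_max i).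
  by rewrite (bigD1_ord ord_max).
have sumE a w (m : 'I_r.+1 -> int) : \sum_j ext a w j * m j =
    a * m ord_max + \sum_i w i * m (lift ord_max i).
  rewrite (bigD1_ord ord_max) //= /ext unlift_none; congr (_ + _).
  by apply: eq_bigr => i _; rewrite liftK.
have [[i ni]|allroot] := pselect (exists i, ~ root_of_unity (e' i)); last first.
  have [|d d0 dP] := @common_order _ e'.
    by move=> i; apply: contrapT => ni; apply: allroot; exists i.
  (* All the other [e j] are roots of unity, so the exponent of [x], which has infinite order, is
     determined. *)
  exists (ext 1 (fun=> 0)); split.
    by exists ord_max; rewrite /ext unlift_none.
  move=> m; rewrite prodE sumE mul1r [X in _ + X]big1 ?addr0 => [mP|i _]; last by rewrite mul0r.
  apply: contrapT => /eqP m0; case: (nj0).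
  have -> : e j0 = x.
    case: (unliftP ord_max j0) nj0 => [i ->|->//] ni.
    by case: allroot; exists i.
  exists (absz (m ord_max) * d)%N; split; first by rewrite muln_gt0 absz_gt0 m0 d0.
  have xd : x ^ (m ord_max * d%:Z) = 1.
    have : (x ^ m ord_max * \prod_i e' i ^ m (lift ord_max i)) ^ d%:Z = 1.
      by rewrite mP exp1rz.
    rewrite expfzMl prod_exprz [X in _ * X]big1 ?mulr1 ?exprz_exp // => i _.
    by rewrite mulrC -exprz_exp -exprnP dP exp1rz.
  have := congr1 (fun z => z ^ sgz (m ord_max)) xd.
  rewrite exp1rz exprz_exp mulrAC [m _ * sgz _]mulrC -abszEsg -PoszM -exprnP.
  by [].
have [||v [[i1 vi1] vP]] := IH e'; [by move=> ?; apply: e0|by exists i|].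
have [[m [a [a0 xa]]]|norel] := pselect (exists (m : 'I_r -> int) (a : int),
    a != 0 /\ x ^ a = \prod_i e' i ^ m i); last first.
  exists (ext 0 v); split.
    by exists (lift ord_max i1); rewrite /ext liftK.
  move=> m; rewrite prodE sumE mul0r add0r => mP.
  have m0 : m ord_max = 0.
    apply: contrapT => /eqP m0; apply: norel.
    exists (fun i => m (lift ord_max i) * (-1)), (m ord_max); split=> //.
    have P0 : \prod_i e' i ^ m (lift ord_max i) != 0.
      by apply/prodf_neq0 => j _; rewrite expfz_neq0 // e0.
    by rewrite -prod_exprz exprN1; apply: (mulIf P0); rewrite mP mulVf.
  by apply: vP; move: mP; rewrite m0 expr0z mul1r.
(* As [x ^ a] is the monomial with exponents [m], the value at [x] has to be the sum of the
   [v i * m i] divided by [a]; multiplying all values by [a] keeps them integral. *)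
exists (ext (\sum_i v i * m i) (fun i => a * v i)); split.
  by exists (lift ord_max i1); rewrite /ext liftK mulf_neq0.
move=> n; rewrite prodE sumE => nP.
have := vP (fun i => m i * n ord_max + n (lift ord_max i) * a).
rewrite prod_exprzD; last by move=> ?; apply: e0.
rewrite -!prod_exprz -xa exprz_exp mulrC [a * _]mulrC -exprz_exp -expfzMl.
rewrite mulrC nP exp1rz => /(_ erefl) E.
rewrite -[RHS]E mulr_suml -big_split; apply: eq_bigr => j _ /=; ring.
Qed.

(** Halve as long as all values are even; the sum of the absolute values decreases. Oddness makes
    the resulting grading see the parameter -1. *)
Lemma exponents_odd r (e : 'I_r -> k) : (forall j, e j != 0) ->
  (exists j, ~ root_of_unity (e j)) ->
  exists v : 'I_r -> int, (exists j, odd `|v j|) /\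
    forall m : 'I_r -> int, \prod_j e j ^ m j = 1 -> \sum_j v j * m j = 0.
Proof.
move=> e0 nr; have [v [v0 vP]] := exponents e0 nr.
have [b] := ubnP (\sum_j `|v j|)%N; elim: b v v0 vP => // b IH v [j0 vj0] vP vb.
have [h|h] := pselect (exists j, odd `|v j|); first by exists v.
have /choice[w wE] : forall j, exists w, v j = 2%:Z * w.
  move=> j; have : ~~ odd `|v j| by apply/negP => o; apply: h; exists j.
  by move=> o; exists (v j %/ 2)%Z; lia.
apply: (IH w).
- by exists j0; apply: contraNneq vj0 => e1; rewrite wE e1.
- move=> m /vP; under eq_bigr do rewrite wE -mulrA.
  by rewrite -mulr_sumr => /eqP; rewrite mulf_eq0 /= => /eqP.
- apply: (@leq_trans (\sum_j `|v j|)%N); last by rewrite -ltnS.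
  rewrite (bigD1 j0) //= [X in (_ < X)%N](bigD1 j0) //= -addSn.
  apply: leq_add; first by rewrite [v j0]wE; have := vj0; rewrite wE; lia.
  by apply: leq_sum => j _; rewrite [v j]wE; lia.
Qed.

End Exponents.

Lemma signr_expz (k : fieldType) (m : int) : (-1 : k) ^ m = (-1) ^+ `|m|%N.
Proof.
by case: m => m //; rewrite NegzE abszN -exprnN -exprVn invrN1.
Qed.

Lemma autX (k : fieldType) (Y : affine_variety k) (s : Aut Y) m y :
  (s ^+ m)%g y = iter m s y.
Proof. by elim: m => //= m IH; rewrite expgS -IH. Qed.

Section OneParameter.
Variables (k : closedFieldType) (Y : irr_affine_variety k).
Hypothesis char0 : [pchar k] =i pred0.
Local Notation N := (ambient_dim Y).
Local Notation G := (Aut Y).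

Definition weight_sum (a : k -> G) (f : Y -> k) :=
  exists (I : finType) (m : I -> int) (F : I -> Y -> k),
    [/\ forall i, regular (F i),
        forall i c y, c != 0 -> F i (a c y) = c ^ m i * F i y &
        forall y, f y = \sum_i F i y].

Section Scaling.
Variables (s : Y -> Y) (Lam : k -> Prop) (chi : k -> k).
Hypothesis Lam1 : Lam 1.
Hypothesis LamM : forall x y, Lam x -> Lam y -> Lam (x * y).
Hypothesis chi1 : chi 1 = 1.
Hypothesis chiM : forall x y, Lam x -> Lam y -> chi (x * y) = chi x * chi y.

(** The graph of the operator that multiplies the generalized eigenspace of [x] by [chi x]. As a
    relation it is easily seen to respect sums and products; [scaled_uniq] shows that it is single
    valued. *)
Definition scaled (f f' : Y -> k) :=
  exists (I : finType) (la : I -> k) (F : I -> Y -> k),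
  [/\ forall i, [/\ Lam (la i), gen_eigen s (la i) (F i) & regular (F i)],
      forall y, f y = \sum_i F i y & forall y, f' y = \sum_i chi (la i) * F i y].

Lemma scaled_eigen l f : Lam l -> gen_eigen s l f -> regular f ->
  scaled f (fun y => chi l * f y).
Proof.
move=> Ll fl rf; exists unit, (fun=> l), (fun=> f).
by split=> // y; rewrite big_const card_unit /= addr0.
Qed.

Lemma scaledD f f' g g' : scaled f f' -> scaled g g' ->
  scaled (fun y => f y + g y) (fun y => f' y + g' y).
Proof.
move=> [I [la [F [FP fE f'E]]]] [J [mu [H [HP gE g'E]]]].
exists (I + J)%type, (fun s => match s with inl i => la i | inr j => mu j end),
  (fun s => match s with inl i => F i | inr j => H j end).
by split=> [[i|j]|y|y]; rewrite ?big_sumType ?fE ?gE ?f'E ?g'E.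
Qed.

Lemma scaledM f f' g g' : scaled f f' -> scaled g g' ->
  scaled (fun y => f y * g y) (fun y => f' y * g' y).
Proof.
move=> [I [la [F [FP fE f'E]]]] [J [mu [H [HP gE g'E]]]].
exists (I * J)%type, (fun s => la s.1 * mu s.2), (fun s y => F s.1 y * H s.2 y).
split=> [[i j]|y|y] /=.
- have [Li Fi ri] := FP i; have [Lj Hj rj] := HP j.
  by split; [exact: LamM|exact: gen_eigenM|exact: regularM].
- rewrite fE gE mulr_suml -(pair_bigA _ (fun i j => F i y * H j y)) /=.
  by apply: eq_bigr => i _; rewrite mulr_sumr.
- rewrite f'E g'E mulr_suml.
  rewrite -(pair_bigA _ (fun i j => chi (la i * mu j) * (F i y * H j y))) /=.
  apply: eq_bigr => i _; rewrite mulr_sumr; apply: eq_bigr => j _.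
  by have [Li _ _] := FP i; have [Lj _ _] := HP j; rewrite chiM // mulrACA.
Qed.

Lemma scaled_cst c : scaled (fun=> c) (fun=> c).
Proof.
have := scaled_eigen Lam1 (gen_eigen1 s c) (regular_cst Y c).
by under [X in scaled _ X]eq_fun do rewrite chi1 mul1r.
Qed.

Lemma scaled_meval (F F' : 'I_N -> Y -> k) (p : {mpoly k[N]}) :
  (forall i, scaled (F i) (F' i)) ->
  scaled (fun y => p.@[fun i => F i y]) (fun y => p.@[fun i => F' i y]).
Proof.
move=> h; elim/mpoly_ring_ind: p => [c|i|p q hp hq|p q hp hq].
- under eq_fun do rewrite mevalC; under [X in scaled _ X]eq_fun do rewrite mevalC.
  exact: scaled_cst.
- under eq_fun do rewrite mevalXU; under [X in scaled _ X]eq_fun do rewrite mevalXU.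
  exact: h.
- under eq_fun do rewrite mevalD; under [X in scaled _ X]eq_fun do rewrite mevalD.
  exact: scaledD.
- under eq_fun do rewrite mevalM; under [X in scaled _ X]eq_fun do rewrite mevalM.
  exact: scaledM.
Qed.

Lemma scaled0 f f' : scaled f f' -> (forall y, f y = 0) -> forall y, f' y = 0.
Proof.
move=> [I [la [F [FP fE f'E]]]] f0 y; rewrite f'E.
apply: (@gen_eigen_weights _ _ s) => [i|x]; first by case: (FP i).
by rewrite -fE.
Qed.

Lemma scaled_uniq f f' f'' : scaled f f' -> scaled f f'' -> forall y, f' y = f'' y.
Proof.
move=> ff' ff'' y; apply/eqP; rewrite -subr_eq0 -mulN1r; apply/eqP.
have h := scaledD ff' (scaledM (scaled_cst (-1)) ff'').
by apply: (scaled0 h) => x; rewrite mulN1r subrr.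
Qed.

(* As scaled is compatible with polynomial operations, the scaled coordinates
   satisfy the equations of Y. *)
Lemma scaled_map (F : 'I_N -> Y -> k) : (forall i, scaled (crd i) (F i)) ->
  exists b : Y -> Y, (forall i y, crd i (b y) = F i y) /\
    forall f, regular f -> scaled f (fun y => f (b y)).
Proof.
move=> hF.
have /choice[b bE] : forall y, exists z : Y, forall i, crd i z = F i y.
  move=> y; have [|z zE] := @exists_point k Y (fun i => F i y).
    move=> p pY; apply: (scaled0 (scaled_meval p hF)) => x.
    by rewrite -[RHS](pY x).
  by exists z => i; rewrite /crd zE.
exists b; split=> // f [p ->].
rewrite (_ : (fun y => ev p (b y)) = fun y => p.@[fun i => F i y]).
  exact: (scaled_meval p hF).
by apply/funext => y; apply: meval_eq => i; rewrite -bE.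
Qed.

End Scaling.

Variable T : set G.
Hypothesis Tcomm : forall s t, T s -> T t -> (s * t)%g = (t * s)%g.
Hypothesis Tcent : forall g, (forall t, T t -> (g * t)%g = (t * g)%g) -> T g.
Hypothesis T1 : T 1%g.
Hypothesis TM : forall s t, T s -> T t -> T (s * t)%g.
Hypothesis Tunip : forall (u : G) M, T u ->
  (forall i y, diff u M (@crd k Y i) y = 0) -> u = 1%g.

Lemma TX s m : T s -> T (s ^+ m)%g.
Proof. by move=> Ts; elim: m => // m IH; rewrite expgS; apply: TM. Qed.

(** For [c ^+ d = 1], the pullback by [s ^+ d] minus 1 is a multiple of the pullback by [s] minus
    [c], by the factorization of a difference of [d]-th powers. *)
Lemma unipotent_power (s : G) (c : k) d M f : c ^+ d = 1 ->
  kills s M c f -> kills (s ^+ d)%g M 1 f.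
Proof.
move=> cd; elim: M f => [|M IH] f hM; first by [].
pose g (a : nat) : Y -> k := fun y => c ^+ (d - a.+1) * shift s c f (iter a s y).
have sh : shift (s ^+ d)%g 1 f = fun y => \sum_(a < d) g a y.
  apply/funext => y; rewrite /shift -cd autX /g /shift.
  pose h a := c ^+ (d - a) * f (iter a s y).
  transitivity (h d - h 0%N); first by rewrite /h subnn subn0 mul1r.
  rewrite -telescope_sumr // big_mkord; apply: eq_bigr => a _.
  by rewrite /h iterS -[(d - a)%N](subnSK (ltn_ord a)) exprS; ring.
have : kills s M c (fun y => \sum_(a < d) g a y).
  apply: (@stable_sum _ _ (kills s M c)) => [x|f1 f2 h1 h2 x|a _ x].
  - exact: iter_shift0.
  - by rewrite iter_shiftD h1 h2 addr0.
  - rewrite iter_shiftZ iter_shift_comp -?iterSr ?hM ?mulr0 // => y.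
    by rewrite -iterSr.
by move=> /IH h y; rewrite iterSr sh; apply: h.
Qed.

Variable s : G.
Hypothesis Ts : T s.
Hypothesis s_inf : forall m, (0 < m)%N -> (s ^+ m)%g <> 1%g.
Variable cs : seq k.
Hypothesis cs0 : 0 \notin cs.
Hypothesis csP : forall i y, foldl (fun f c => shift s c f) (@crd k Y i) cs y = 0.

(** Not all eigenvalues are roots of unity: otherwise a power of [s] would be unipotent in [T],
    hence trivial. An odd exponent vector gives the characters [x |-> c ^ pi x], and [a c] scales by
    them. It commutes with [T] because [T] preserves the generalized eigenspaces of [s]. *)
Lemma one_parameter : exists a : k -> G,
  [/\ forall c, c != 0 -> T (a c), a (-1) <> 1%g,
      forall c d, c != 0 -> d != 0 -> a (c * d) = (a c * a d)%g &
      forall f, regular f -> weight_sum a f].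
Proof.
pose r := size cs.
have /choice[z0 z0P] : forall i, exists z : 'I_r -> Y -> k,
    (forall l : 'I_r, gen_eigen s cs`_l (z l) /\ regular (z l)) /\
    forall y, crd i y = \sum_l z l y.
  move=> i; apply: (gen_eigen_decomposition _ _ _ _ (regular_crd i)) => //.
  - exact: regular_cst.
  - by move=> f g; apply: regularD.
  - by move=> c f; apply: regularZ.
  - by move=> f; apply: regular_aut.
(* An element of [cs] need not occur in any coordinate. Replacing it by 1 forces the exponent 0
   there, so the odd exponent belongs to an eigenvalue that does occur. *)
pose active l := exists i y, z0 i l y != 0.
pose e (l : 'I_r) := if pselect (active l) then cs`_l else 1.
have e0 l : e l != 0.
  rewrite /e; case: pselect => ?; last exact: oner_neq0.
  by apply: contraNneq cs0 => <-; apply: mem_nth.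
have zg i l : gen_eigen s (e l) (z0 i l).
  have [/(_ l)[h _] _] := z0P i; rewrite /e; case: pselect => // na.
  rewrite (_ : z0 i l = fun=> 0); first exact: gen_eigen0.
  by apply/funext => y; apply/eqP/negP => /negP h0; apply: na; exists i, y.
have zr i l : regular (z0 i l) by have [/(_ l)[]] := z0P i.
have zE i y : crd i y = \sum_l z0 i l y by have [_ ->] := z0P i.
have nroot : exists j, ~ root_of_unity (e j).
  apply: contrapT => /forallNP h.
  have [|d d0 dP] := @common_order _ _ e; first by move=> j; apply: contrapT.
  apply: (s_inf d0).
  have /choice[M hM] : forall i, exists M, kills (s ^+ d)%g M 1 (@crd k Y i).
    move=> i; rewrite (_ : @crd k Y i = fun y => \sum_l z0 i l y); last exact/funext.
    apply: gen_eigen_sum => l _; have [M hM] := zg i l.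
    by exists M; apply: (unipotent_power (dP l)).
  apply: (Tunip (M := \max_i M i)); first exact: TX.
  by move=> i y; apply: (kills_le _ (hM i)); apply: leq_bigmax.
have [v [[j0 odd0] vP]] := exponents_odd e0 nroot.
pose Lam x := exists m : 'I_r -> int, x = \prod_j e j ^ m j.
(* On the group [Lam], [pi] is the homomorphism with value [v l] at [e l], well defined by [vP]. *)
have /choice[pi piP] : forall x, exists p, forall m : 'I_r -> int,
    x = \prod_j e j ^ m j -> p = \sum_j v j * m j.
  move=> x; have [[m0 m0E]|h] := pselect (Lam x); last first.
    by exists 0 => m E; case: h; exists m.
  exists (\sum_j v j * m0 j) => m mE; apply/eqP; rewrite -subr_eq0 -sumrB.
  have := vP (fun j => m0 j + m j * (-1)).
  rewrite prod_exprzD // -prod_exprz -mE -m0E exprN1 mulfV; last first.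
    by rewrite m0E; apply/prodf_neq0 => j _; rewrite expfz_neq0.
  by move/(_ erefl) => E; apply/eqP; rewrite -[RHS]E; apply: eq_bigr => j _; ring.
have LamM x y : Lam x -> Lam y -> Lam (x * y).
  by move=> [m ->] [m' ->]; exists (fun j => m j + m' j); rewrite prod_exprzD.
have e_prod l : e l = \prod_j e j ^ (j == l)%:R.
  rewrite (bigD1 l) //= eqxx expr1z big1 ?mulr1 // => j /negbTE ->.
  by rewrite expr0z.
have Lame l : Lam (e l) by exists (fun j => (j == l)%:R).
have pie l : pi (e l) = v l.
  rewrite (piP _ _ (e_prod l)) (bigD1 l) //= eqxx mulr1 big1 ?addr0 // => j /negbTE ->.
  by rewrite mulr0.
have one_prod : 1 = \prod_j e j ^ (0 : int) by rewrite big1 // => j _; rewrite expr0z.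
have Lam1 : Lam 1 by exists (fun=> 0).
have pi1 : pi 1 = 0 by rewrite (piP _ _ one_prod) big1 // => j _; rewrite mulr0.
have piM x y : Lam x -> Lam y -> pi (x * y) = pi x + pi y.
  move=> [m mE] [m' mE']; rewrite (piP x m mE) (piP y m' mE').
  rewrite (piP (x * y) (fun j => m j + m' j)) ?prod_exprzD -?mE -?mE' //.
  by rewrite -big_split; apply: eq_bigr => j _ /=; ring.
have chi1 c : c ^ pi 1 = 1 :> k by rewrite pi1 expr0z.
have chiM (c : k) : c != 0 -> forall x y, Lam x -> Lam y ->
    c ^ pi (x * y) = c ^ pi x * c ^ pi y.
  by move=> c0 x y Lx Ly; rewrite piM // expfzDr.
have hcrd c i : scaled s Lam (fun x => c ^ pi x) (crd i)
    (fun y => \sum_l c ^ v l * z0 i l y).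
  exists 'I_r, e, (z0 i); split=> // y; apply: eq_bigr => l _.
  by rewrite pie.
have /choice[b bP] : forall c : k, exists b : Y -> Y, c != 0 ->
    (forall i y, crd i (b y) = \sum_l c ^ v l * z0 i l y) /\
    forall f, regular f -> scaled s Lam (fun x => c ^ pi x) f (fun y => f (b y)).
  move=> c; have [->|c0] := eqVneq c 0; first by exists id.
  by have [b bP] := scaled_map Lam1 LamM (chi1 c) (chiM _ c0) (hcrd c); exists b.
have key c x f y : c != 0 -> regular f -> gen_eigen s x f -> Lam x ->
    f (b c y) = c ^ pi x * f y.
  move=> c0 rf fx Lx; have [_ /(_ f rf) h] := bP c c0.
  exact: (scaled_uniq Lam1 LamM (chi1 c) (chiM _ c0) h (scaled_eigen _ Lx fx rf)).
have keyz c i l y : c != 0 -> z0 i l (b c y) = c ^ v l * z0 i l y.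
  by move=> c0; rewrite (key c (e l)) // pie.
have bM c d y : c != 0 -> d != 0 -> b c (b d y) = b (c * d) y.
  move=> c0 d0; apply: points_inj => i; have [h _] := bP c c0.
  have [h' _] := bP (c * d) (mulf_neq0 c0 d0).
  change (crd i (b c (b d y)) = crd i (b (c * d) y)); rewrite h h'.
  by apply: eq_bigr => l _; rewrite keyz // mulrA expfzMl.
have b1 y : b 1 y = y.
  apply: points_inj => i; have [h _] := bP 1 (oner_neq0 _).
  change (crd i (b 1 y) = crd i y); rewrite h zE; apply: eq_bigr => l _.
  by rewrite exp1rz mul1r.
have rb c i : c != 0 -> regular (fun y => crd i (b c y)).
  move=> c0; have [h _] := bP c c0; under eq_fun do rewrite h.
  by apply: regular_sum => l _; apply: regularZ.
have /choice[a aP] : forall c, exists a : G, c != 0 -> forall y, a y = b c y.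
  move=> c; have [->|c0] := eqVneq c 0; first by exists 1%g.
  have [||||a aE] := @exists_aut _ Y (b c) (b c^-1).
  - by move=> i; apply: rb.
  - by move=> i; apply: rb; rewrite invr_neq0.
  - by move=> y; rewrite bM ?invr_neq0 // mulVf.
  - by move=> y; rewrite bM ?invr_neq0 // mulfV.
  by exists a.
have N1 : (-1 : k) != 0 by rewrite oppr_eq0 oner_neq0.
exists a; split.
- move=> c c0; apply: Tcent => t Tt; apply: aut_eq => y.
  change (a c (t y) = t (a c y)); rewrite !aP //.
  apply: points_inj => i; have [h _] := bP c c0.
  change (crd i (b c (t y)) = crd i (t (b c y))); rewrite h zE.
  apply: eq_bigr => l _.
  rewrite (key c (e l) (fun y => z0 i l (t y))) ?pie //; first exact: regular_aut.
  have [M hM] := zg i l; exists M => x; rewrite iter_shift_comp // => x0.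
  by change ((s * t)%g x0 = (t * s)%g x0); rewrite Tcomm.
- move=> a1; suff v0 : v j0 = 0 by move: odd0; rewrite v0.
  have na : ~ active j0.
    move=> [i [y]]; apply/negP; rewrite negbK.
    have := keyz (-1) i j0 y N1; rewrite -aP // a1.
    have -> : (-1 : k) ^ v j0 = -1.
      by rewrite signr_expz -signr_odd odd0.
    move/eqP; rewrite mulN1r -addr_eq0 -mulr2n -mulr_natl mulf_eq0.
    by have /pcharf0P -> := char0.
  have ej : e j0 = 1 by rewrite /e; case: pselect.
  by rewrite -pie ej pi1.
- move=> c d c0 d0; apply: aut_eq => y.
  by change (a (c * d) y = a c (a d y)); rewrite !aP ?mulf_neq0 // bM.
- move=> f rf; have [_ /(_ f rf)[I [la [F [FP fE _]]]]] := bP 1 (oner_neq0 _).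
  exists I, (fun i => pi (la i)), F; split=> // i.
    by have [] := FP i.
  by move=> c y c0; rewrite aP //; have [? ? ?] := FP i; apply: key.
Qed.

End OneParameter.

(** * Commuting gradings *)

Section JointWeights.
Variables (k : closedFieldType) (Y : irr_affine_variety k).
Hypothesis char0 : [pchar k] =i pred0.
Local Notation N := (ambient_dim Y).
Local Notation G := (Aut Y).

(** 2 has infinite order in characteristic 0, so a weight can be read off from the eigenvalue of
    [a 2]. *)
Lemma expz2_inj (m m' : int) : (2%:R : k) ^ m = 2%:R ^ m' -> m = m'.
Proof.
have two0 : (2%:R : k) != 0 by have /pcharf0P -> := char0.
suff h (a : int) : (2%:R : k) ^ a = 1 -> a = 0.
  move=> e; apply/eqP; rewrite -subr_eq0; apply/eqP/h.
  by rewrite expfzDr // -invr_expz e mulfV // expfz_neq0.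
have nat1 a1 : (2%:R : k) ^+ a1 = 1 -> a1 = 0%N.
  rewrite -natrX => e; apply/eqP; rewrite eqn0Ngt; apply/negP => a0.
  have : (2 ^ a1 - 1)%:R == 0 :> k by rewrite natrB ?expn_gt0 // e subrr.
  have /pcharf0P -> := char0.
  by rewrite subn_eq0 leqNgt -{1}(expn0 2) ltn_exp2l // a0.
case: a => a /=; rewrite -?exprnP; first by move=> /nat1 ->.
rewrite NegzE -exprnN => /(congr1 GRing.inv); rewrite invrK invr1.
by move=> /nat1.
Qed.

Lemma weight_direct (a : k -> G) (I : finType) (m : I -> int) (F : I -> Y -> k) :
  (forall i c y, c != 0 -> F i (a c y) = c ^ m i * F i y) ->
  (forall y, \sum_i F i y = 0) -> forall w y, \sum_(i | m i == w) F i y = 0.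
Proof.
move=> Fw F0 w y.
have two0 : (2%:R : k) != 0 by have /pcharf0P -> := char0.
have := @gen_eigen_weights _ _ (a 2%:R) I (fun i => 2%:R ^ m i) F
  (fun x => (x == 2%:R ^ w)%:R) _ F0 y.
move=> h; rewrite -[RHS]h => [|i]; last first.
  by exists 1%N => x; rewrite /= /shift Fw // subrr.
rewrite big_mkcond; apply: eq_bigr => i _.
have -> : (2%:R ^ m i == 2%:R ^ w :> k) = (m i == w).
  by apply/eqP/eqP => [/expz2_inj|->].
by case: eqP => _; rewrite ?mul1r ?mul0r.
Qed.

Lemma weight_sum_uniq (a : k -> G) f : weight_sum a f ->
  exists (ms : seq int) (F : int -> Y -> k), [/\ uniq ms,
    forall m, regular (F m), forall m c y, c != 0 -> F m (a c y) = c ^ m * F m y &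
    forall y, f y = \sum_(m <- ms) F m y].
Proof.
move=> [I [m [F [Fr Fw fE]]]].
exists (undup [seq m i | i <- enum I]), (fun w y => \sum_(i | m i == w) F i y).
split; first exact: undup_uniq.
- by move=> w; apply: regular_sum => i _.
- move=> w c y c0; rewrite mulr_sumr; apply: eq_bigr => i /eqP <-.
  exact: Fw.
move=> y; rewrite fE (exchange_big_dep xpredT) //=; apply: eq_bigr => i _.
have mi : m i \in undup [seq m i | i <- enum I].
  by rewrite mem_undup; apply: map_f; rewrite mem_enum.
rewrite big_mkcond (bigD1_seq (m i)) ?undup_uniq //= eqxx big1 ?addr0 // => w.
by rewrite eq_sym => /negbTE ->.
Qed.

Variables (n : nat) (b : 'I_n -> k -> G).
Hypothesis bcomm : forall i j c d y, c != 0 -> d != 0 ->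
  b i c (b j d y) = b j d (b i c y).
Hypothesis bsum : forall i f, regular f -> weight_sum (b i) f.

Definition joint_weight (w : 'rV[int]_n) (F : Y -> k) :=
  forall i c y, c != 0 -> F (b i c y) = c ^ w 0 i * F y.

Lemma joint_weight_cst a : joint_weight 0 (fun=> a).
Proof. by move=> i c y _; rewrite mxE expr0z mul1r. Qed.

Lemma joint_weightM w w' f g : joint_weight w f -> joint_weight w' g ->
  joint_weight (w + w') (fun y => f y * g y).
Proof. by move=> hf hg i c y c0; rewrite hf // hg // mxE expfzDr // mulrACA. Qed.

Lemma joint_weightZ w a f : joint_weight w f -> joint_weight w (fun y => a * f y).
Proof. by move=> hf i c y c0; rewrite hf // mulrCA. Qed.

Lemma joint_weightX w e f : joint_weight w f ->
  joint_weight (w *+ e) (fun y => f y ^+ e).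
Proof.
move=> hf; elim: e => [|e IH]; first exact: joint_weight_cst.
rewrite mulrS (_ : (fun _ => _) = fun y => f y * f y ^+ e); first exact: joint_weightM.
by apply/funext => y; rewrite exprS.
Qed.

Lemma joint_weight_prod (I : finType) (w : I -> 'rV[int]_n) (F : I -> Y -> k) :
  (forall i, joint_weight (w i) (F i)) ->
  joint_weight (\sum_i w i) (fun y => \prod_i F i y).
Proof.
move=> h; elim: (index_enum I) => [|i r IH].
  by rewrite big_nil; under eq_fun do rewrite big_nil; apply: joint_weight_cst.
under [X in joint_weight _ X]eq_fun do rewrite big_cons.
by rewrite big_cons; apply: joint_weightM.
Qed.

Lemma joint_weight_direct (I : finType) (w : I -> 'rV[int]_n) (F : I -> Y -> k) :
  (forall i, joint_weight (w i) (F i)) -> (forall y, \sum_i F i y = 0) ->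
  forall v y, \sum_(i | w i == v) F i y = 0.
Proof.
move=> Fw F0 v.
have h (s : seq 'I_n) y : \sum_(i | all (fun j => w i 0 j == v 0 j) s) F i y = 0.
  elim: s y => [|j s IH] y; first by rewrite -[RHS](F0 y).
  rewrite /= big_andbC big_mkcondl.
  pose F' i y := if all (fun j => w i 0 j == v 0 j) s then F i y else 0.
  rewrite -[RHS](@weight_direct (b j) I (fun i => w i 0 j) F' _ _ (v 0 j) y).
  - by rewrite [RHS]big_mkcond [LHS]big_mkcond.
  - by move=> i c x c0; rewrite /F'; case: ifP => _; rewrite ?mulr0 ?Fw.
  - by move=> x; rewrite -big_mkcond.
move=> y; rewrite -[RHS](h (enum 'I_n) y); apply: eq_bigl => i.
apply/eqP/allP => [->//|e]; apply/rowP => j.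
by apply/eqP/e; rewrite mem_enum.
Qed.

Definition joint_sum (s : seq 'I_n) (f : Y -> k) :=
  exists m (w : nat -> 'rV[int]_n) (F : nat -> Y -> k),
    [/\ forall l, regular (F l),
        forall l j c y, j \in s -> c != 0 -> F l (b j c y) = c ^ w l 0 j * F l y &
        forall y, f y = \sum_(l < m) F l y].

Lemma joint_sumD s f g : joint_sum s f -> joint_sum s g ->
  joint_sum s (fun y => f y + g y).
Proof.
move=> [m [w [F [Fr Fw fE]]]] [m' [w' [F' [Fr' Fw' gE]]]].
exists (m + m')%N, (fun l => if (l < m)%N then w l else w' (l - m)%N),
  (fun l => if (l < m)%N then F l else F' (l - m)%N).
split=> [l|l j c y js c0|y].
- by case: ifP.
- by case: ifP => _; [apply: Fw|apply: Fw'].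
rewrite big_split_ord fE gE; congr (_ + _); apply: eq_bigr => l _ /=.
  by rewrite ltn_ord.
by rewrite ltnNge leq_addr /= addKn.
Qed.

Lemma joint_sum_sum s (I : Type) (r : seq I) (F : I -> Y -> k) :
  (forall i, joint_sum s (F i)) -> joint_sum s (fun y => \sum_(i <- r) F i y).
Proof.
move=> h; elim: r => [|i r IH].
  under eq_fun do rewrite big_nil.
  exists 0%N, (fun=> 0), (fun=> fun=> 0).
  by split=> [l|l j c y|y]; rewrite ?big_ord0 ?mulr0 //; apply: regular_cst.
by under eq_fun do rewrite big_cons; apply: joint_sumD.
Qed.

(** Decompose along the [b j] successively. As they commute, the components along [b j] of a weight
    vector of [b i] are again weight vectors of [b i], by uniqueness of the decomposition. *)
Lemma joint_decomposition f : regular f ->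
  exists m (w : nat -> 'rV[int]_n) (F : nat -> Y -> k),
    [/\ forall l, regular (F l), forall l, joint_weight (w l) (F l) &
        forall y, f y = \sum_(l < m) F l y].
Proof.
move=> rf; suff h s : joint_sum s f.
  have [m [w [F [Fr Fw fE]]]] := h (enum 'I_n).
  by exists m, w, F; split=> // l j c y; apply: Fw; rewrite mem_enum.
elim: s => [|j s [m [w [F [Fr Fw fE]]]]].
  exists 1%N, (fun=> 0), (fun=> f).
  by split=> // y; rewrite big_ord1.
rewrite (_ : f = fun y => \sum_(l < m) F l y); last exact/funext.
apply: joint_sum_sum => l; have [ms [H [mu Hr Hw FE]]] := weight_sum_uniq (bsum j (Fr l)).
exists (size ms), (fun p => \row_i (if i == j then ms`_p else w l 0 i)),
  (fun p y => if (p < size ms)%N then H ms`_p y else 0).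
split=> [p|p i c y|y]; last 1 first.
- by rewrite FE (big_nth 0) big_mkord; apply: eq_bigr => p _; rewrite ltn_ord.
- by case: (p < size ms)%N => //; apply: regular_cst.
case: ifP => [pm is_ c0|]; last by rewrite mulr0.
rewrite mxE; case: eqP => [->|/eqP ij]; first exact: Hw.
have {}is_ : i \in s by move: is_; rewrite inE (negbTE ij).
pose D (q : 'I_(size ms)) x := H ms`_q (b i c x) + - c ^ w l 0 i * H ms`_q x.
have := @weight_direct (b j) _ (fun q : 'I_(size ms) => ms`_q) D _ _ ms`_p y.
rewrite (big_pred1 (Ordinal pm)) => [h|q]; last first.
  by rewrite /= nth_uniq.
have : D (Ordinal pm) y = 0.
  apply: h => [q d x d0|x].
    by rewrite /D bcomm // !Hw //; ring.
  rewrite /D big_split -mulr_sumr /=.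
  have sE z : \sum_(q < size ms) H ms`_q z = F l z by rewrite FE (big_nth 0) big_mkord.
  by rewrite !sE Fw //; ring.
by rewrite /D /= mulNr => /eqP; rewrite subr_eq0 => /eqP.
Qed.

End JointWeights.

(** In Smith form, a zero or missing diagonal entry would put a column of the inverse of [R] into
    the kernel, and such a column is not divisible by 2. The rows of [diag_mx D *m R] are then a
    basis of the lattice spanned by the rows of [M]; [A] and [L] are the changes of generators. *)
Lemma smith_full_rank (m n : nat) (M : 'M[int]_(m, n)) :
  (forall v : 'cV[int]_n, M *m v = 0 -> forall l, ~~ odd `|v l 0|) ->
  exists (A : 'M[int]_(n, m)) (L : 'M[int]_(m, n)) (D : 'rV[int]_n) (R V : 'M[int]_n),
    [/\ A *m M = diag_mx D *m R, L *m (diag_mx D *m R) = M,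
        R *m V = 1%:M, V *m R = 1%:M & forall i, D 0 i != 0].
Proof.
move=> Mv; have [L uL [R uR [d _ ME]]] := int_Smith_normal_form M.
set E := (X in L *m X *m R) in ME.
have pE (i : 'I_n) : (i < m)%N /\ d`_i != 0.
  apply/andP; apply: contrapT => /negP h.
  have Mz : M *m (invmx R *m (delta_mx i 0 : 'cV_n)) = 0.
    rewrite ME !mulmxA mulmxK // -mulmxA -colE (_ : col i E = 0) ?mulmx0 //.
    apply/matrixP => j z; rewrite !mxE; case: eqP => // ji.
    by move: h; rewrite -ji ltn_ord negbK => /eqP ->.
  have := congr1 (fun X : 'cV_n => X i 0) (mulKVmx uR (delta_mx i 0)).
  rewrite !mxE !eqxx /= => e1.
  have : ~~ odd `|(\sum_l R i l * (invmx R *m (delta_mx i 0 : 'cV_n)) l 0)%R|.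
    have /choice[h2 hE] : forall l, exists w, (invmx R *m (delta_mx i 0 : 'cV_n)) l 0 = 2%:Z * w.
      move=> l; have := Mv _ Mz l; move: (_ l 0) => a.
      by exists (a %/ 2)%Z; lia.
    under eq_bigr do rewrite hE mulrCA.
    by rewrite -mulr_sumr abszM oddM.
  by rewrite e1.
pose p i : 'I_m := Ordinal (pE i).1.
pose D : 'rV_n := \row_i d`_i.
have ED : rowsub p E = diag_mx D.
  by apply/matrixP => i j; rewrite !mxE.
exists (rowsub p (invmx L)), (colsub p L), D, R, (invmx R); split.
- by rewrite mul_rowsub_mx ME -!mulmxA mulKmx // -mul_rowsub_mx ED.
- rewrite mulmxA [RHS]ME; congr (_ *m R); apply/matrixP => j i.
  rewrite mul_mx_diag !mxE (bigD1 (p i)) //= big1 ?addr0 => [|l lp].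
    by rewrite !mxE /= eqxx.
  by rewrite !mxE; move: lp; rewrite -val_eqE /= => /negbTE ->; rewrite mulr0.
- exact: mulmxV.
- exact: mulVmx.
- by move=> i; rewrite mxE; have [] := pE i.
Qed.

Section ProductsOfFunctions.
Variables (k : closedFieldType) (Y : irr_affine_variety k).
Implicit Types f g : Y -> k.

Definition nonzero f := exists y, f y <> 0.

Lemma nonzeroM f g : regular f -> regular g -> nonzero f -> nonzero g ->
  nonzero (fun y => f y * g y).
Proof.
move=> rf rg [y fy] [z gz]; apply: contrapT => /forallNP h.
have [|f0|g0] := regular_domain rf rg; first by move=> x; apply: contrapT.
  by case: fy.
by case: gz.
Qed.

Lemma nonzero_cst c : c != 0 -> nonzero (fun=> c).
Proof. by have [y _] := irr_nonempty Y => c0; exists y; apply/eqP. Qed.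

Lemma nonzeroX f e : regular f -> nonzero f -> nonzero (fun y => f y ^+ e).
Proof.
move=> rf nf; elim: e => [|e IH].
  by under eq_fun do rewrite expr0; apply: nonzero_cst; apply: oner_neq0.
under eq_fun do rewrite exprS; apply: nonzeroM => //; exact: regularX.
Qed.

Lemma nonzero_prod (I : Type) (r : seq I) (F : I -> Y -> k) :
  (forall i, regular (F i)) -> (forall i, nonzero (F i)) ->
  nonzero (fun y => \prod_(i <- r) F i y).
Proof.
move=> Fr F0; elim: r => [|i r IH].
  by under eq_fun do rewrite big_nil; apply: nonzero_cst; apply: oner_neq0.
under eq_fun do rewrite big_cons.
by apply: nonzeroM => //; apply: regular_prod.
Qed.

(** On an irreducible variety, one of the linear factors of [P] at [f] vanishes identically. *)
Lemma algebraic_constant f (P : {poly k}) : regular f -> P != 0 ->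
  (forall y, P.[f y] = 0) -> exists c, forall y, f y = c.
Proof.
move=> rf P0 Pf; have [r PE] := closed_field_poly_normal P.
have {Pf}: forall y, \prod_(z <- r) (f y - z) = 0.
  move=> y; have := Pf y; rewrite PE hornerZ horner_prod => /eqP.
  rewrite mulf_eq0 lead_coef_eq0 (negbTE P0) /= => /eqP <-.
  by apply: eq_bigr => z _; rewrite hornerXsubC.
elim: r {PE} => [|z r IH] h.
  have [y _] := irr_nonempty Y; have := h y; rewrite big_nil => /eqP.
  by rewrite oner_eq0.
have rz z0 : regular (fun y => f y - z0) by apply: regularB => //; apply: regular_cst.
have [|fz|/IH//] := regular_domain (rz z) (@regular_prod _ _ _ r xpredT _ (fun z0 _ => rz z0)).
  by move=> y; have := h y; rewrite big_cons.
by exists z => y; apply/eqP; rewrite -subr_eq0 fz.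
Qed.

End ProductsOfFunctions.

(** * Points and coordinate functions of the torus *)

Section TorusPoints.
Variables (k : fieldType) (n : nat).
Local Notation T := (Gm_power k n).

Definition tcrd i (x : T) : k := @crd k T (lshift n i) x.

Lemma regular_tcrd i : regular (@tcrd i).
Proof. exact: regular_crd. Qed.

Lemma tcrd_inv (x : T) i : tcrd i x * @crd k T (rshift n i) x = 1.
Proof.
have /set_mem /(_ _ (ex_intro2 _ _ i I erefl)) := valP x.
by rewrite mevalB mevalM !mevalXU meval1 => /eqP; rewrite subr_eq0 => /eqP.
Qed.

Lemma tcrd_neq0 (x : T) i : tcrd i x != 0.
Proof.
by apply/eqP => e; have := tcrd_inv x i; rewrite e mul0r => /eqP; rewrite eq_sym oner_eq0.
Qed.

Lemma crd_rshift (x : T) i : @crd k T (rshift n i) x = (tcrd i x)^-1.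
Proof. by apply: (mulfI (tcrd_neq0 x i)); rewrite tcrd_inv mulfV // tcrd_neq0. Qed.

Lemma regular_tcrdV i : regular (fun x => (@tcrd i x)^-1).
Proof. by under eq_fun do rewrite -crd_rshift; apply: regular_crd. Qed.

Lemma Gm_point (t : 'I_n -> k) : (forall i, t i != 0) ->
  exists x : T, forall i, tcrd i x = t i.
Proof.
move=> t0; pose v (i : 'I_(n + n)) :=
  match fintype.split i with inl j => t j | inr j => (t j)^-1 end.
have vl i : v (lshift n i) = t i by rewrite /v (unsplitK (inl i)).
have vr i : v (rshift n i) = (t i)^-1 by rewrite /v (unsplitK (inr i)).
have [|x xE] := @exists_point k T v; last first.
  by exists x => i; rewrite /tcrd /crd xE.
have vP : points T v.
  by move=> _ [i _ <-]; rewrite mevalB mevalM !mevalXU meval1 vl vr mulfV ?subrr.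
move=> p /(_ (exist _ v (mem_set vP))); exact.
Qed.

Lemma Gm_eq (x y : T) : (forall i, tcrd i x = tcrd i y) -> x = y.
Proof.
move=> h; apply: points_inj => i; rewrite -[i](@splitK n n).
case: (fintype.split i) => j; first exact: h.
by change (@crd k T (rshift n j) x = @crd k T (rshift n j) y); rewrite !crd_rshift h.
Qed.

Lemma morphism_Gm (X : affine_variety k) (f : X -> T) :
  (forall i, regular (fun x => tcrd i (f x))) ->
  (forall i, regular (fun x => (tcrd i (f x))^-1)) -> morphism f.
Proof.
move=> h hV; apply/morphism_regular => i; rewrite -[i](@splitK n n).
case: (fintype.split i) => j; first exact: h.
change (regular (fun x => @crd k T (rshift n j) (f x))).
by under eq_fun do rewrite crd_rshift; apply: hV.
Qed.

End TorusPoints.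

Lemma prod_expz_sum (k : fieldType) (I : Type) (r : seq I) (x : k) (a : I -> int) :
  x != 0 -> \prod_(i <- r) x ^ a i = x ^ (\sum_(i <- r) a i).
Proof.
move=> x0; elim: r => [|i r IH]; first by rewrite !big_nil expr0z.
by rewrite !big_cons IH expfzDr.
Qed.

Lemma regular_expz (k : fieldType) (X : affine_variety k) (f : X -> k) (a : int) :
  regular f -> regular (fun x => (f x)^-1) -> regular (fun x => f x ^ a).
Proof.
move=> rf rV; case: a => a; first exact: regularX.
under eq_fun do rewrite NegzE -exprnN -exprVn.
exact: regularX.
Qed.

Lemma exists_root_expz (k : closedFieldType) (v : k) (d : int) :
  v != 0 -> d != 0 -> exists x, x != 0 /\ x ^ d = v.
Proof.
have pos n (v0 : k) : v0 != 0 -> (0 < n)%N -> exists x, x != 0 /\ x ^+ n = v0.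
  move=> v00 n0; have /closed_rootP[x] : size ('X^n - v0%:P) != 1.
    by rewrite size_XnsubC // eqSS -lt0n.
  rewrite rootE !hornerE subr_eq0 => /eqP xn; exists x; split=> //.
  by apply: contraNneq v00 => x0; rewrite -xn x0 expr0n (gtn_eqF n0).
move=> v0 d0; case: d d0 => n n0; first by apply: pos => //; rewrite lt0n.
have [|//|x [x0 xn]] := pos n.+1 v^-1; first by rewrite invr_neq0.
by exists x; rewrite NegzE -exprnN xn invrK.
Qed.

(** * Reconstruction of a variety from commuting gradings *)

Section TorusAction.
Variables (k : closedFieldType) (Y : irr_affine_variety k).
Hypothesis char0 : [pchar k] =i pred0.
Hypothesis k_unc : ~ countable [set: k].
Local Notation N := (ambient_dim Y).
Local Notation G := (Aut Y).
Variables (n : nat) (b : 'I_n -> k -> G) (iota : G).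
Hypothesis bcomm : forall i j c d y, c != 0 -> d != 0 ->
  b i c (b j d y) = b j d (b i c y).
Hypothesis bsum : forall i f, regular f -> weight_sum (b i) f.
Hypothesis iotaP : forall i c y, c != 0 -> iota (b i c y) = b i c^-1 (iota y).

Definition torus_act (c : 'I_n -> k) (y : Y) : Y :=
  foldr (fun l => b l (c l)) y (enum 'I_n).

Hypothesis faithful : forall c : 'I_n -> k, (forall l, c l = 1 \/ c l = -1) ->
  (forall y, torus_act c y = y) -> forall l, c l = 1.
Hypothesis dimY : (krull_dim Y <= n)%N.

Local Notation jw := (@joint_weight k Y n b).

Lemma jw_inv w f : jw w f -> jw (- w) (fun y => f (iota y)).
Proof.
by move=> h i c y c0; rewrite iotaP // h ?invr_neq0 // mxE -exprz_inv.
Qed.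

Lemma jw_act c w f y : (forall l, c l != 0) -> jw w f ->
  f (torus_act c y) = (\prod_l c l ^ w 0 l) * f y.
Proof.
move=> c0 h; rewrite /torus_act -big_enum /=.
elim: (enum 'I_n) => [|l s IH] /=; first by rewrite big_nil mul1r.
by rewrite big_cons h // IH mulrA.
Qed.

(** Composition with [iota] stands in for the inverse while weight vectors are not yet known to be
    units; it produces the same weight. *)
Definition zpow f (a : int) : Y -> k :=
  fun y => (if 0 <= a then f y else f (iota y)) ^+ `|a|%N.

Lemma regular_zpow f a : regular f -> regular (zpow f a).
Proof.
by move=> rf; rewrite /zpow; case: (0 <= a); apply: regularX => //; apply: regular_aut.
Qed.

Lemma nonzero_iota f : nonzero f -> nonzero (fun y => f (iota y)).
Proof. by move=> [y fy]; exists ((iota^-1)%g y); rewrite autVr. Qed.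

Lemma nonzero_zpow f a : regular f -> nonzero f -> nonzero (zpow f a).
Proof.
move=> rf nf; rewrite /zpow; case: (0 <= a); apply: nonzeroX => //.
  exact: regular_aut.
exact: nonzero_iota.
Qed.

Lemma jw_zpow w f a : jw w f -> jw (a *: w) (zpow f a).
Proof.
move=> h; rewrite /zpow; case a0: (0 <= a).
  rewrite (_ : a *: w = w *+ `|a|%N); first exact: joint_weightX.
  by rewrite -scaler_nat; congr (_ *: _); lia.
rewrite (_ : a *: w = (- w) *+ `|a|%N).
  by apply: joint_weightX; apply: jw_inv.
by rewrite -scaler_nat scalerN -scaleNr; congr (_ *: _); lia.
Qed.

Lemma coordinate_weights : exists m (w : 'I_m -> 'rV[int]_n) (z : 'I_m -> Y -> k)
    (eps : 'I_N -> 'I_m -> k),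
  (forall j, [/\ regular (z j), nonzero (z j) & jw (w j) (z j)]) /\
  forall i y, crd i y = \sum_j eps i j * z j y.
Proof.
have /choice[d] : forall i : 'I_N, exists d : nat * (nat -> 'rV[int]_n) * (nat -> Y -> k),
    [/\ forall l, regular (d.2 l), forall l, jw (d.1.2 l) (d.2 l) &
        forall y, crd i y = \sum_(l < d.1.1) d.2 l y].
  move=> i; have [m [w [F h]]] := joint_decomposition char0 bcomm bsum (regular_crd i).
  by exists (m, w, F).
move=> dP; pose B := \max_i (d i).1.1.
pose F (p : 'I_N * 'I_B) := (d p.1).2 p.2.
pose nz p := `[< nonzero (F p) >].
have nzP p : nz p = false -> forall y, F p y = 0.
  by move=> /asboolP h y; apply: contrapT => fy; apply: h; exists y.
pose P (j : 'I_#|{: 'I_N * 'I_B}|) : 'I_N * 'I_B := enum_val j.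
(* Vanishing components are replaced by the constant 1, of weight 0, with coefficient 0: every [z j]
   has to be nonzero. *)
exists #|{: 'I_N * 'I_B}|,
  (fun j => if nz (P j) then (d (P j).1).1.2 (P j).2 else 0),
  (fun j => if nz (P j) then F (P j) else fun=> 1),
  (fun i j => (((P j).1 == i) && ((P j).2 < (d i).1.1)%N && nz (P j))%:R).
split=> [j|i y] /=.
  case nzj: (nz (P j)); first (move/asboolP: nzj => h).
    by have [r0 w0 _] := dP (P j).1; split; [exact: r0| |exact: w0].
  split; [exact: regular_cst|exact/nonzero_cst/oner_neq0|].
  exact: joint_weight_cst.
have [_ _ ->] := dP i.
rewrite -(big_enum_val (A := {: 'I_N * 'I_B}) (fun p => ((p.1 == i) && (p.2 < (d i).1.1)%N && nz p)%:R *
  (if nz p then F p else fun=> 1) y)) /=.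
have -> : \sum_(p in {: 'I_N * 'I_B}) ((p.1 == i) && (p.2 < (d i).1.1)%N && nz p)%:R *
    (if nz p then F p else fun=> 1) y =
    \sum_(p : 'I_N * 'I_B) (if p.1 == i then
       (if (p.2 < (d i).1.1)%N then F p y else 0) else 0).
  apply: eq_bigr => p _; have [_|_] /= := eqVneq p.1 i; last by rewrite mul0r.
  have [_|_] /= := ltnP p.2 (d i).1.1; last by rewrite mul0r.
  by case nzp: (nz p); rewrite ?mul1r // mul0r nzP.
rewrite -(pair_bigA _ (fun (i' : 'I_N) (l : 'I_B) => if i' == i then
   (if (l < (d i).1.1)%N then F (i', l) y else 0) else 0)) /=.
rewrite (bigD1 i) //= eqxx [X in _ + X]big1 ?addr0; last first.
  by move=> i' /negbTE ->; rewrite big1.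
rewrite -big_mkcond /= /F /=.
have le : ((d i).1.1 <= B)%N by apply: leq_bigmax.
by rewrite (big_ord_widen _ (fun l => (d i).2 l y) le).
Qed.

Lemma torus_act_signs (w : 'rV[int]_n) (v : 'I_n -> int) f y : jw w f ->
  \sum_l w 0 l * v l = 0 -> f (torus_act (fun l => (-1) ^ v l) y) = f y.
Proof.
have N1 : (-1 : k) != 0 by rewrite oppr_eq0 oner_neq0.
move=> h e; rewrite (jw_act y _ h) => [|l]; last by rewrite expfz_neq0.
under eq_bigr do rewrite exprz_exp mulrC.
by rewrite prod_expz_sum // e expr0z mul1r.
Qed.

(** If [v] is orthogonal to all weights, the signs [(-1) ^ v l 0] act trivially on every coordinate;
    by [faithful] they are all 1. *)
Lemma weights_full_rank m (w : 'I_m -> 'rV[int]_n) (z : 'I_m -> Y -> k)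
    (eps : 'I_N -> 'I_m -> k) :
  (forall j, jw (w j) (z j)) -> (forall i y, crd i y = \sum_j eps i j * z j y) ->
  forall v : 'cV[int]_n, (\matrix_j w j) *m v = 0 -> forall l, ~~ odd `|v l 0|.
Proof.
move=> zw crdE v Mv l.
have N1 : (1 : k) != -1.
  rewrite -addr_eq0 -mulr2n; by have /pcharf0P -> := char0.
apply/negP => ol; have h := @faithful (fun l => (-1) ^ v l 0).
suff : (-1 : k) ^ v l 0 = 1.
  by rewrite signr_expz -signr_odd ol expr1 => e; rewrite e eqxx in N1.
apply: h => [l'|y].
  by rewrite signr_expz -signr_odd; case: odd; [right; rewrite expr1|left].
apply: points_inj => i; change (crd i (torus_act (fun l => (-1) ^ v l 0) y) = crd i y).
rewrite !crdE; apply: eq_bigr => j _; rewrite (@torus_act_signs (w j)) //.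
have := congr1 (fun X : 'cV_m => X j 0) Mv; rewrite !mxE => e.
by rewrite -[RHS]e; apply: eq_bigr => l' _; rewrite mxE.
Qed.

Section IndependentWeights.
Variables (Om : 'M[int]_n) (u : 'I_n -> Y -> k).
Hypothesis Om_inj : forall a a' : 'rV[int]_n, a *m Om = a' *m Om -> a = a'.
Hypothesis ur : forall i, regular (u i).
Hypothesis u0 : forall i, nonzero (u i).
Hypothesis uw : forall i, jw (row i Om) (u i).

(* With the u_i, a nonconstant function of weight 0 would give n + 1
   algebraically independent functions. *)
Lemma weight0_constant f : regular f -> jw 0 f -> exists c, forall y, f y = c.
Proof.
move=> rf wf; apply: contrapT => nf.
pose F (i : 'I_n.+1) : Y -> k := if unlift ord0 i is Some j then u j else f.
have Fr i : regular (F i) by rewrite /F; case: unlift.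
have /choice[g gE] : forall i, exists p, F i = ev p by move=> i; exact: Fr.
suff indep : alg_indep id (points Y) g.
  have Ycl : Zclosed id (points Y) by have [S SE] := points_closed Y; exists S.
  have Yirr := irreducible_Zirr (points_closed Y) (irr_varietyP Y).
  have := krull_dim_ge (alg_indep_chain k_unc Ycl Yirr indep).
  by move=> /leq_trans/(_ dimY); rewrite ltnn.
move=> q qY; apply: contrapT => /eqP q0.
have qF y : q.@[fun i => F i y] = 0.
  rewrite -[RHS](qY (\val y)); last exact: (set_mem (valP y)).
  by apply: meval_eq => i; rewrite gE.
pose a (mm : 'X_{1..n.+1}) : 'rV[int]_n := \row_j (mm (lift ord0 j))%:Z.
pose I := 'I_(size (msupp q)).
pose ml (i : I) := nth 0%MM (msupp q) i.
pose H (i : I) y := q@_(ml i) * (f y ^+ ml i ord0 * \prod_j u j y ^+ ml i (lift ord0 j)).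
have HE y : \sum_i H i y = 0.
  rewrite -[RHS](qF y) mevalE (big_nth 0%MM) big_mkord.
  apply: eq_bigr => i _; rewrite /H /ml big_ord_recl {1}/F unlift_none.
  by congr (_ * (_ * _)); apply: eq_bigr => j _; rewrite /F liftK.
have Hw i : jw (a (ml i) *m Om) (H i).
  have -> : a (ml i) *m Om = 0 *+ ml i ord0 + \sum_j a (ml i) 0 j *: row j Om.
    by rewrite mul0rn add0r mulmx_sum_row.
  apply: joint_weightZ; apply: joint_weightM; first exact: joint_weightX.
  apply: (@joint_weight_prod _ _ _ _ 'I_n (fun j => a (ml i) 0 j *: row j Om)
    (fun j y => u j y ^+ ml i (lift ord0 j))) => j.
  by rewrite mxE -natz scaler_nat; apply: joint_weightX.
have := mlead_supp q0; set m0 := mlead q => m0q.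
(* Consider the part of the relation with the weight of the leading monomial [m0]. By injectivity of
   [Om] its terms share the exponents of the [u j], so it is [U] times a nonzero polynomial in
   [f]. *)
pose U y := \prod_j u j y ^+ m0 (lift ord0 j).
pose P := \sum_(i : I | a (ml i) == a m0) q@_(ml i) *: 'X^(ml i ord0).
have PE y : P.[f y] = \sum_(i : I | a (ml i) == a m0) q@_(ml i) * f y ^+ ml i ord0.
  by rewrite horner_sum; apply: eq_bigr => i _; rewrite hornerZ hornerXn.
have UP y : U y * P.[f y] = 0.
  rewrite -[RHS](joint_weight_direct char0 Hw HE (a m0 *m Om) y) PE mulr_sumr.
  apply: eq_big => i; first by apply/eqP/eqP => [->|/Om_inj].
  move=> /eqP e; rewrite /H [LHS]mulrC -mulrA; congr (_ * (_ * _)).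
  apply: eq_bigr => j _.
  by have := congr1 (fun X : 'rV_n => X 0 j) e; rewrite !mxE => -[->].
apply: nf; apply: (@algebraic_constant _ _ _ P) => //.
- have i0p : (index m0 (msupp q) < size (msupp q))%N by rewrite index_mem.
  pose i0 : I := Ordinal i0p.
  have mi0 : ml i0 = m0 by rewrite /ml nth_index.
  apply/eqP => /(congr1 (fun p : {poly k} => p`_(m0 ord0))).
  rewrite coef0 coef_sum (bigD1 i0) ?mi0 //= coefZ coefXn eqxx mulr1 big1.
    by rewrite addr0 => /eqP; apply/negP; rewrite mcoeff_eq0 negbK.
  move=> i /andP[/eqP e ii0]; rewrite coefZ coefXn; case: eqP => [e0|]; last by rewrite mulr0.
  case/eqP: ii0; apply/val_inj/eqP; rewrite -(nth_uniq 0%MM _ _ (msupp_uniq q)) ?ltn_ord //.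
  apply/eqP; rewrite -/(ml i) -/(ml i0) mi0; apply/mnmP => l.
  case: (unliftP ord0 l) => [j ->|->] //.
  by have := congr1 (fun X : 'rV_n => X 0 j) e; rewrite !mxE => -[->].
- have Ur : regular U by apply: regular_prod => j _; apply: regularX.
  have Pr : regular (fun y => P.[f y]).
    rewrite (funext PE); apply: regular_sum => i _.
    by apply: regularZ; apply: regularX.
  have [y Uy] : nonzero U.
    by apply: nonzero_prod => j; [apply: regularX|apply: nonzeroX].
  by case: (regular_domain Ur Pr UP) => // /(_ y).
Qed.

Lemma weight_unit w f : regular f -> nonzero f -> jw w f ->
  exists2 c, c != 0 & forall y, f y * f (iota y) = c.
Proof.
move=> rf nf wf; have rfi := regular_aut iota rf.
have [|c cE] := weight0_constant (regularM rf rfi).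
  by rewrite -(subrr w); apply: joint_weightM => //; apply: jw_inv.
exists c => //; apply/eqP => c0.
by have [y] := nonzeroM rf rfi nf (nonzero_iota nf); rewrite cE c0.
Qed.

(** Multiplication by [f o iota] brings [g] to weight 0, and up to a constant [f o iota] is the
    inverse of [f]. *)
Lemma weight_unique w f g : regular f -> nonzero f -> jw w f ->
  regular g -> jw w g -> exists c, forall y, g y = c * f y.
Proof.
move=> rf nf wf rg wg; have [c c0 cE] := weight_unit rf nf wf.
have rfi := regular_aut iota rf.
have [|d dE] := weight0_constant (regularM rg rfi).
  by rewrite -(subrr w); apply: joint_weightM => //; apply: jw_inv.
exists (d / c) => y; apply: (mulIf c0).
by rewrite -{1}(cE y) mulrCA dE mulrAC divfK // mulrC.
Qed.

End IndependentWeights.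

(** Smith's form yields products [u i] of powers of the [z j] whose weights are a basis of the
    weight lattice. They are units, every [z j] is a constant times a monomial in them, and they
    take arbitrary nonzero values: they are the coordinates of a torus. *)
Theorem torus_of_action : isomorphic (Gm_power k n) Y.
Proof.
have [m [w [z [eps [zP crdE]]]]] := coordinate_weights.
have zr j : regular (z j) by have [] := zP j.
have zn j : nonzero (z j) by have [] := zP j.
have zw j : jw (w j) (z j) by have [] := zP j.
have [A [L [D [R [V [AM LM RV VR D0]]]]]] := smith_full_rank (weights_full_rank zw crdE).
set M := \matrix_j w j in AM LM; set Om := diag_mx D *m R in AM LM.
have Om_inj (a a' : 'rV[int]_n) : a *m Om = a' *m Om -> a = a'.
  move=> /(congr1 (mulmx^~ V)); rewrite !mulmxA -!(mulmxA _ R) RV !mulmx1.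
  rewrite !mul_mx_diag => e; apply/rowP => i.
  by have := congr1 (fun X : 'rV_n => X 0 i) e; rewrite !mxE => /(mulIf (D0 i)).
pose u i y := \prod_j zpow (z j) (A i j) y.
have ur i : regular (u i) by apply: regular_prod => j _; apply: regular_zpow.
have un i : nonzero (u i).
  by apply: nonzero_prod => j; [apply: regular_zpow|apply: nonzero_zpow].
have uw i : jw (row i Om) (u i).
  rewrite -AM row_mul mulmx_sum_row.
  apply: (@joint_weight_prod _ _ _ _ _ (fun j => row i A 0 j *: row j M)
    (fun j => zpow (z j) (A i j))) => j.
  by rewrite rowK mxE; apply: jw_zpow.
have /choice[kap kapP] : forall i, exists c, c != 0 /\ forall y, u i y * u i (iota y) = c.
  by move=> i; have [c c0 cE] := weight_unit Om_inj ur un uw (ur i) (un i) (uw i); exists c.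
have u0 i y : u i y != 0.
  have [c0 cE] := kapP i; apply: contraNneq c0 => e.
  by rewrite -(cE y) e mul0r.
have uVr i : regular (fun y => (u i y)^-1).
  have [c0 cE] := kapP i.
  rewrite (_ : (fun _ => _) = fun y => (kap i)^-1 * u i (iota y)).
    by apply: regularZ; apply: regular_aut.
  apply/funext => y; apply: (mulfI (u0 i y)).
  by rewrite mulfV // mulrCA cE mulVf.
pose mono (a : 'rV[int]_n) y := \prod_i u i y ^ a 0 i.
have mono_r a : regular (mono a) by apply: regular_prod => i _; apply: regular_expz.
have mono0 a y : mono a y != 0 by apply/prodf_neq0 => i _; rewrite expfz_neq0.
have mono_w a : jw (a *m Om) (mono a).
  move=> l c y c0; rewrite /mono mxE -prod_expz_sum // -big_split.
  apply: eq_bigr => i _ /=; rewrite uw // expfzMl exprz_exp mxE.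
  by rewrite [Om i l * _]mulrC.
have /choice[ka kaP] : forall j, exists c, forall y, z j y = c * mono (row j L) y.
  move=> j; apply: (weight_unique Om_inj ur un uw (w := w j)) => //.
    by have [y _] := irr_nonempty Y; exists y; apply/eqP.
  by have := mono_w (row j L); rewrite -row_mul LM rowK.
have crd_u i y : crd i y = \sum_j eps i j * (ka j * \prod_l u l y ^ L j l).
  rewrite crdE; apply: eq_bigr => j _; rewrite kaP; congr (_ * (_ * _)).
  by apply: eq_bigr => l _; rewrite mxE.
have u_surj (t : 'I_n -> k) : (forall i, t i != 0) -> exists y, forall i, u i y = t i.
  move=> t0; have [y0 _] := irr_nonempty Y.
  have /choice[s sP] : forall i, exists x, x != 0 /\ x ^ D 0 i = t i / u i y0.
    by move=> i; apply: exists_root_expz => //; rewrite mulf_neq0 ?invr_neq0.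
  (* [V] inverts [R], and the elementary divisors [D] are undone by extracting roots: acting by [c]
     multiplies [u i] by [s i ^ D 0 i]. *)
  pose c l := \prod_i s i ^ V l i.
  have c0 l : c l != 0 by apply/prodf_neq0 => i _; rewrite expfz_neq0 //; case: (sP i).
  exists (torus_act c y0) => i; rewrite (jw_act y0 c0 (uw i)).
  suff -> : \prod_l c l ^ row i Om 0 l = t i / u i y0 by rewrite divfK.
  under eq_bigr do rewrite prod_exprz.
  rewrite exchange_big /=.
  have [_ <-] := sP i.
  have E i' : \prod_l s i' ^ (V l i' * row i Om 0 l) = s i' ^ (D 0 i * (i == i')%:R).
    rewrite prod_expz_sum; last by case: (sP i').
    congr (_ ^ _); have := congr1 (fun X : 'M_n => X i i') RV; rewrite !mxE => <-.
    rewrite mulr_sumr; apply: eq_bigr => l _.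
    by rewrite mxE /Om mul_diag_mx mxE; ring.
  under eq_bigr do rewrite E.
  rewrite (bigD1 i) //= eqxx mulr1 big1 ?mulr1 // => i' /negbTE.
  by rewrite eq_sym => ->; rewrite mulr0 expr0z.
have /choice[h hE] : forall x : Gm_power k n, exists y, forall i, u i y = tcrd i x.
  by move=> x; apply: u_surj => i; apply: tcrd_neq0.
have /choice[g gE] : forall y : Y, exists x : Gm_power k n, forall i, tcrd i x = u i y.
  by move=> y; apply: Gm_point.
exists h, g; split.
- apply/morphism_regular => i; under eq_fun do rewrite crd_u.
  apply: regular_sum => j _; apply: regularZ; apply: regularZ.
  apply: regular_prod => l _; under eq_fun do rewrite hE.
  by apply: regular_expz; [apply: regular_tcrd|apply: regular_tcrdV].
- apply: morphism_Gm => i.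
  + by under eq_fun do rewrite gE.
  + by under eq_fun do rewrite gE.
- by move=> x; apply: Gm_eq => i; rewrite gE hE.
- move=> y; apply: points_inj => i; change (crd i (h (g y)) = crd i y).
  rewrite !crd_u; apply: eq_bigr => j _; congr (_ * (_ * _)).
  by apply: eq_bigr => l _; rewrite hE gE.
Qed.

End TorusAction.

(** * Automorphisms of the torus *)

Lemma mlastcM (R : nzRingType) n (p q : {mpoly R[n]}) :
  (p * q)@_(mlast p + mlast q) = p@_(mlast p) * q@_(mlast q).
Proof.
have [->|p0] := eqVneq p 0; first by rewrite mul0r !mcoeff0 mul0r.
have [->|q0] := eqVneq q 0; first by rewrite mulr0 !mcoeff0 mulr0.
have only m1 m2 : m1 \in msupp p -> m2 \in msupp q ->
    (m1 + m2)%MM = (mlast p + mlast q)%MM -> m1 = mlast p /\ m2 = mlast q.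
  move=> /mlast_lemc le1 /mlast_lemc le2 e; suff e1 : m1 = mlast p.
    by split=> //; move: e; rewrite e1 => /addmI.
  move: le1; rewrite le_eqVlt => /predU1P[->//|lt1].
  by have := ltmc_le_add lt1 le2; rewrite e ltxx.
rewrite mpolyME raddf_sum big_allpairs /=.
rewrite (bigD1_seq (mlast p)) ?mlast_supp ?msupp_uniq //=.
rewrite (bigD1_seq (mlast q)) ?mlast_supp ?msupp_uniq //=.
rewrite mcoeffZ mcoeffX eqxx mulr1 -[RHS]addr0 -addrA; congr (_ + _).
rewrite !big1_seq ?addr0 // => m1 /andP[ne m1S].
  apply: big1_seq => m2 /= m2S; rewrite mcoeffZ mcoeffX.
  by case: eqP => [/(only _ _ m1S m2S)[/eqP]|]; rewrite ?(negbTE ne) ?mulr0.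
rewrite mcoeffZ mcoeffX; case: eqP => [/(only _ _ (mlast_supp p0) m1S)[_ /eqP]|].
  by rewrite (negbTE ne).
by rewrite mulr0.
Qed.

(** The leading monomials of [p] and [q] add up to [m], and so do the least ones; this forces the
    two extreme monomials of [p] to agree. *)
Lemma monomial_factor (F : fieldType) n (p q : {mpoly F[n]}) m :
  p * q = 'X_[m] -> exists c a, c != 0 /\ p = c *: 'X_[a].
Proof.
move=> pq; have : p * q != 0 by rewrite pq -msupp_eq0 msuppX.
rewrite mulf_eq0 negb_or => /andP[p0 q0].
have lead : (mlead p + mlead q)%MM = m.
  have := mleadM_proper (p := p) (q := q); rewrite pq mleadXm => -> //.
  by rewrite mulf_neq0 // mleadc_eq0.
have last : (mlast p + mlast q)%MM = m.
  apply/eqP; have := mlastcM p q; rewrite pq mcoeffX => /eqP.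
  have [//|_] := eqVneq m (mlast p + mlast q)%MM.
  by rewrite eq_sym mulf_eq0 !mcoeff_eq0 !mlast_supp.
have e : mlast p = mlead p.
  apply/eqP; rewrite eq_le mlast_lemc ?mlead_supp //= leNgt; apply/negP => lt.
  have := ltmc_le_add lt (mlast_lemc (mlead_supp q0)).
  by rewrite lead last ltxx.
exists p@_(mlead p), (mlead p); rewrite mleadc_eq0; split=> //.
apply/mpolyP => b; rewrite mcoeffZ mcoeffX.
case: eqP => [->|/eqP ne]; first by rewrite mulr1.
rewrite mulr0; apply: contrapT => /eqP; rewrite mcoeff_eq0 negbK => bp.
case/eqP: ne; apply/eqP; rewrite eq_le -{1}e mlast_lemc //.
exact: msupp_le_mlead.
Qed.

(** Times the product of the variables, [p] vanishes everywhere; apply the Nullstellensatz to the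
    zero ideal. *)
Lemma mpoly_nowhere0 (k : closedFieldType) n (p : {mpoly k[n]}) :
  ~ countable [set: k] -> (forall t : 'I_n -> k, (forall i, t i != 0) -> p.@[t] = 0) ->
  p = 0.
Proof.
move=> k_unc pt; pose M : {mpoly k[n]} := 'X_[[multinom 1%N | i < n]].
have M0 : M != 0 by rewrite -msupp_eq0 msuppX.
suff /eqP : p * M = 0 by rewrite mulf_eq0 (negbTE M0) orbF => /eqP.
apply: contrapT => /eqP pM.
have [|e|v [_]] := @nullstellensatz k n k_unc [set 0] (p * M).
- split=> // [p1 p2 -> ->|p1 p2 ->]; rewrite ?addr0 ?mulr0 //.
- by move/eqP; rewrite expf_eq0 (negbTE pM) andbF.
apply/negP; rewrite negbK mevalM mulf_eq0.
have [/forallP v0|] := boolP [forall i, v i != 0]; first by rewrite pt ?eqxx.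
rewrite negb_forall => /existsP[i]; rewrite negbK => /eqP vi.
by rewrite mevalX (bigD1 i) //= mnmE vi expr1 mul0r eqxx orbT.
Qed.

Section TorusFunctions.
Variables (k : closedFieldType) (n : nat).
Hypothesis k_unc : ~ countable [set: k].
Local Notation T := (Gm_power k n).

Definition monall : 'X_{1..n} := [multinom 1%N | i < n].

Lemma meval_monall (t : 'I_n -> k) e : 'X_[monall *+ e].@[t] = (\prod_i t i) ^+ e.
Proof.
rewrite -mpolyXn rmorphXn /= mevalX; congr (_ ^+ e); apply: eq_bigr => i _.
by rewrite mnmE expr1.
Qed.

Lemma Gm_coords (t : 'I_n -> k) : (forall i, t i != 0) ->
  exists x : T, (fun i => tcrd i x) = t.
Proof. by move=> /Gm_point[x xE]; exists x; apply/funext. Qed.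

Lemma regular_numerator (f : T -> k) : regular f -> exists p e, forall x : T,
  f x * (\prod_i tcrd i x) ^+ e = p.@[fun i => tcrd i x].
Proof.
move=> [P ->]; rewrite /ev; elim/mpoly_ring_ind: P => [c|i|P Q|P Q].
- by exists c%:MP, 0%N => x; rewrite !mevalC mulr1.
- rewrite -[i](@splitK n n); case: (fintype.split i) => j.
    by exists 'X_j, 0%N => x; rewrite !mevalXU mulr1.
  exists (\prod_(i | i != j) 'X_i), 1%N => x.
  rewrite mevalXU rmorph_prod /= expr1 (bigD1 j) //= mulrA.
  rewrite [X in X * _](_ : _ = 1) ?mul1r; last first.
    by rewrite mulrC; apply: (tcrd_inv x j).
  by apply: eq_bigr => l _; rewrite mevalXU.
- move=> [p [e pE]] [q [e' qE]].
  exists (p * 'X_[monall *+ e'] + q * 'X_[monall *+ e]), (e + e')%N => x.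
  by rewrite !mevalD !mevalM !meval_monall -pE -qE exprD; ring.
- move=> [p [e pE]] [q [e' qE]]; exists (p * q), (e + e')%N => x.
  by rewrite !mevalM -pE -qE exprD; ring.
Qed.

Lemma prod_tcrd0 (x : T) : \prod_i tcrd i x != 0.
Proof. by apply/prodf_neq0 => i _; apply: tcrd_neq0. Qed.

(** After clearing denominators, the numerators of [f] and of its inverse multiply to a monomial, so
    each of them is one up to a constant. *)
Lemma unit_monomial (f h : T -> k) : regular f -> regular h -> (forall x, f x * h x = 1) ->
  exists c (a : 'I_n -> int), c != 0 /\ forall x, f x = c * \prod_i tcrd i x ^ a i.
Proof.
move=> /regular_numerator[p [e pE]] /regular_numerator[q [e' qE]] fh.
have pq : p * q = 'X_[monall *+ (e + e')].
  apply/eqP; rewrite -subr_eq0; apply/eqP/(mpoly_nowhere0 k_unc) => t t0.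
  have [x <-] := Gm_coords t0.
  rewrite mevalB mevalM -pE -qE meval_monall exprD mulrACA fh mul1r.
  by rewrite subrr.
have [c [a [c0 pa]]] := monomial_factor pq.
exists c, (fun i => (a i)%:Z - e%:Z); split=> // x.
apply: (mulIf (expf_neq0 e (prod_tcrd0 x))); rewrite pE pa mevalZ mevalX -mulrA.
congr (_ * _); rewrite -prodrXl -big_split; apply: eq_bigr => i _ /=.
by rewrite expfzDr ?tcrd_neq0 // -exprnN -exprnP divfK ?expf_neq0 ?tcrd_neq0.
Qed.

(** More than [n] functions on the torus are polynomials over a common power of the product of the
    coordinates, hence dependent by [rational_dependence]. *)
Lemma krull_dim_torus (X : affine_variety k) : isomorphic X T -> (krull_dim X <= n)%N.
Proof.
move=> [f [g [mf mg fg gf]]]; apply: krull_dim_le => d.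
move=> /irreducible_chain_alg_indep[F Find]; rewrite leqNgt; apply/negP => nd.
have /choice[P0 P0E] : forall i, exists pe : {mpoly k[n]} * nat, forall x : T,
    ev (F i) (g x) * (\prod_i tcrd i x) ^+ pe.2 = pe.1.@[fun i => tcrd i x].
  move=> i; have [|p [e pE]] := @regular_numerator (fun x => ev (F i) (g x)).
    by apply: regular_comp => //; exists (F i).
  by exists (p, e).
pose e := \max_i (P0 i).2.
pose p i := (P0 i).1 * 'X_[monall *+ (e - (P0 i).2)].
have pE i x : ev (F i) (g x) * (\prod_i tcrd i x) ^+ e = (p i).@[fun i => tcrd i x].
  have ei : ((P0 i).2 <= e)%N by apply: leq_bigmax.
  by rewrite mevalM -P0E meval_monall -mulrA -exprD subnKC.
have [q [q0 qE]] := rational_dependence p 'X_[monall *+ e] nd.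
case/eqP: q0; apply: Find => w Xw.
pose xw : X := exist _ w (mem_set Xw).
have := qE (fun i => tcrd i (f xw)); rewrite meval_monall expf_neq0 ?prod_tcrd0 // => /(_ isT).
move=> E; rewrite -[RHS]E; apply: meval_eq => i.
by rewrite -pE mulfK ?expf_neq0 ?prod_tcrd0 // fg.
Qed.

End TorusFunctions.

Section TorusAutomorphisms.
Variables (k : closedFieldType) (n : nat).
Hypothesis k_unc : ~ countable [set: k].
Local Notation T := (Gm_power k n).
Local Notation GT := (Aut T).
Implicit Types (t : 'I_n -> k) (x : T) (A B : 'M[int]_n).

Definition nz t := forall i, t i != 0.
Definition coords x : 'I_n -> k := fun i => tcrd i x.

Lemma coords_nz x : nz (coords x).
Proof. by move=> i; apply: tcrd_neq0. Qed.

Lemma coords_inj x x' : coords x = coords x' -> x = x'.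
Proof. by move=> e; apply: Gm_eq => i; have := congr1 (@^~ i) e. Qed.

Definition monomial_map (phi : ('I_n -> k) -> 'I_n -> k) := forall i,
  exists c (a : 'I_n -> int), c != 0 /\ forall t, nz t -> phi t i = c * \prod_j t j ^ a j.

Lemma monomial_map_nz phi t : monomial_map phi -> nz t -> nz (phi t).
Proof.
move=> h t0 i; have [c [a [c0 ->]]] := h i; rewrite // mulf_neq0 //.
by apply/prodf_neq0 => j _; rewrite expfz_neq0.
Qed.

Lemma regular_monomial phi i : monomial_map phi ->
  regular (fun x => phi (coords x) i) /\ regular (fun x => (phi (coords x) i)^-1).
Proof.
move=> h; have [c [a [c0 E0]]] := h i; have E x := E0 _ (coords_nz x).
have pr (b : 'I_n -> int) : regular (fun x : T => \prod_j coords x j ^ b j).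
  by apply: regular_prod => j _; apply: regular_expz; [apply: regular_tcrd|apply: regular_tcrdV].
split; under eq_fun do rewrite E; first exact/regularZ/pr.
rewrite (_ : (fun _ => _) = fun x => c^-1 * \prod_j coords x j ^ (a j * (-1))).
  exact/regularZ/pr.
by apply/funext => x; rewrite -prod_exprz exprN1 invfM.
Qed.

Lemma Gm_aut phi psi : monomial_map phi -> monomial_map psi ->
  (forall t, nz t -> psi (phi t) = t) -> (forall t, nz t -> phi (psi t) = t) ->
  exists a : GT, forall x, coords (a x) = phi (coords x).
Proof.
have ex chi : monomial_map chi -> exists f : T -> T, forall x, coords (f x) = chi (coords x).
  move=> hc; have /choice[f fE] : forall x : T, exists z : T, coords z = chi (coords x).
    by move=> x; apply: Gm_coords; apply/monomial_map_nz/coords_nz.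
  by exists f.
have morph chi (f : T -> T) : monomial_map chi ->
    (forall x, coords (f x) = chi (coords x)) -> morphism f.
  move=> hc fE; have E i x : tcrd i (f x) = chi (coords x) i by rewrite -fE.
  by apply: morphism_Gm => i; under eq_fun do rewrite E; have [] := regular_monomial i hc.
move=> hphi hpsi K K'; have [f fE] := ex _ hphi; have [g gE] := ex _ hpsi.
have [||||a aE] := @exists_aut k T f g.
- exact/morphism_regular/(morph _ _ hphi fE).
- exact/morphism_regular/(morph _ _ hpsi gE).
- by move=> x; apply: coords_inj; rewrite gE fE K //; apply: coords_nz.
- by move=> x; apply: coords_inj; rewrite fE gE K' //; apply: coords_nz.
by exists a => x; rewrite aE.
Qed.

Definition mact A t : 'I_n -> k := fun i => \prod_j t j ^ A i j.

Lemma mact_monomial A : monomial_map (mact A).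
Proof. by move=> i; exists 1, (A i); rewrite oner_neq0; split=> // t _; rewrite mul1r. Qed.

Lemma mact_nz A t : nz t -> nz (mact A t).
Proof. exact/monomial_map_nz/mact_monomial. Qed.

Lemma mact1 t : mact 1%:M t = t.
Proof.
apply/funext => i; rewrite /mact (bigD1 i) //= mxE eqxx expr1z big1 ?mulr1 // => j ji.
by rewrite mxE eq_sym (negbTE ji) expr0z.
Qed.

Lemma mactM A B t : nz t -> mact (A *m B) t = mact A (mact B t).
Proof.
move=> t0; apply/funext => i; rewrite /mact.
under [RHS]eq_bigr do rewrite prod_exprz.
rewrite exchange_big; apply: eq_bigr => j _; rewrite prod_expz_sum // mxE.
by congr (_ ^ _); apply: eq_bigr => l _; rewrite mulrC.
Qed.

Lemma mact_mul A t t' : mact A (fun i => t i * t' i) = fun i => mact A t i * mact A t' i.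
Proof.
by apply/funext => i; rewrite -big_split; apply: eq_bigr => j _; rewrite expfzMl.
Qed.

Lemma monomial_aut A B : A *m B = 1%:M -> B *m A = 1%:M ->
  exists a : GT, forall x, coords (a x) = mact A (coords x).
Proof.
move=> AB BA; apply: (Gm_aut (mact_monomial A) (mact_monomial B)) => t t0.
  by rewrite -mactM // BA mact1.
by rewrite -mactM // AB mact1.
Qed.

Lemma translation t : exists a : GT, nz t ->
  forall x, coords (a x) = fun i => t i * coords x i.
Proof.
have [t0|] := pselect (nz t); last by exists 1%g.
have scal s : nz s -> monomial_map (fun t' i => s i * t' i).
  move=> s0 i; exists (s i), (fun j => (j == i)%:R); split=> // t' _; congr (_ * _).
  rewrite (bigD1 i) //= eqxx expr1z big1 ?mulr1 // => j /negbTE ->.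
  by rewrite expr0z.
have [|||a aE] := @Gm_aut (fun t' i => t i * t' i) (fun t' i => (t i)^-1 * t' i) (scal _ t0).
- by apply: (scal (fun i => (t i)^-1)) => i; rewrite invr_neq0.
- by move=> s _; apply/funext => i; rewrite mulKf.
- by move=> s _; apply/funext => i; rewrite mulVKf.
by exists a.
Qed.

(** Arbitrary unless all [t i] are nonzero. *)
Definition tr t : GT := sval (cid (translation t)).

Lemma trE t x : nz t -> coords (tr t x) = fun i => t i * coords x i.
Proof. by rewrite /tr; case: cid => a /= h t0; rewrite h. Qed.

Lemma aut_eq_coords (a b : GT) : (forall x, coords (a x) = coords (b x)) -> a = b.
Proof. by move=> h; apply: aut_eq => x; apply: coords_inj. Qed.

Lemma nz_mul t t' : nz t -> nz t' -> nz (fun i => t i * t' i).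
Proof. by move=> h h' i; rewrite mulf_neq0. Qed.

Lemma nz_inv t : nz t -> nz (fun i => (t i)^-1).
Proof. by move=> h i; rewrite invr_neq0. Qed.

Lemma nz1 : nz (fun=> 1).
Proof. by move=> i; apply: oner_neq0. Qed.

Lemma tr_mul t t' : nz t -> nz t' -> tr (fun i => t i * t' i) = (tr t * tr t')%g.
Proof.
move=> t0 t'0; apply: aut_eq_coords => x.
change (coords (tr (fun i => t i * t' i) x) = coords (tr t (tr t' x))).
by rewrite !trE //; [apply/funext => i; rewrite mulrA|apply: nz_mul].
Qed.

Lemma tr1 : tr (fun=> 1) = 1%g.
Proof.
apply: aut_eq_coords => x; rewrite trE; last exact: nz1.
by apply/funext => i; rewrite mul1r.
Qed.

Lemma trV t : nz t -> tr (fun i => (t i)^-1) = (tr t)^-1%g.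
Proof.
move=> t0; have t0V := nz_inv t0.
suff e : (tr (fun i => (t i)^-1)%R * tr t)%g = 1%g.
  by rewrite -[LHS]mulg1 -(mulgV (tr t)) mulgA e mul1g.
rewrite -tr_mul // -tr1; congr tr; apply/funext => i; exact: mulVf.
Qed.

Lemma Gm_unit_point : exists x : T, coords x = fun=> 1.
Proof. exact/Gm_coords/nz1. Qed.

Lemma tr_inj t t' : nz t -> nz t' -> tr t = tr t' -> t = t'.
Proof.
move=> t0 t'0 e; have [x1 x1E] := Gm_unit_point.
have := trE x1 t0; rewrite e trE // x1E => E; apply/funext => i.
by have := congr1 (@^~ i) E; rewrite !mulr1.
Qed.

Lemma tr_comm t t' : nz t -> nz t' -> (tr t * tr t')%g = (tr t' * tr t)%g.
Proof. by move=> t0 t'0; rewrite -!tr_mul //; congr tr; apply/funext => i; rewrite mulrC. Qed.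

(** Translations are transitive on points, so such a [g] is determined by the image of the unit
    point. *)
Lemma tr_cent (g : GT) : (forall t, nz t -> (g * tr t)%g = (tr t * g)%g) ->
  exists t, nz t /\ g = tr t.
Proof.
move=> h; have [x1 x1E] := Gm_unit_point.
exists (coords (g x1)); split; first exact: coords_nz.
apply: aut_eq_coords => x; rewrite trE; last exact: coords_nz.
have xE : x = tr (coords x) x1.
  by apply: coords_inj; rewrite trE ?x1E; [apply/funext => i; rewrite mulr1|apply: coords_nz].
rewrite {1}xE; change (g (tr (coords x) x1)) with ((g * tr (coords x))%g x1).
rewrite h; last exact: coords_nz.
change (coords (tr (coords x) (g x1)) = fun i => coords (g x1) i * coords x i).
by rewrite trE; [apply/funext => i; rewrite mulrC|apply: coords_nz].
Qed.

Lemma mact_tr (g : GT) A (c : 'I_n -> k) :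
  (forall x i, coords (g x) i = c i * mact A (coords x) i) ->
  forall t, nz t -> (g * tr t)%g = (tr (mact A t) * g)%g.
Proof.
move=> gE t t0; apply: aut_eq_coords => x.
change (coords (g (tr t x)) = coords (tr (mact A t) (g x))).
rewrite trE; last exact: mact_nz.
by apply/funext => i; rewrite !gE trE // mact_mul mulrCA.
Qed.

(** The coordinates of an automorphism are units, hence monomials up to constants. *)
Lemma aut_monomial (g : GT) : exists A (c : 'I_n -> k),
  forall x i, coords (g x) i = c i * mact A (coords x) i.
Proof.
have /choice[d dE] : forall i, exists d : k * ('I_n -> int),
    forall x, tcrd i (g x) = d.1 * \prod_j tcrd j x ^ d.2 j.
  move=> i; have [|||c [a [_ E]]] := @unit_monomial k n k_unc (fun x => tcrd i (g x))
    (fun x => (tcrd i (g x))^-1).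
  - exact/regular_aut/regular_tcrd.
  - exact/(@regular_aut _ _ g (fun x => (tcrd i x)^-1))/regular_tcrdV.
  - by move=> x; rewrite mulfV // tcrd_neq0.
  by exists (c, a).
exists (\matrix_(i, j) (d i).2 j), (fun i => (d i).1) => x i.
rewrite [LHS]dE; congr (_ * _); apply: eq_bigr => j _.
by rewrite mxE.
Qed.

(* There are only countably many exponent matrices. *)
Lemma translation_index (F : k -> GT) : exists c c', c != c' /\
  exists t, nz t /\ ((F c)^-1 * F c')%g = tr t.
Proof.
have /choice[A AE] : forall c, exists A, exists d : 'I_n -> k,
    forall x i, coords (F c x) i = d i * mact A (coords x) i.
  by move=> c; have [A h] := aut_monomial (F c); exists A.
have [e unce] := uncountable_fiber (fun c => pickle (A c)) k_unc.
have [s [us ss sA]] := uncountable_uniq_seq 2 unce.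
case: s us ss sA => [|c [|c' [|]]] //= us _ sA.
have [_ ce] := sA c (mem_head _ _).
have [_ ce'] : ([set: k] `&` [set x | pickle (A x) = e]) c' by apply: sA; rewrite !inE eqxx orbT.
exists c, c'; split; first by move: us; rewrite inE andbT.
apply: tr_cent => t t0.
have [d /mact_tr h] := AE c; have [d' /mact_tr h'] := AE c'.
have EA : A c = A c' by apply: (pcan_inj pickleK); rewrite ce ce'.
have hV : ((F c)^-1 * tr (mact (A c) t))%g = (tr t * (F c)^-1)%g.
  by apply: (mulgI (F c)); rewrite mulVKg mulgA h // mulgK.
by rewrite -mulgA h' // -EA mulgA hV mulgA.
Qed.

Lemma inversion : exists g : GT, forall t, nz t ->
  (g * tr t)%g = (tr (fun i => (t i)^-1)%R * g)%g.
Proof.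
have [||g gE] := @monomial_aut (- 1%:M) (- 1%:M); try by rewrite mulNmx mulmxN mul1mx opprK.
exists g => t t0; rewrite (@mact_tr g (- 1%:M) (fun=> 1) _ t t0) => [|x i]; last first.
  by rewrite gE mul1r.
congr (tr _ * _)%g; apply/funext => i; rewrite /mact (bigD1 i) //= !mxE eqxx.
rewrite exprN1 big1 ?mulr1 // => j /negbTE ji.
by rewrite !mxE eq_sym ji oppr0 expr0z.
Qed.

(* GL_n(Z) acts transitively on the nonzero vectors modulo 2. *)
Lemma sign_transitive (v : 'cV[bool]_n) (i j : 'I_n) : v j 0 ->
  exists (A B : 'M[int]_n), [/\ A *m B = 1%:M, B *m A = 1%:M &
    mact A (fun l => (-1) ^+ v l 0) = fun l => (-1) ^+ (l == i)].
Proof.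
move=> vj; pose w : 'cV[int]_n := \col_l (v l 0 && (l != j))%:R.
pose ej : 'rV[int]_n := delta_mx 0 j.
have ejw : ej *m w = 0.
  by apply/matrixP => a b; rewrite -rowE !mxE eqxx andbF.
(* [E] subtracts from [v] the column [w] of its other ones, leaving the basis vector at [j]; [P]
   moves it to [i]. *)
pose E := 1%:M - w *m ej; pose E' := 1%:M + w *m ej; pose P : 'M[int]_n := tperm_mx i j.
have PP : P *m P = 1%:M by rewrite /P /tperm_mx -perm_mxM perm.tperm2 perm_mx1.
have wejwej : w *m ej *m (w *m ej) = 0 by rewrite mulmxA -(mulmxA w) ejw mulmx0 mul0mx.
have EE' : E *m E' = 1%:M.
  by rewrite mulmxBl !mulmxDr !mulmx1 !mul1mx wejwej addr0 addrK.
have E'E : E' *m E = 1%:M.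
  by rewrite mulmxDl !mulmxBr !mulmx1 !mul1mx wejwej subr0 subrK.
exists (P *m E), (E' *m P); split.
- by rewrite mulmxA -(mulmxA P) EE' mulmx1.
- by rewrite mulmxA -(mulmxA E') PP mulmx1.
pose vz : 'cV[int]_n := \col_l (v l 0)%:R.
have ejv : ej *m vz = 1%:M.
  by apply/matrixP => a b; rewrite -rowE !ord1 !mxE vj.
have Evz : P *m E *m vz = delta_mx i 0.
  have -> : P *m E *m vz = P *m (delta_mx j 0 : 'cV_n).
    rewrite -mulmxA mulmxBl mul1mx -mulmxA ejv mulmx1; congr (_ *m _).
    apply/matrixP => a b; rewrite !ord1 !mxE andbT.
    by have [->|_] := eqVneq a j; rewrite ?vj ?andbF ?andbT ?subr0 ?subrr.
  rewrite /P -xrowE; apply/matrixP => a b; rewrite !mxE.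
  case: perm.tpermP => [->|->|/eqP/negbTE ai /eqP/negbTE aj]; rewrite ?eqxx ?ai ?aj //.
  by rewrite eq_sym.
apply/funext => l; rewrite /mact.
under eq_bigr do rewrite exprnP exprz_exp.
rewrite prod_expz_sum ?oppr_eq0 ?oner_eq0 //.
have := congr1 (fun X : 'cV_n => X l 0) Evz; rewrite [LHS]mxE => e.
rewrite (_ : \sum_l' _ = (l == i)%:R); last first.
  transitivity ((delta_mx i 0 : 'cV[int]_n) l 0); last by rewrite mxE andbT.
  by rewrite -e; apply: eq_bigr => l' _; rewrite [vz _ _]mxE mulrC natz.
by rewrite natz -exprnP.
Qed.

End TorusAutomorphisms.

(** * The theorem *)

Section Assembly.
Variables (k : closedFieldType) (Y : irr_affine_variety k) (n : nat).
Hypothesis char0 : [pchar k] =i pred0.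
Hypothesis k_unc : ~ countable [set: k].
Hypothesis dimY : (krull_dim Y <= n)%N.
Local Notation GT := (Aut (Gm_power k n)).
Local Notation G := (Aut Y).
Variables (Phi : GT -> G) (Psi : G -> GT).
Hypothesis PhiM : {morph Phi : g h / (g * h)%g}.
Hypotheses (PhiK : cancel Phi Psi) (PsiK : cancel Psi Phi).

Let theta (t : 'I_n -> k) : G := Phi (tr t).
Let T : set G := [set g | exists t, nz t /\ g = theta t].

Let Phi1 : Phi 1%g = 1%g.
Proof. by apply: (mulgI (Phi 1%g)); rewrite -PhiM !mulg1. Qed.

Let PhiV g : Phi g^-1%g = (Phi g)^-1%g.
Proof. by apply: (mulgI (Phi g)); rewrite -PhiM !mulgV Phi1. Qed.

Let thetaM t t' : nz t -> nz t' -> theta (fun i => t i * t' i) = (theta t * theta t')%g.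
Proof. by move=> t0 t'0; rewrite /theta tr_mul // PhiM. Qed.

Let theta1 : theta (fun=> 1) = 1%g.
Proof. by rewrite /theta tr1 Phi1. Qed.

Let theta_inj t t' : nz t -> nz t' -> theta t = theta t' -> t = t'.
Proof. by move=> t0 t'0 /(can_inj PhiK); apply: tr_inj. Qed.

Let T_subgroup : is_subgroup T.
Proof.
split.
- by exists (fun=> 1); rewrite theta1; split=> //; apply: nz1.
- move=> _ _ [t [t0 ->]] [t' [t'0 ->]]; exists (fun i => t i * t' i).
  by split; [apply: nz_mul|rewrite thetaM].
- move=> _ [t [t0 ->]]; exists (fun i => (t i)^-1).
  by split; [apply: nz_inv|rewrite /theta trV // PhiV].
Qed.

Let T_comm s t : T s -> T t -> (s * t)%g = (t * s)%g.
Proof. by move=> [u [u0 ->]] [v [v0 ->]]; rewrite /theta -!PhiM tr_comm. Qed.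

Let T_cent (g : G) : (forall t, T t -> (g * t)%g = (t * g)%g) -> T g.
Proof.
move=> h; have [t t0|t [t0 gE]] := @tr_cent k n (Psi g).
  apply: (can_inj PhiK); rewrite !PhiM !PsiK; apply: h; by exists t.
by exists t; split=> //; rewrite /theta -gE PsiK.
Qed.

Let T_index (F : k -> G) : exists c c', c != c' /\ T ((F c)^-1 * F c')%g.
Proof.
have [c [c' [cc [t [t0 tE]]]]] := translation_index k_unc (fun c => Psi (F c)).
exists c, c'; split=> //; exists t; split=> //.
by rewrite /theta -tE PhiM PhiV !PsiK.
Qed.

Let T_uncountable (i0 : 'I_n) : ~ countable T.
Proof.
move=> /countable_injP[f finj].
pose t (c : k) (i : 'I_n) : k := if c == 0 then 1 else c.
have t0 c : nz (t c) by move=> i; rewrite /t; have [_|//] := eqVneq c 0; apply: oner_neq0.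
have [e unce] := uncountable_fiber (fun c => f (theta (t c))) k_unc.
(* Three elements, because the parameters 0 and 1 give the same translation. *)
have [s [us ss sA]] := uncountable_uniq_seq 3 unce.
have same c c' : c \in s -> c' \in s -> t c i0 = t c' i0.
  move=> /sA[_ ce] /sA[_ ce']; have := finj (theta (t c)) (theta (t c')).
  have mT d : theta (t d) \in T by apply/mem_set; exists (t d).
  by move=> /(_ (mT _) (mT _)) h; rewrite (theta_inj (t0 c) (t0 c')) // h // ce ce'.
case: s us ss {sA} same => [|c1 [|c2 [|c3 [|]]]] //= us _ same.
have h12 := same c1 c2; have h13 := same c1 c3; have h23 := same c2 c3.
move: us h12 h13 h23; rewrite !inE !eqxx !orbT !negb_or /t.
move=> /andP[/andP[c12 c13] /andP[c23 _]] /(_ isT isT) h12 /(_ isT isT) h13 /(_ isT isT) h23.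
move: h12 h13 h23 c12 c13 c23.
case: (c1 =P 0) => [->|_]; case: (c2 =P 0) => [->|_]; case: (c3 =P 0) => [->|_] //;
  by [rewrite eqxx|move=> -> _ _; rewrite eqxx|move=> _ -> _; rewrite eqxx|move=> _ _ -> ; rewrite eqxx].
Qed.

(* Roots of unity form a countable set. *)
Let exists_infinite_order (W : set G) : W `<=` T -> ~ countable W ->
  exists w v, [/\ W w, W v & forall m, (0 < m)%N -> ((w * v^-1) ^+ m)%g <> 1%g].
Proof.
move=> WT Wunc; apply: contrapT => none.
have [v Wv] : exists v, W v.
  by apply: contrapT => /forallNP h; apply: Wunc; rewrite (_ : W = set0) //; apply/seteqP; split.
have [u [u0 vE]] := WT _ Wv.
have /choice[r rE] : forall m, exists r : seq k, ('X^(m.+1) - 1%:P : {poly k}) = \prod_(z <- r) ('X - z%:P).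
  move=> m; have [r rE] := closed_field_poly_normal ('X^(m.+1) - 1%:P : {poly k}); exists r.
  by rewrite {1}rE (monicP (monicXnsubC 1 (ltn0Sn m))) scale1r.
have /choice[t tP] : forall w, exists t, W w -> nz t /\ w = theta t.
  move=> w; have [Ww|] := pselect (W w); last by exists (fun=> 1).
  by have [t tE] := WT _ Ww; exists t.
have /choice[m mP] : forall w, exists m, W w -> ((w * v^-1) ^+ m.+1)%g = 1%g.
  move=> w; have [Ww|] := pselect (W w); last by exists 0%N.
  apply: contrapT => /forallNP h; apply: none; exists w, v; split=> // -[//|l] _ e.
  by apply: (h l).
pose q w i := t w i / u i.
have qr w i : W w -> q w i \in r (m w).
  move=> Ww; have [t0 wE] := tP w Ww.
  have q0 : nz (q w) by move=> l; rewrite mulf_neq0 ?invr_neq0.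
  have qE : (w * v^-1)%g = theta (q w).
    rewrite {1}wE vE /theta -PhiV -PhiM -trV // -tr_mul //; exact: nz_inv.
  have qX l : nz (fun i => q w i ^+ l) /\ ((w * v^-1) ^+ l)%g = theta (fun i => q w i ^+ l).
    split=> [j|]; first by rewrite expf_neq0.
    elim: l => [|l IH]; first by rewrite expg0 -theta1.
    rewrite expgS IH qE -thetaM //; first by congr theta; apply/funext => j; rewrite exprS.
    by move=> j; rewrite expf_neq0.
  have [n1 e1] := qX (m w).+1.
  have := mP w Ww; rewrite e1 -theta1 => /(theta_inj n1 (@nz1 _ _))/(congr1 (@^~ i)) /= qm.
  rewrite -root_prod_XsubC -rE rootE !hornerE qm subrr; exact: eqxx.
(* As [v] is fixed, [w] is determined by the order of the quotient and by the positions of its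
   coordinates among the roots of unity. *)
pose code w := pickle (m w, [ffun i => index (q w i) (r (m w))]).
have [e unce] := uncountable_fiber code Wunc.
have [s [us ss sA]] := uncountable_uniq_seq 2 unce.
case: s us ss sA => [|w [|w' [|]]] //= us _ sA.
have [Ww we] := sA w (mem_head _ _).
have [Ww' we'] : (W `&` [set w | code w = e]) w' by apply: sA; rewrite !inE eqxx orbT.
move: us; rewrite inE andbT => /eqP; apply.
have : code w = code w' by rewrite we we'.
move=> /(pcan_inj pickleK)[em /ffunP ei].
have [t0 ->] := tP w Ww; have [t0' ->] := tP w' Ww'.
congr theta; apply/funext => i; have := ei i; rewrite !ffunE => ei'.
have u0i := u0 i; apply: (mulIf (invr_neq0 u0i)); change (q w i = q w' i).
by rewrite -(nth_index 0 (qr w i Ww)) ei' -em nth_index // em qr.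
Qed.

Let theta_act t t' y : nz t -> nz t' ->
  theta t (theta t' y) = theta (fun i => t i * t' i) y.
Proof. by move=> t0 t'0; rewrite thetaM. Qed.

(** The involution [theta tau], a sign in the coordinate [i0], excludes unipotent elements of [T].
    Since [a (-1)] lies in [T] and has square 1, it is a vector of signs. *)
Lemma sign_one_parameter (i0 : 'I_n) : exists (a : k -> G) (v : 'cV[bool]_n) j,
  [/\ v j 0, a (-1) = theta (fun l => (-1) ^+ v l 0), a 1 = 1%g &
   [/\ forall c, c != 0 -> T (a c),
      forall c d, c != 0 -> d != 0 -> a (c * d) = (a c * a d)%g &
      forall f, regular f -> weight_sum a f]].
Proof.
have [W [WT Wunc Wcs]] := uncountable_locally_finite k_unc T_subgroup (T_uncountable i0) T_comm.
have [w [v [Ww Wv inf]]] := exists_infinite_order WT Wunc.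
have [cs cs0 csP] := Wcs w v Ww Wv.
have [T1 TM TV] := T_subgroup.
have N1 : (1 : k) != -1.
  by rewrite -addr_eq0 -mulr2n; have /pcharf0P -> := char0.
have N0 : (-1 : k) != 0 by rewrite oppr_eq0 oner_neq0.
pose tau (l : 'I_n) : k := (-1) ^+ (l == i0).
have tau0 : nz tau by move=> l; rewrite expf_neq0.
have Tunip (u : G) M : T u -> (forall i y, diff u M (@crd k Y i) y = 0) -> u = 1%g.
  move=> Tu; apply: (unipotent_trivial char0 T_comm T_index Tu (tau := theta tau)).
  - by exists tau.
  - rewrite -thetaM // -theta1; congr theta; apply/funext => l.
    by rewrite -expr2 sqrr_sign.
  - rewrite -theta1 => /(theta_inj tau0 (@nz1 _ _))/(congr1 (@^~ i0)).
    by rewrite /tau eqxx expr1 => e; rewrite e eqxx in N1.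
have Ts : T (w * v^-1)%g by apply: TM; [apply: WT|apply/TV/WT].
have [a [aT aN aM aw]] := one_parameter char0 T_comm T_cent T1 TM Tunip Ts inf cs0 csP.
have a1 : a 1 = 1%g.
  by apply: (mulgI (a 1)); rewrite -aM ?oner_neq0 // mulr1 mulg1.
have [e [e0 aE]] := aT _ N0.
have esq l : e l = (-1) ^+ (e l == -1).
  have : theta (fun l => e l * e l) = theta (fun=> 1).
    by rewrite thetaM // -aE -aM // mulN1r opprK a1 theta1.
  move=> /theta_inj-/(_ (nz_mul e0 e0) (@nz1 _ _))/(congr1 (@^~ l))/eqP.
  rewrite -expr2 sqrf_eq1; have [->//|_] := eqVneq (e l) (-1).
  by rewrite orbF => /eqP.
have [j ej] : exists j, e j == -1.
  apply: contrapT => /forallNP none; apply: aN; rewrite aE -theta1; congr theta.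
  by apply/funext => l; rewrite esq; have /negP/negbTE -> := none l.
exists a, (\col_l (e l == -1)), j; split=> //; first by rewrite mxE.
by rewrite aE; congr theta; apply/funext => l; rewrite esq mxE -esq.
Qed.

Lemma weight_sum_conj (a : k -> G) (h : G) : (forall f, regular f -> weight_sum a f) ->
  forall f, regular f -> weight_sum (fun c => (h * a c * h^-1)%g) f.
Proof.
move=> aw f rf; have [I [m [F [Fr Fw fE]]]] := aw _ (regular_aut h rf).
exists I, m, (fun i y => F i ((h^-1)%g y)); split.
- by move=> i; apply: regular_aut.
- move=> i c y c0; change (F i ((h^-1)%g (h (a c ((h^-1)%g y)))) = c ^ m i * F i ((h^-1)%g y)).
  by rewrite autV Fw.
- by move=> y; rewrite -fE autVr.
Qed.

Theorem torus_of_group : isomorphic (Gm_power k n) Y.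
Proof.
(* For [n = 0] there is no coordinate [i0] to start from, and the empty family of gradings does. *)
have [noI|/existsNP[i0 _]] := pselect ('I_n -> False).
  by apply: (@torus_of_action k Y char0 k_unc n (fun i _ => 1%g) 1%g).
have [a [v [j [vj aN a1 [aT aM aw]]]]] := sign_one_parameter i0.
have /choice[g gP] : forall i : 'I_n, exists g : GT, exists A : 'M[int]_n,
    (forall t, nz t -> (g * tr t)%g = (tr (mact A t) * g)%g) /\
    mact A (fun l => (-1 : k) ^+ v l 0) = fun l => (-1) ^+ (l == i).
  move=> i; have [A [B [AB BA AE]]] := @sign_transitive k n v i j vj.
  have [g gE] := @monomial_aut k n A B AB BA; exists g, A; split=> // t t0.
  by rewrite (@mact_tr k n g A (fun=> 1) _ t t0) // => x l; rewrite gE mul1r.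
(* Conjugation by the monomial automorphism [g i] moves the signs of [a (-1)] to a single sign at
   [i]; of the other values it is only known that they stay in [T]. *)
pose b i c := (Phi (g i) * a c * (Phi (g i))^-1)%g.
have N0 : (-1 : k) != 0 by rewrite oppr_eq0 oner_neq0.
have conjT i t : nz t -> exists t', [/\ nz t',
    (Phi (g i) * theta t * (Phi (g i))^-1)%g = theta t' &
    t = (fun l => (-1) ^+ v l 0) -> t' = fun l => (-1) ^+ (l == i)].
  move=> t0; have [A [gA AE]] := gP i; exists (mact A t).
  split; [exact: mact_nz| |by move=> ->].
  by rewrite /theta -PhiM gA // PhiM mulgK.
have bT i c : c != 0 -> T (b i c).
  move=> c0; have [t [t0 aE]] := aT c c0; have [t' [t'0 E _]] := conjT i t t0.
  by exists t'; split=> //; rewrite /b aE.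
have bN i : b i (-1) = theta (fun l => (-1) ^+ (l == i)).
  have [|t' [_ E h]] := conjT i (fun l => (-1) ^+ v l 0); first by move=> l; rewrite expf_neq0.
  by rewrite /b aN E h.
have b1 i : b i 1 = 1%g by rewrite /b a1 mulg1 mulgV.
have bM i c d : c != 0 -> d != 0 -> b i (c * d) = (b i c * b i d)%g.
  by move=> c0 d0; rewrite /b aM // !mulgA mulgVK.
have [io ioE] := @inversion k n.
apply: (@torus_of_action k Y char0 k_unc n b (Phi io)) => //.
- move=> i l c d y c0 d0; change ((b i c * b l d)%g y = (b l d * b i c)%g y).
  by rewrite T_comm //; apply: bT.
- by move=> i f; apply: weight_sum_conj.
- move=> i c y c0; have [t [t0 bE]] := bT i c c0.
  have bV : b i c^-1 = (b i c)^-1%g.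
    by apply: (mulgI (b i c)); rewrite -bM ?invr_neq0 // mulfV // b1 mulgV.
  change ((Phi io * b i c)%g y = (b i c^-1%R * Phi io)%g y).
  by rewrite bV bE /theta -PhiV -trV // -!PhiM ioE.
(* For signs, the joint action of the [b l] is the image of the translation with these signs, so
   faithfulness follows from injectivity of [theta]. *)
move=> c cs cact.
have c0 : nz c by move=> l; case: (cs l) => ->; rewrite ?oner_neq0.
pose part (s : seq 'I_n) l := if l \in s then c l else 1.
have part0 s : nz (part s) by move=> l; rewrite /part; case: ifP => _; rewrite ?oner_neq0.
have actE s y : uniq s -> foldr (fun l => b l (c l)) y s = theta (part s) y.
  elim: s => [|l s IH].
    by rewrite (_ : part [::] = fun=> 1) ?theta1.
  rewrite cons_uniq => /andP[ls us].
  transitivity (b l (c l) (theta (part s) y)); first by rewrite -IH.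
  have bl : b l (c l) = theta (fun m => if m == l then c l else 1).
    case: (cs l) => cl; rewrite cl ?bN ?b1 -?theta1; congr theta; apply/funext => m.
      by case: ifP.
    by case: eqP => _; rewrite ?expr0 ?expr1.
  rewrite bl theta_act //; last by move=> m; case: ifP => _; rewrite ?oner_neq0.
  congr (theta _ y); apply/funext => m; rewrite /part inE.
  by have [->|_] := eqVneq m l; rewrite ?(negbTE ls) ?mulr1 ?mul1r.
have thc : theta c = 1%g.
  apply: aut_eq => y; rewrite -[RHS](cact y) /torus_act actE ?enum_uniq //.
  by congr (theta _ y); apply/funext => l; rewrite /part mem_enum.
move=> l; rewrite -theta1 in thc.
by rewrite (theta_inj c0 (@nz1 _ _) thc).
Qed.

End Assembly.

Lemma isomorphic_trans (k : fieldType) (X X' X'' : affine_variety k) :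
  isomorphic X X' -> isomorphic X' X'' -> isomorphic X X''.
Proof.
move=> [f [g [mf mg fg gf]]] [f' [g' [mf' mg' fg' gf']]].
by exists (f' \o f), (g \o g'); split; [exact: morphism_comp|exact: morphism_comp|
  exact: can_comp|exact: can_comp].
Qed.

Lemma aut_iso (k : fieldType) (X X' : affine_variety k) (f : X -> X') (g : X' -> X) :
  morphism f -> morphism g -> cancel f g -> cancel g f ->
  exists c : Aut X -> Aut X', forall a x, c a x = f (a (g x)).
Proof.
move=> mf mg fg gf.
suff /choice[c cE] : forall a : Aut X, exists c : Aut X', forall x, c x = f (a (g x)) by exists c.
move=> a; have [||||c cE] := @exists_aut k X' (fun x => f (a (g x))) (fun x => f ((a^-1)%g (g x))).
- apply/morphism_regular/(@morphism_comp k _ _ _ f (a \o g)) => //.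
  exact/morphism_comp/mg/aut_morphism.
- apply/morphism_regular/(@morphism_comp k _ _ _ f ((a^-1)%g \o g)) => //.
  exact/morphism_comp/mg/aut_morphism.
- by move=> x; rewrite fg autV gf.
- by move=> x; rewrite fg autVr gf.
by exists c.
Qed.

Local Close Scope ring_scope.
Local Close Scope classical_set_scope.

Theorem theorem5 (k : closedFieldType) (char0 : [pchar k]%R =i pred0)
    (k_uncountable : ~ countable [set: k]%classic)
    (X : affine_variety k) (X_torus : algebraic_torus X)
    (Y : irr_affine_variety k) (Y_normal : normal_variety Y)
    (Aut_iso : group_isomorphic (Aut X) (Aut Y))
    (dim_le : krull_dim Y <= krull_dim X) :
  isomorphic X Y.
Proof.
have [n XT] := X_torus; have [phi [psi phiK psiK]] := Aut_iso.
apply: (isomorphic_trans XT).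
have [f [g [mf mg fg gf]]] := XT.
(* Conjugation by [f] and [g] carries the isomorphism of groups over to the standard torus. *)
have [c cE] := aut_iso mg mf gf fg; have [d dE] := aut_iso mf mg fg gf.
apply: (@torus_of_group k Y n char0 k_uncountable _ (fun a => phi (c a))
  (fun h => d (psi h))).
- exact: leq_trans dim_le (krull_dim_torus XT).
- move=> a b; rewrite -gmulfM; congr (phi _); apply: aut_eq => x.
  by rewrite cE; change (g (a (b (f x))) = c a (c b x)); rewrite !cE gf.
- by move=> a; rewrite phiK; apply: aut_eq => x; rewrite dE cE !gf.
- by move=> h; apply: (canLR psiK); apply: aut_eq => x; rewrite cE dE !fg.
Qed.
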